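(* Let $q$ be the fixed cardinality of the finite field $\mathbb{F}_q$ and assume $q\equiv 1\pmod 4$. Then, as $g\to\infty$, with $|D|=q^{2g+1}$, $$\frac{1}{\#\mathcal{H}_{2g+1,q}}\sum_{D\in\mathcal{H}_{2g+1,q}}P_{C_D}(q^{-1/2})\sim\frac12P(1)\log_q|D|=\frac12P(1)(2g+1),$$ where $$P(s)=\prod_{\substack{P\ \mathrm{monic}\\ \mathrm{irreducible}}}\left(1-\frac{1}{(|P|+1)|P|^{s}}\right),$$ the product being over monic irreducible polynomials in $\mathbb{F}_q[x]$.
   Context: For nonzero $f\in\mathbb{F}_q[x]$, $|f|=q^{\deg f}$. $\mathcal{H}_{2g+1,q}$ is the set of monic square-free polynomials $D\in\mathbb{F}_q[x]$ of degree $2g+1$ ($g\ge 1$). For $D\in\mathcal{H}_{2g+1,q}$, $C_D$ is the hyperelliptic curve of genus $g$ with affine equation $y^2=D(x)$, and $P_{C_D}(u)$ is the numerator of its zeta function $Z_{C_D}(u)=\exp\left(\sum_{n\ge1}\#C_D(\mathbb{F}_{q^n})\,u^n/n\right)=\frac{P_{C_D}(u)}{(1-u)(1-qu)}$, a polynomial in $\mathbb{Z}[u]$ of degree $2g$ with $P_{C_D}(0)=1$. Equivalently, $P_{C_D}(u)=\mathcal{L}(u,\chi_D)=\sum_{n\ge 0}\Big(\sum_{f\text{ monic},\,\deg f=n}\chi_D(f)\Big)u^n$, a polynomial in $u$, where $\chi_D(f)=\left(\frac{D}{f}\right)$ is the Jacobi symbol in $\mathbb{F}_q[x]$ (equal to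 $0$ if $D,f$ are not coprime). *)

(* Defs.v *)
From HB Require Import structures.
From mathcomp Require Import all_boot all_order all_algebra all_field.
From mathcomp Require Import all_classical all_reals all_analysis.

Set Implicit Arguments.
Unset Strict Implicit.
Unset Printing Implicit Defensive.

Import Order.TTheory GRing.Theory Num.Theory.
Import numFieldNormedType.Exports.

Local Open Scope ring_scope.

(* Taking h = 'X shows that 0 is not squarefree. *)
Definition squarefree (F : fieldType) (D : {poly F}) : Prop :=
  forall h : {poly F}, size h != 1%N -> ~~ (h ^+ 2 %| D).

(* {poly_n F} is the type of polynomials of size at most n, that is, of degree
   less than n; size D = 2g + 2 means deg D = 2g + 1. *)
Definition hyper_ensemble (F : finFieldType) (g : nat) :
    {set {poly_(2 * g + 2) F}} :=
  [set D : {poly_(2 * g + 2) F} |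
    [&& size D == (2 * g + 2)%N, (D : {poly F}) \is monic
      & `[< squarefree (D : {poly F}) >]]].

Lemma XnsubX_neq0 (F : finFieldType) (n : nat) :
  ('X^(#|F| ^ n.+1) - 'X : {poly F}) != 0.
Proof.
have q1 : (1 < #|F| ^ n.+1)%N.
  by rewrite -(exp1n n.+1) ltn_exp2r // finNzRing_gt1.
rewrite -size_poly_eq0 size_polyDl ?size_polyXn //.
by rewrite size_polyN size_polyX ltnS.
Qed.

(* For n > 0, the extension of degree n of F, as the splitting field of
   'X^(q^n) - 'X with q = #|F|; the value at n = 0 is irrelevant. *)
Definition ext_field (F : finFieldType) (n : nat) : splittingFieldType F :=
  sval (FinSplittingFieldFor (XnsubX_neq0 F n.-1)).

Lemma card_ext_field (F : finFieldType) (n : nat) : (0 < n)%N ->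
  #|finvect_type (ext_field F n)| = (#|F| ^ n)%N.
Proof.
move=> n_gt0; rewrite /ext_field; case: FinSplittingFieldFor => L /=.
rewrite prednK //; set m := (#|F| ^ n)%N => splitL.
have m_gt1 : (1 < m)%N.
  by rewrite /m -(exp1n n) ltn_exp2r // finNzRing_gt1.
have m1_gt0 : (0 < m.-1)%N by rewrite -ltnS prednK // ltnW.
pose q (S : nzRingType) : {poly S} := 'X^m - 'X.
have Dq (S : nzRingType) : q S = ('X^(m.-1) - 1) * ('X - 0).
  by rewrite /q subr0 mulrBl mul1r -exprSr prednK // ltnW.
rewrite [map_poly _ _]rmorphB rmorphXn /= map_polyX -/(q L) in splitL.
have /finField_galois_generator[/= a _ Da] : (1 <= {:L})%VS by apply: sub1v.
pose Em := fixedSpace (a ^+ n)%g; rewrite /= dimv1 expn1 in Da.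
have m0 : m%:R = 0 :> L.
  have F0 : #|F|%:R = 0 :> F.
    have shift : \sum_(x : F) x = \sum_(x : F) x + #|F|%:R.
      rewrite -[in #|F|%:R]sumr_const -big_split /=.
      by rewrite [LHS](reindex_inj (addIr 1)).
    by move: shift; rewrite -[LHS]addr0 => /addrI.
  by rewrite natrX -(rmorph_nat (in_alg L)) F0 rmorph0 expr0n gtn_eqF.
have{splitL} [zs DqL defL] := splitL.
have Uzs : uniq zs.
  rewrite -separable_prod_XsubC -(eqp_separable DqL) Dq separable_root andbC.
  rewrite /root !hornerE subr_eq0 eq_sym expr0n gtn_eqF ?oner_eq0 //=.
  rewrite cyclotomic.separable_Xn_sub_1 // -subn1 natrB ?(ltnW m_gt1) //.
  by rewrite m0 sub0r oppr_eq0 oner_eq0.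
have in_zs : zs =i Em.
  move=> z; rewrite -root_prod_XsubC -(eqp_root DqL) (sameP fixedSpaceP eqP).
  rewrite /root !hornerE subr_eq0 /= /m; congr (_ == z).
  elim: (n) => [|i IHi]; first by rewrite gal_id.
  by rewrite expgSr expnSr exprM IHi galM ?Da ?memvf.
have defEm : Em = {:L}%VS.
  apply/eqP; rewrite eqEsubv subvf -defL -[Em]subfield_closed agenvS //.
  by rewrite subv_add sub1v; apply/span_subvP=> z; rewrite in_zs.
have /eq_card-> : finvect_type L =i zs by move=> z; rewrite in_zs defEm memvf.
apply: succn_inj; rewrite (card_uniqP _) //= -(size_prod_XsubC _ id).
by rewrite -(eqp_size DqL) size_polyDl size_polyXn // size_polyN size_polyX.
Qed.

(* The number of points over the extension of degree n of F of the smooth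
   projective model of y^2 = D(x), for D of odd degree: the affine points, and
   the unique point at infinity, which is rational. *)
Definition curve_points (F : finFieldType) (D : {poly F}) (n : nat) : nat :=
  let L := ext_field F n in
  (#|[set xy : finvect_type L * finvect_type L |
      (xy.2 ^+ 2 : L) == (map_poly (in_alg L) D).[xy.1]]|).+1.

(* The coefficient of u^n in the formal power series
   exp(sum_(k >= 1) a_k u^k); only the terms a_k u^k with k <= n and the
   powers up to n of the series contribute to it. *)
Definition exp_series_coef (a : nat -> rat) (n : nat) : rat :=
  (\sum_(j < n.+1)
     (j`!%:R)^-1 *: (\sum_(1 <= k < n.+1) a k *: 'X^k) ^+ j : {poly rat})`_n.

Definition zeta_coef (F : finFieldType) (D : {poly F}) : nat -> rat :=
  exp_series_coef (fun k => (curve_points D k)%:R / k%:R).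

(* P = (1 - u) (1 - q u) Z(u) in Q[[u]], coefficient by coefficient. *)
Definition is_zeta_numerator (F : finFieldType) (D : {poly F})
    (P : {poly int}) : Prop :=
  forall n, (P`_n)%:~R =
    ((1 - 'X) * (1 - #|F|%:R *: 'X) * \poly_(i < n.+1) zeta_coef D i)`_n.

(* At most one polynomial satisfies is_zeta_numerator; the default value 0 is
   used only if there is none. *)
Definition zeta_numerator (F : finFieldType) (D : {poly F}) : {poly int} :=
  xget 0 [set P | is_zeta_numerator D P]%classic.

(* The norm q^(deg f), for nonzero f. *)
Definition poly_norm (R : realType) (F : finFieldType) (f : {poly F}) : R :=
  #|F|%:R ^+ (size f).-1.

(* The product over all monic irreducible polynomials, as the limit of the
   products over those of degree less than n. *)
Definition euler_prod (R : realType) (F : finFieldType) (s : R) : R :=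
  limn (fun n => \prod_(P : {poly_n F} |
      ((P : {poly F}) \is monic) && `[< irreducible_poly (P : {poly F}) >])
    (1 - ((poly_norm R P + 1) * (poly_norm R P `^ s))^-1)).

Definition log_base (R : realType) (b x : R) : R := ln x / ln b.

Definition mean_zeta_numerator (R : realType) (F : finFieldType) (g : nat) : R :=
  (#|hyper_ensemble F g|%:R)^-1 *
  \sum_(D in hyper_ensemble F g)
    (map_poly intr (zeta_numerator D)).[#|F|%:R `^ (- 2^-1)].

(* Main.v *)
(* Write L_n(D) for the sum of chi_D over monic polynomials of degree n, so that
   P_{C_D}(u) is the sum of the L_n(D) u^n; this identification compares
   logarithmic derivatives, using that x in F_{q^k} with minimal polynomial P of
   degree d contributes chi_D(P)^(k/d) to the point count, by Euler's criterion.

   The functional equation L_{2g-n} = q^(g-n) L_n is obtained without the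
   Riemann-Roch theorem: the number of pairs (f, V) with f monic of degree n,
   deg V < n and f | V^2 - D has generating series
   L(u) (1 - q u^2) / (1 - q u), and it satisfies a recurrence coming from the
   involution f <-> (V^2 - D) / f.

   It follows that P_{C_D}(q^(-1/2)) is the sum of L_n(D) q^(-n/2) over n <= g plus
   the same sum over n < g.  Average over D.  For f not a square, the sum of
   chi_D(f) over all monic D of degree N vanishes once N >= deg f, and sieving for
   squarefree D leaves a total contribution O(1).  The squares f = l^2 contribute
   the density of coprime pairs (D, l) with D squarefree, which tends to P(1) by a
   sieve over the primes of bounded degree; there are g + 1 such terms. *)
Require Import Defs.
From HB Require Import structures.
From mathcomp Require Import all_boot all_order all_algebra all_field.
From mathcomp Require Import all_classical all_reals all_analysis.
From mathcomp Require Import zify ring lra.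

Set Implicit Arguments.
Unset Strict Implicit.
Unset Printing Implicit Defensive.

Import Order.TTheory GRing.Theory Num.Theory.
Import numFieldNormedType.Exports.

Local Open Scope classical_set_scope.
Local Open Scope ring_scope.

(** * Finite lists of polynomials *)

(** Stopping at n <= g is what lets trivial bounds suffice. After division by the number of D and
    weighting by q^(-n/2), the nonsquare f of degree n contribute O(q^(n-g-1)): a factor q^(n/2)
    from their number and weight, and q^(-(2g+2-n)/2) from the sieve. This is summable over n <= g,
    whereas the same estimate would be exponentially large near n = 2g. The main term has order g,
    so the density attached to a square is only needed up to o(1). Hence the sieve uses the primes
    of degree below a fixed k, where the count is exact as soon as D and l have large degree; the
    primes of degree at least k are handled by a union bound, and the boundedly many l of small
    degree by the trivial bound 1. Since P(1) >= 1/2, an error o(g) is then negligible against the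
    main term. *)

Lemma big_bij (S : nmodType) (T1 T2 : eqType) (r1 : seq T1) (r2 : seq T2)
    (h : T1 -> T2) (E : T2 -> S) :
  uniq r1 -> uniq r2 -> {in r1 &, injective h} ->
  (forall y, y \in r2 <-> exists2 x, x \in r1 & y = h x) ->
  \sum_(y <- r2) E y = \sum_(x <- r1) E (h x).
Proof.
move=> u1 u2 inj_h r2P; rewrite -(big_map h predT E); apply: perm_big.
apply: uniq_perm; rewrite ?map_inj_in_uniq // => y.
by apply/idP/mapP=> /r2P.
Qed.

Section PolyLists.
Variable F : finFieldType.
Local Notation q := #|F|.
Implicit Types (f g h P Q A B D V : {poly F}).

(* [polys n] and [primes n] contain the polynomials of size at most n, that is,
   of degree less than n, whereas [monics n] is in degree exactly n. *)
Definition polys n : seq {poly F} :=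
  [seq val p | p <- enum {: {poly_n F}}].

Definition monics n : seq {poly F} := [seq 'X^n + p | p <- polys n].

Definition pirr P := (P \is monic) && irreducibleb P.

Definition primes k : seq {poly F} := [seq P <- polys k | pirr P].

Lemma mem_polys n f : (f \in polys n) = (size f <= n)%N.
Proof.
apply/mapP/idP => [[p _ ->]|sf]; first exact: size_npoly.
by exists (NPoly (sf : f \is a poly_of_size n)); rewrite ?mem_enum.
Qed.

Lemma uniq_polys n : uniq (polys n).
Proof. by rewrite map_inj_uniq ?enum_uniq //; apply: val_inj. Qed.

Lemma size_polys n : size (polys n) = (q ^ n)%N.
Proof. by rewrite size_map -cardE card_npoly. Qed.

Lemma mem_monics n f : (f \in monics n) = (f \is monic) && (size f == n.+1).
Proof.
apply/mapP/andP => [[p]|[mf /eqP sf]].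
  rewrite mem_polys => sp ->.
  have sX : size ('X^n + p) = n.+1 by rewrite size_polyDl size_polyXn.
  rewrite sX eqxx monicE lead_coefDl ?size_polyXn ?ltnS //.
  by rewrite lead_coefXn.
exists (f - 'X^n); last by rewrite addrC subrK.
rewrite mem_polys; apply/leq_sizeP => j.
rewrite leq_eqVlt => /predU1P[<-|ltnj].
  rewrite coefB coefXn eqxx; move: mf; rewrite monicE lead_coefE sf /=.
  by move/eqP->; rewrite subrr.
by rewrite coefB coefXn gtn_eqF // subr0 nth_default ?sf.
Qed.

Lemma uniq_monics n : uniq (monics n).
Proof. by rewrite map_inj_uniq ?uniq_polys //; apply: addrI. Qed.

Lemma size_monics n : size (monics n) = (q ^ n)%N.
Proof. by rewrite size_map size_polys. Qed.

Lemma monics_monic n f : f \in monics n -> f \is monic.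
Proof. by rewrite mem_monics => /andP[]. Qed.

Lemma monics_size n f : f \in monics n -> size f = n.+1.
Proof. by rewrite mem_monics => /andP[_ /eqP]. Qed.

Lemma monics0 : monics 0 = [:: 1].
Proof.
have : perm_eq (monics 0) [:: 1].
  apply: uniq_perm; rewrite ?uniq_monics // => f.
  rewrite mem_monics inE; apply/andP/eqP => [[mf /eqP sf]|->].
    have /size_poly1P[c c0 fE] : size f == 1%N by rewrite sf.
    by move: mf; rewrite fE monicE lead_coefC => /eqP->.
  by rewrite monic1 size_poly1.
by move/perm_small_eq=> ->.
Qed.

Lemma pirr_monic P : pirr P -> P \is monic.
Proof. by case/andP. Qed.

Lemma pirr_irr P : pirr P -> irreducible_poly P.
Proof. by case/andP=> _ /irreducibleP. Qed.

Lemma pirr_size P : pirr P -> (1 < size P)%N.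
Proof. by move/pirr_irr=> [[]]. Qed.

Lemma pirr_neq0 P : pirr P -> P != 0.
Proof. by move/pirr_monic/monic_neq0. Qed.

Lemma pirr_coprime P f : pirr P -> coprimep P f = ~~ (P %| f).
Proof. by move/pirr_irr/irreducible_poly_coprime->. Qed.

Lemma pirr_dvdM P f g : pirr P -> (P %| f * g) = (P %| f) || (P %| g).
Proof.
move=> iP; apply/idP/orP => [|[]]; [|exact: dvdp_mulr|exact: dvdp_mull].
by case: (boolP (P %| f)) => [|nf]; [left|rewrite Gauss_dvdpr ?pirr_coprime //; right].
Qed.

Lemma pirr_dvdX P f n : pirr P -> P %| f ^+ n -> P %| f.
Proof.
move=> iP; elim: n => [|n IH]; last by rewrite exprS pirr_dvdM // => /orP[].
by rewrite expr0 dvdp1 gtn_eqF // pirr_size.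
Qed.

Lemma pirr_dvd_pirr P Q : pirr P -> pirr Q -> (P %| Q) = (P == Q).
Proof.
move=> iP iQ; apply/idP/eqP => [dPQ|->//].
have sP := pirr_size iP.
apply/eqP; rewrite -eqp_monic ?pirr_monic //.
by apply: (pirr_irr iQ) dPQ; rewrite gtn_eqF.
Qed.

Lemma mem_primes k P : (P \in primes k) = (size P <= k)%N && pirr P.
Proof. by rewrite mem_filter mem_polys andbC. Qed.

Lemma uniq_primes k : uniq (primes k).
Proof. by rewrite filter_uniq ?uniq_polys. Qed.

Lemma primes1 : primes 1 = [::].
Proof.
apply/eqP; rewrite -size_eq0 -all_pred0; apply/allP => P.
by rewrite mem_primes => /andP[sP /pirr_size]; rewrite ltnNge sP.
Qed.

Lemma pirr_divisor f : (1 < size f)%N -> exists2 P, pirr P & P %| f.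
Proof.
have [n] := ubnP (size f); elim: n f => // n IH f sfn sf.
have f0 : f != 0 by rewrite -size_poly_gt0 ltnW.
have [/irreducibleP fI|] := boolP (irreducibleb f).
  exists ((lead_coef f)^-1 *: f); last first.
    by rewrite dvdpZl ?invr_eq0 ?lead_coef_eq0.
  rewrite /pirr monicE lead_coefZ mulVf ?lead_coef_eq0 // eqxx /=.
  apply/irreducibleP; split=> [|g sg]; first by rewrite size_scale ?invr_eq0 ?lead_coef_eq0.
  rewrite dvdpZr ?invr_eq0 ?lead_coef_eq0 // => /(fI.2 _ sg) gf.
  by rewrite (eqp_trans gf) // eqp_sym eqp_scale ?invr_eq0 ?lead_coef_eq0.
rewrite /irreducibleb sf negb_forall => /existsP[g].
rewrite negb_imply -ltnNge -Pdiv.Idomain.dvdpE => /andP[dgf sg].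
have sgf : (size g < size f)%N.
  by rewrite (leq_ltn_trans (size_npoly g)) // ltn_predL ltnW.
have [P iP dP] := IH g (leq_trans sgf sfn) sg.
by exists P => //; apply: dvdp_trans dgf.
Qed.

Lemma monicM_size f g : f \is monic -> g \is monic ->
  (size (f * g)).-1 = ((size f).-1 + (size g).-1)%N.
Proof.
move=> mf mg; rewrite size_monicM ?monic_neq0 //.
have := size_poly_gt0 f; have := size_poly_gt0 g.
rewrite !monic_neq0 //; lia.
Qed.

Lemma monicX_size f e : f \is monic -> (size (f ^+ e)).-1 = (e * (size f).-1)%N.
Proof.
move=> mf; elim: e => [|e IH]; first by rewrite expr0 size_poly1.
by rewrite exprS monicM_size ?monic_exp // IH mulSn.
Qed.

Lemma in_monics f : f \is monic -> f \in monics (size f).-1.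
Proof.
move=> mf; rewrite mem_monics mf /= prednK // size_poly_gt0.
exact: monic_neq0.
Qed.

Lemma monics_deg n f : f \in monics n -> (size f).-1 = n.
Proof. by move/monics_size->. Qed.

Lemma monicsM m n f g : f \in monics m -> g \in monics n ->
  f * g \in monics (m + n).
Proof.
move=> fm gn; rewrite -(monics_deg fm) -(monics_deg gn) -monicM_size;
  rewrite ?in_monics ?monicMl; by rewrite ?(monics_monic fm) ?(monics_monic gn).
Qed.

Lemma monicsX m f e : f \in monics m -> f ^+ e \in monics (e * m).
Proof.
move=> fm; rewrite -(monics_deg fm) -monicX_size ?in_monics ?monic_exp //;
  exact: monics_monic fm.
Qed.

Lemma monics_divp m n f g : f \in monics m -> g \in monics n -> f %| g ->
  [/\ (m <= n)%N, g %/ f \in monics (n - m) & g = f * (g %/ f)].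
Proof.
move=> fm gn dfg; have mf := monics_monic fm; have mg := monics_monic gn.
have gE : g = f * (g %/ f) by rewrite mulrC divpK.
have mh : g %/ f \is monic by rewrite -(monicMl _ mf) -gE.
have := monics_deg gn; rewrite {1}gE monicM_size // (monics_deg fm) => en.
have mn : (m <= n)%N by rewrite -en leq_addr.
have nm : (n - m)%N = (size (g %/ f)).-1 by rewrite -en addKn.
by split; rewrite ?nm ?in_monics.
Qed.

Lemma pirr_in_monics P : pirr P -> P \in monics (size P).-1.
Proof. by move/pirr_monic/in_monics. Qed.

Lemma coprimep_pirr P Q : pirr P -> pirr Q -> P != Q -> coprimep P Q.
Proof. by move=> iP iQ nPQ; rewrite pirr_coprime // pirr_dvd_pirr. Qed.

Section Sums.
Variable S : comNzRingType.
Implicit Type phi : {poly F} -> S.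

Lemma sum_multiples A a N phi : A \in monics a ->
  \sum_(D <- monics N) (A %| D)%R%:R * phi D =
  if (a <= N)%N then \sum_(B <- monics (N - a)) phi (A * B) else 0.
Proof.
move=> Aa; have A0 : A != 0 by rewrite monic_neq0 ?(monics_monic Aa).
transitivity (\sum_(D <- [seq D <- monics N | A %| D]) phi D).
  rewrite big_filter [RHS]big_mkcond; apply: eq_bigr => D _.
  by case: (A %| D); rewrite ?mul1r ?mul0r.
case: leqP => [aN|Na]; last first.
  rewrite big1_seq // => D /=; rewrite mem_filter => /andP[dAD DN].
  by have [] := monics_divp Aa DN dAD; lia.
apply: big_bij; rewrite ?filter_uniq ?uniq_monics //.
  by move=> x y _ _; apply: mulfI.
move=> D; rewrite mem_filter; split=> [/andP[dAD DN]|[B BN ->]].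
  by have [_ ? ?] := monics_divp Aa DN dAD; exists (D %/ A).
by rewrite dvdp_mulr //= -[N](subnKC aN) monicsM.
Qed.

(** Division with remainder by f is a bijection from V to the pairs (quotient t, remainder r). All
    averages over residue classes below rest on it. *)
Lemma sum_polys_split f d n phi : size f = d.+1 ->
  \sum_(V <- polys (n + d)) phi V =
  \sum_(t <- polys n) \sum_(r <- polys d) phi (r + t * f).
Proof.
move=> sf; have f0 : f != 0 by rewrite -size_poly_eq0 sf.
rewrite -(big_allpairs_dep (h := pair) (F := fun u => phi (u.2 + u.1 * f))).
apply: (big_bij (h := fun u : {poly F} * {poly F} => u.2 + u.1 * f)).
- by apply: allpairs_uniq; rewrite ?uniq_polys // => [[? ?] [? ?] _ _].
- exact: uniq_polys.
- move=> [t r] [t' r'] /allpairsP[[x y] [_ /= ry [_ ->]]]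
    /allpairsP[[x' y'] [_ /= ry' [_ ->]]] /= E.
  rewrite mem_polys in ry; rewrite mem_polys in ry'.
  have yy : y = y'.
    have := congr1 (fun p => p %% f) E.
    by rewrite /= addrC [y' + _]addrC !modp_addl_mul_small // sf.
  by move: E; rewrite yy => /addrI/(mulIf f0)->.
- move=> V; rewrite mem_polys; split=> [sV|[[t r]]].
    exists (V %/ f, V %% f); last by rewrite /= addrC -divp_eq.
    apply/allpairsP; exists (V %/ f, V %% f); split=> //=; rewrite mem_polys.
      by rewrite size_divp // sf leq_subLR addnC.
    by rewrite -ltnS -sf ltn_modp.
  move=> /allpairsP[[x y] [/= xn yd [-> ->]]] ->.
  move: xn yd; rewrite !mem_polys /= => xn yd.
  rewrite (leq_trans (size_polyD _ _)) // geq_max (leq_trans yd) ?leq_addl //.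
  by rewrite (leq_trans (size_polyMleq _ _)) // sf addnS leq_add2r.
Qed.

Lemma sum_polys_const n (c : S) : \sum_(V <- polys n) c = q%:R ^+ n * c.
Proof. by rewrite big_const_seq count_predT size_polys iter_addr_0 -[c *+ _]mulr_natl natrX. Qed.

Lemma sum_monics_const n (c : S) : \sum_(V <- monics n) c = q%:R ^+ n * c.
Proof. by rewrite big_const_seq count_predT size_monics iter_addr_0 -[c *+ _]mulr_natl natrX. Qed.

(** As a is invertible modulo f, V -> a V + b is injective on residues, hence permutes this finite
    list. *)
Lemma sum_polys_affine f d a b phi : size f = d.+1 -> coprimep f a ->
  \sum_(V <- polys d) phi ((a * V + b) %% f) = \sum_(V <- polys d) phi V.
Proof.
move=> sf cfa; have f0 : f != 0 by rewrite -size_poly_eq0 sf.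
rewrite -(big_map (fun V => (a * V + b) %% f) predT phi).
apply: perm_big; set r := map _ _.
have ur : uniq r.
  rewrite map_inj_in_uniq ?uniq_polys // => x y.
  rewrite !mem_polys => sx sy /eqP.
  rewrite -subr_eq0 -modpN -modpD -/(dvdp _ _) opprD addrACA subrr addr0.
  rewrite -mulrBr Gauss_dvdpr // => dxy.
  apply/eqP; rewrite -subr_eq0; apply: contraLR dxy => nz.
  rewrite gtNdvdp // sf ltnS (leq_trans (size_polyD _ _)) // geq_max sx.
  by rewrite size_polyN.
have sub : {subset r <= polys d}.
  by move=> x /mapP[y _ ->]; rewrite mem_polys -ltnS -sf ltn_modp.
have [_ eqr] := uniq_min_size ur sub (eq_leq (esym (size_map _ _))).
by apply: uniq_perm; rewrite ?uniq_polys.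
Qed.

Lemma sum_polys_mod f d n phi : size f = d.+1 -> (d <= n)%N ->
  \sum_(V <- polys n) phi (V %% f) = q%:R ^+ (n - d) * \sum_(V <- polys d) phi V.
Proof.
move=> sf dn; rewrite -{1}[n](subnK dn) (sum_polys_split _ _ sf).
rewrite -sum_polys_const; apply: eq_big_seq => t _; apply: eq_big_seq => r.
by rewrite mem_polys => rd; rewrite addrC modp_addl_mul_small ?sf.
Qed.

Lemma sum_monics_mod f d n phi : size f = d.+1 -> (d <= n)%N ->
  \sum_(V <- monics n) phi (V %% f) = q%:R ^+ (n - d) * \sum_(V <- polys d) phi V.
Proof.
move=> sf dn; rewrite big_map.
under eq_bigr => V _.
  rewrite addrC (_ : _ %% f = (V %% f + 'X^n %% f) %% f); last first.
    by rewrite !modpD !modp_id.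
  over.
rewrite (sum_polys_mod (fun V => phi ((V + 'X^n %% f) %% f)) sf dn); congr (_ * _).
(* The leading term of a monic V only translates its residue by 'X^n modulo f, and a translation
   permutes the residues. *)
rewrite -[RHS](@sum_polys_affine f d 1 ('X^n %% f)) ?coprimep1 //.
by apply: eq_bigr => V _; rewrite mul1r.
Qed.

End Sums.
End PolyLists.

(** * Unique factorization and Euler products *)

Section Factorization.
Variable F : finFieldType.
Implicit Types (f g h P Q : {poly F}) (s t : seq {poly F}).

(** A chosen factorization, determined only up to the order of the factors. The default value is
    taken exactly when f is not monic. *)
Definition pfac f : seq {poly F} :=
  xget [::] [set s | all (@pirr F) s && (\prod_(P <- s) P == f)].

Lemma prod_pirr_monic s : all (@pirr F) s -> \prod_(P <- s) P \is monic.
Proof. by move=> /allP si; rewrite big_seq rpred_prod // => P Ps; apply/pirr_monic/si. Qed.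

Lemma pirr_dvd_prod P s : pirr P -> all (@pirr F) s ->
  (P %| \prod_(Q <- s) Q) = (P \in s).
Proof.
move=> iP; elim: s => [_|Q s IH /= /andP[iQ si]].
  by rewrite big_nil dvdp1 gtn_eqF // pirr_size.
by rewrite big_cons pirr_dvdM // inE IH // pirr_dvd_pirr.
Qed.

Lemma pfac_ex f : f \is monic ->
  exists s, all (@pirr F) s && (\prod_(P <- s) P == f).
Proof.
have [n] := ubnP (size f); elim: n f => // n IH f sfn mf.
have [sf|sf] := leqP (size f) 1.
  have /size_poly1P[c c0 fE] : size f == 1%N.
    by rewrite eqn_leq sf size_poly_gt0 monic_neq0.
  by exists [::]; rewrite big_nil; move: mf; rewrite fE monicE lead_coefC => /eqP->;
    rewrite /= eqxx.
have [P iP dPf] := pirr_divisor sf.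
have [_ gm fE] := monics_divp (pirr_in_monics iP) (in_monics mf) dPf.
have [||s /andP[si /eqP sE]] := IH (f %/ P); last 2 first.
- exact: monics_monic gm.
- by exists (P :: s); rewrite /= iP si big_cons sE -fE eqxx.
rewrite (monics_size gm); have := pirr_size iP.
move: sfn sf; case: (size f) => // a; case: (size P) => [|[|b]] //=.
by move=> *; lia.
Qed.

Lemma pfacP f : f \is monic -> all (@pirr F) (pfac f) /\ \prod_(P <- pfac f) P = f.
Proof.
move=> /pfac_ex[s sP]; rewrite /pfac.
by case: xgetP => [t _ /andP[? /eqP]|/(_ s)/=]; first by split.
Qed.

Lemma pfac_uniq s t : all (@pirr F) s -> all (@pirr F) t ->
  \prod_(P <- s) P = \prod_(P <- t) P -> perm_eq s t.
Proof.
elim: s t => [|P s IH] t /=.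
  case: t => // Q t _ /= /andP[iQ it]; rewrite big_nil => E.
  have := pirr_dvd_prod iQ (_ : all (@pirr F) [::]).
  rewrite big_nil E in_nil => /(_ isT); rewrite big_cons dvdp_mulr //.
move=> /andP[iP si] it E.
have Pt : P \in t by rewrite -pirr_dvd_prod // -E big_cons dvdp_mulr.
rewrite (perm_trans _ (_ : perm_eq (P :: rem P t) t)) //; last first.
  by rewrite perm_sym perm_to_rem.
rewrite perm_cons; apply: IH => //.
  by apply/allP => Q /mem_rem; apply/allP.
apply: (mulfI (pirr_neq0 iP)).
by move: E; rewrite big_cons (perm_big _ (perm_to_rem Pt)) big_cons.
Qed.

Lemma perm_pfac f s : all (@pirr F) s -> \prod_(P <- s) P = f ->
  perm_eq (pfac f) s.
Proof.
move=> si sE; have mf : f \is monic by rewrite -sE prod_pirr_monic.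
by have [fi fE] := pfacP mf; apply: pfac_uniq; rewrite ?fE.
Qed.

Lemma perm_pfacM f g : f \is monic -> g \is monic ->
  perm_eq (pfac (f * g)) (pfac f ++ pfac g).
Proof.
move=> /pfacP[fi fE] /pfacP[gi gE]; apply: perm_pfac; first by rewrite all_cat fi.
by rewrite big_cat /= fE gE.
Qed.

Lemma pfac1 : pfac 1 = [::].
Proof. by apply/perm_small_eq => //; apply: perm_pfac; rewrite ?big_nil. Qed.

Lemma pfac_pirr P : pirr P -> pfac P = [:: P].
Proof.
move=> iP; apply/perm_small_eq => //; apply: perm_pfac; first by rewrite /= iP.
by rewrite big_seq1.
Qed.

Lemma mem_pfac f P : f \is monic -> (P \in pfac f) = pirr P && (P %| f).
Proof.
move=> /pfacP[fi fE]; apply/idP/andP => [Pf|[iP]].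
  have iP : pirr P by apply: (allP fi).
  by rewrite -{1}fE pirr_dvd_prod.
by rewrite -{1}fE pirr_dvd_prod.
Qed.

Definition vP P f := count_mem P (pfac f).

Lemma vP_decomp P f : pirr P -> f \is monic ->
  exists g, [/\ g \is monic, ~~ (P %| g) & f = P ^+ vP P f * g].
Proof.
move=> iP mf; have [fi fE] := pfacP mf.
pose r := [seq Q <- pfac f | Q != P]; exists (\prod_(Q <- r) Q).
have ri : all (@pirr F) r.
  by apply/allP => Q; rewrite mem_filter => /andP[_]; apply/allP.
split; first exact: prod_pirr_monic.
  by rewrite pirr_dvd_prod // mem_filter eqxx.
rewrite -{1}fE (bigID (pred1 P)) big_filter /=; congr (_ * _).
rewrite /vP -big_filter (eq_big_seq (fun=> P)) ?big_const_seq ?count_predT; last first.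
  by move=> Q; rewrite mem_filter => /andP[/eqP].
by rewrite size_filter iter_mulr_1.
Qed.

Lemma vP_mul P e g : pirr P -> g \is monic -> ~~ (P %| g) ->
  vP P (P ^+ e * g) = e.
Proof.
move=> iP mg ng; have [gi gE] := pfacP mg.
have : perm_eq (pfac (P ^+ e * g)) (nseq e P ++ pfac g).
  apply: perm_pfac; first by rewrite all_cat gi andbT all_nseq iP orbT.
  by rewrite big_cat gE /= big_nseq iter_mulr_1.
move=> /permP; rewrite /vP => ->; rewrite count_cat count_nseq /= eqxx mul1n.
by rewrite (count_memPn _) ?addn0 ?mem_pfac ?iP.
Qed.

End Factorization.

(** * Truncated power series *)

Section EqX.
Variable S : comNzRingType.
Implicit Types p r u v : {poly S}.

(* Power series are handled as polynomials modulo ['X^K]. *)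
Definition eqX K p r := forall i, (i < K)%N -> p`_i = r`_i.

Lemma eqX_refl K p : eqX K p p. Proof. by []. Qed.

Lemma eqX_eq K p r : p = r -> eqX K p r. Proof. by move=> ->. Qed.

Lemma eqX_sym K p r : eqX K p r -> eqX K r p.
Proof. by move=> E i iK; rewrite E. Qed.

Lemma eqX_trans K p r u : eqX K p r -> eqX K r u -> eqX K p u.
Proof. by move=> E1 E2 i iK; rewrite E1 ?E2. Qed.

Lemma eqXD K p r u v : eqX K p r -> eqX K u v -> eqX K (p + u) (r + v).
Proof. by move=> E1 E2 i iK; rewrite !coefD E1 ?E2. Qed.

Lemma eqXM K p r u v : eqX K p r -> eqX K u v -> eqX K (p * u) (r * v).
Proof.
move=> E1 E2 i iK; rewrite !coefM; apply: eq_bigr => j _.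
by rewrite E1 ?E2 //; have := ltn_ord j; lia.
Qed.

Lemma eqXMl K p r u : eqX K p r -> eqX K (u * p) (u * r).
Proof. exact: eqXM. Qed.

Lemma eqXMr K p r u : eqX K p r -> eqX K (p * u) (r * u).
Proof. by move=> E; apply: eqXM. Qed.

Lemma eqX_prod (T : eqType) K (s : seq T) (p r : T -> {poly S}) :
  (forall x, x \in s -> eqX K (p x) (r x)) ->
  eqX K (\prod_(x <- s) p x) (\prod_(x <- s) r x).
Proof.
elim: s => [|x s IH] E; first by rewrite !big_nil.
rewrite !big_cons; apply: eqXM; first by apply: E; rewrite mem_head.
by apply: IH => y ys; apply: E; rewrite inE ys orbT.
Qed.

Definition gen K (a : nat -> S) : {poly S} := \poly_(i < K) a i.

Lemma geom_eqX K d (c : S) : (0 < d)%N ->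
  eqX K ((1 - c *: 'X^d) * \sum_(e < K) c ^+ e *: 'X^(e * d)) 1.
Proof.
move=> d0; rewrite [X in _ * X](_ : _ = \sum_(e < K) (c *: 'X^d) ^+ e); last first.
  by apply: eq_bigr => e _; rewrite exprZn -exprM mulnC.
rewrite -opprB mulNr -subrX1 opprB exprZn -exprM => i iK.
rewrite coefB coefZ coefXn ltn_eqF ?mulr0 ?subr0 //.
by rewrite (leq_trans iK) // leq_pmull.
Qed.

End EqX.

Section EulerProduct.
Variables (F : finFieldType) (S : comNzRingType).
Implicit Types (f g P : {poly F}) (s : seq {poly F}) (h : {poly F} -> S).

Definition smooth s n := [seq f <- monics F n | all (mem s) (pfac f)].

(** Multiplicativity in the form that suffices to build an Euler product one prime at a time. It
    covers [nroots], which is not completely multiplicative. *)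
Definition pmult h := h 1 = 1 /\ forall P e f, pirr P -> f \is monic ->
  ~~ (P %| f) -> h (P ^+ e * f) = h (P ^+ e) * h f.

(** Cutting off at e < K loses nothing modulo 'X^K, because a prime has degree at least 1. *)
Definition efactor K h P : {poly S} :=
  \sum_(e < K) h (P ^+ e) *: 'X^(e * (size P).-1).

Lemma mem_smooth s n f : f \in smooth s n =
  (f \in monics F n) && all (mem s) (pfac f).
Proof. by rewrite mem_filter andbC. Qed.

Lemma smooth_primes K n : (n < K)%N -> smooth (primes F K) n = monics F n.
Proof.
move=> nK; apply/all_filterP/allP => f fn; apply/allP => P.
have mf := monics_monic fn; rewrite mem_pfac //= mem_primes => /andP[-> dP].
rewrite andbT (leq_trans _ nK) // -(monics_size fn) dvdp_leq //.
exact: monic_neq0.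
Qed.

(** The f are sorted by the exact power P^e dividing them; e <= e deg P <= n < K, so e < K covers
    all of them. *)
Lemma sum_smooth_cons h P s n K : pmult h -> pirr P -> P \notin s ->
  all (@pirr F) s -> (n < K)%N ->
  \sum_(f <- smooth (P :: s) n) h f =
  \sum_(e < K) if (e * (size P).-1 <= n)%N then
     h (P ^+ e) * \sum_(f <- smooth s (n - e * (size P).-1)) h f else 0.
Proof.
move=> [h1 hM] iP nPs si nK; set d := (size P).-1.
have d0 : (0 < d)%N by rewrite /d -subn1 subn_gt0 pirr_size.
have vdeg f : f \in monics F n -> (vP P f * d <= n)%N.
  move=> fn; have mf := monics_monic fn.
  have [g [mg _ fE]] := vP_decomp iP mf.
  rewrite -(monics_deg fn) {2}fE monicM_size ?monicX_size ?monic_exp //;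
    try exact: pirr_monic.
  exact: leq_addr.
transitivity (\sum_(e < K) \sum_(f <- smooth (P :: s) n | vP P f == e) h f).
  rewrite (exchange_big_dep predT) //=; apply: eq_big_seq => f.
  rewrite mem_smooth => /andP[fn _].
  have vK : (vP P f < K)%N.
    by rewrite (leq_ltn_trans _ nK) // (leq_trans _ (vdeg _ fn)) // leq_pmulr.
  rewrite (bigD1 (Ordinal vK)) //= big1 ?addr0 // => e /andP[/eqP ve].
  by case/eqP; apply/val_inj.
apply: eq_bigr => e _; case: leqP => [den|den]; last first.
  rewrite big1_seq // => f /andP[/eqP ve]; rewrite mem_smooth => /andP[fn _].
  by have := vdeg _ fn; rewrite ve leqNgt den.
rewrite mulr_sumr -big_filter.
have facP f : f \is monic -> ~~ (P %| f) ->
    all (mem (P :: s)) (pfac (P ^+ e * f)) = all (mem s) (pfac f).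
  move=> mf nf; have mPf : P ^+ e * f \is monic.
    by rewrite rpredM // rpredX // pirr_monic.
  apply/allP/allP => H Q.
    rewrite mem_pfac // => /andP[iQ dQ].
    have := H Q; rewrite mem_pfac // iQ dvdp_mull //= inE => /(_ isT)/orP[|//].
    by move=> /eqP QP; rewrite QP (negPf nf) in dQ.
  rewrite mem_pfac // => /andP[iQ]; rewrite pirr_dvdM //= inE => /orP[/pirr_dvdX|].
    by move=> /(_ iQ); rewrite pirr_dvd_pirr // => ->.
  by move=> dQ; rewrite [_ \in s]H ?orbT // mem_pfac // iQ.
rewrite [RHS](eq_big_seq (fun f => h (P ^+ e * f))); last first.
  move=> f; rewrite mem_smooth => /andP[fn sf]; rewrite hM ?(monics_monic fn) //.
  apply: contra nPs => dP; apply: (allP sf).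
  by rewrite mem_pfac ?iP // (monics_monic fn).
apply: (big_bij (h := fun f => P ^+ e * f)).
- by rewrite !filter_uniq // uniq_monics.
- by rewrite !filter_uniq // uniq_monics.
- by move=> f g _ _; apply/mulfI; rewrite expf_neq0 // pirr_neq0.
move=> f; rewrite mem_filter mem_smooth; split=> [/and3P[/eqP ve fn sf]|[g]].
  have [g [mg ng fE]] := vP_decomp iP (monics_monic fn).
  rewrite ve in fE; exists g => //; rewrite mem_smooth -facP // -fE sf andbT.
  rewrite (_ : _ - _ = (size g).-1)%N ?in_monics //.
  rewrite -(monics_deg fn) fE monicM_size ?monicX_size ?monic_exp //;
    try exact: pirr_monic.
  by rewrite addKn.
rewrite mem_smooth => /andP[gn sg] ->; have mg := monics_monic gn.
have ng : ~~ (P %| g).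
  by apply: contra nPs => dP; apply: (allP sg); rewrite mem_pfac ?iP.
rewrite vP_mul // eqxx facP // sg andbT -[n](subnKC den).
by apply: monicsM; rewrite // monicsX ?pirr_in_monics.
Qed.

Lemma euler_smooth h s K : pmult h -> uniq s -> all (@pirr F) s ->
  eqX K (gen K (fun n => \sum_(f <- smooth s n) h f)) (\prod_(P <- s) efactor K h P).
Proof.
move=> hM; have [h1 _] := hM; elim: s => [_ _|P s IH /= /andP[nPs us] /andP[iP si]].
  rewrite big_nil => n nK; rewrite coef_poly nK coef1.
  case: n nK => [|n] nK /=.
    by rewrite /smooth monics0 /= pfac1 /= big_seq1.
  rewrite big1_seq // => f /=; rewrite mem_smooth => /andP[fn].
  have mf := monics_monic fn; have [_ fE] := pfacP mf.
  case: (pfac f) fE => //; rewrite big_nil => f1 _.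
  by have := monics_size fn; rewrite -f1 size_poly1.
rewrite big_cons; apply: eqX_trans (eqXMl _ (IH us si)).
move=> n nK; rewrite coef_poly nK (sum_smooth_cons hM iP nPs si nK).
rewrite /efactor mulr_suml coef_sum; apply: eq_bigr => e _.
rewrite -scalerAl coefZ coefXnM ltnNge; case: leqP => _ /=; last by rewrite mulr0.
by rewrite coef_poly (leq_ltn_trans (leq_subr _ _) nK).
Qed.

(** A monic polynomial of degree n < K has all its prime factors in [primes F K], so every f that
    matters modulo 'X^K is smooth. *)
Lemma euler_monics h K : pmult h ->
  eqX K (gen K (fun n => \sum_(f <- monics F n) h f))
        (\prod_(P <- primes F K) efactor K h P).
Proof.
move=> hM; apply: eqX_trans (euler_smooth hM (uniq_primes _ _) _).
  by move=> n nK; rewrite !coef_poly nK smooth_primes.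
by apply/allP => P; rewrite mem_primes => /andP[].
Qed.

End EulerProduct.

(** * Quadratic characters *)

Section EulerCriterion.
Variable K : finFieldType.
Hypothesis oddK : odd #|K|.
Let m := (#|K|.-1)./2.

(** The quadratic character of K with value 0 at 0, kept in the integers so that it can be summed
    and compared between different fields. *)
Definition sqc (z : K) : int := \sum_(y : K) (y ^+ 2 == z)%:R - 1.

Lemma odd_card_2neq0 : (2 : K) != 0.
Proof.
apply/negP => /eqP K2.
have card0 : #|K|%:R = 0 :> K.
  (* Translation by 1 permutes K, so adding #|K| times 1 to the sum of all elements does not change
     it. *)
  apply: (addrI (\sum_(x : K) x)); rewrite addr0 -sumr_const -big_split /=.
  by rewrite [RHS](reindex_inj (addIr 1)).
move: card0; rewrite -[#|K|]odd_double_half oddK natrD -muln2 natrM K2 mulr0 addr0.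
by move/eqP; rewrite oner_eq0.
Qed.

Lemma finField_expr_card1 (z : K) : z != 0 -> z ^+ #|K|.-1 = 1.
Proof.
move=> z0; apply: (mulfI z0); rewrite mulr1 -exprS prednK ?expf_card //.
exact: ltnW (finNzRing_gt1 K).
Qed.

Let m2 : m.*2 = #|K|.-1.
Proof. by rewrite /m -[#|K|]odd_double_half oddK /= doubleK. Qed.

Let m_gt0 : (0 < m)%N.
Proof. by rewrite -double_gt0 m2 -subn1 subn_gt0 finNzRing_gt1. Qed.

Lemma nsq0 : \sum_(y : K) (y ^+ 2 == 0)%:R = 1 :> int.
Proof.
rewrite (bigD1 0) //= expr0n eqxx big1 ?addr0 // => y y0.
by rewrite expf_eq0 /= (negPf y0).
Qed.

Lemma nsq_sq x : x != 0 -> \sum_(y : K) (y ^+ 2 == x ^+ 2)%:R = 2 :> int.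
Proof.
move=> x0; have xN : - x != x.
  by rewrite -subr_eq0 -opprD oppr_eq0 -mulr2n -mulr_natl mulf_neq0 // odd_card_2neq0.
rewrite (bigD1 x) //= (bigD1 (- x)) //= sqrrN !eqxx big1 ?addr0 // => y /andP[yx yNx].
by rewrite eqf_sqr (negPf yx) (negPf yNx).
Qed.

Lemma sum_sqc : \sum_z sqc z = 0.
Proof.
rewrite sumrB sumr_const exchange_big /=.
rewrite (eq_bigr (fun=> 1)) ?sumr_const ?subrr // => y _.
rewrite (bigD1 (y ^+ 2)) //= eqxx big1 ?addr0 // => z.
by rewrite eq_sym => /negPf->.
Qed.

Definition issq (z : K) := [exists y, y ^+ 2 == z].

Lemma sqcE z : sqc z = if z == 0 then 0 else if issq z then 1 else -1.
Proof.
rewrite /sqc; have [->|z0] := eqVneq z 0; first by rewrite nsq0 subrr.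
have [/existsP[x /eqP zx]|/existsPn nz] := boolP (issq z).
  rewrite -zx nsq_sq //; apply: contraNneq z0 => x0.
  by rewrite -zx x0 expr0n.
by rewrite big1 ?add0r // => y _; rewrite (negPf (nz y)).
Qed.

(** Since [sqc] sums to 0, there are as many nonzero squares as nonsquares. *)
Lemma card_nzsq : #|[pred z | (z != 0) && issq z]| = m.
Proof.
have := sum_sqc; under eq_bigr do rewrite sqcE.
rewrite (bigD1 0) //= eqxx add0r.
rewrite (eq_bigr (fun z => (issq z)%:R * 2 - 1)); last first.
  by move=> z /negPf->; case: (issq z).
rewrite sumrB sumr_const -mulr_suml.
rewrite (_ : #|_| = m.*2); last by rewrite m2 cardC1.
rewrite -natr_sum -big_mkcondr sum1_card /= => /eqP.
rewrite subr_eq0 => /eqP; set c := #|_|; rewrite -natrM -[RHS]/(m.*2%:R) => /eqP.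
rewrite eqr_nat muln2 => /eqP/double_inj <-.
by apply: eq_card => z; rewrite ?inE /in_mem /=.
Qed.

Lemma sqc_exp z : (sqc z)%:~R = z ^+ m.
Proof.
rewrite sqcE; have [->|z0] := eqVneq z 0; first by rewrite expr0n gtn_eqF.
have zX : z ^+ m.*2 = 1 by rewrite m2 finField_expr_card1.
have [/existsP[x /eqP zx]|nz] := boolP (issq z).
  rewrite -zx -exprM mul2n m2 finField_expr_card1 //.
  by apply: contraNneq z0 => x0; rewrite -zx x0 expr0n.
have : (z ^+ m) ^+ 2 == 1 by rewrite -exprM muln2 zX.
rewrite sqrf_eq1 => /orP[/eqP zm1|/eqP->]; last by rewrite rmorphN1.
(* If z^m were 1, the nonsquare z and the m nonzero squares would be m + 1 roots of 'X^m - 1. *)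
pose rs := z :: enum [pred z | (z != 0) && issq z].
have urs : uniq rs by rewrite /= enum_uniq mem_enum inE /= (negPf nz) andbF.
have p0 : 'X^m - 1 != 0 :> {poly K}.
  by rewrite -size_poly_gt0 size_XnsubC.
suff /(max_poly_roots p0)/(_ urs) : all (root ('X^m - 1)) rs.
  by rewrite size_XnsubC // /= -cardE card_nzsq ltnn.
apply/allP => w; rewrite inE mem_enum inE => /orP[/eqP->|/andP[w0 /existsP[x /eqP wx]]].
  by rewrite rootE !hornerE zm1 subrr.
rewrite rootE !hornerE -wx -exprM mul2n m2 finField_expr_card1 ?subrr //.
by apply: contraNneq w0 => x0; rewrite -wx x0 expr0n.
Qed.

End EulerCriterion.

(** * Square roots and residue symbols modulo a polynomial *)

Section Residues.
Variable F : finFieldType.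
Local Notation q := #|F|.
Implicit Types (f g h P Q A B D V : {poly F}).

Definition nroots f D : int :=
  \sum_(V <- polys F (size f).-1) (f %| V ^+ 2 - D)%R%:R.

(* The symbol (D/P), read off the number of square roots of D modulo P; this
   makes all the properties of chi_D needed here accessible by counting. *)
Definition chi0 D P : int := nroots P D - 1.

Definition chi D f : int := \prod_(P <- pfac f) chi0 D P.

Lemma eq_modp f D E : (D %% f == E %% f) = (f %| D - E).
Proof. by rewrite /dvdp modpD modpN subr_eq0. Qed.

Lemma dvd_sq_mod f V D : (f %| (V %% f) ^+ 2 - D) = (f %| V ^+ 2 - D).
Proof.
rewrite -[in RHS](subrK ((V %% f) ^+ 2) (V ^+ 2)) -addrA [RHS]dvdp_addr // subr_sqr.
by rewrite dvdp_mulr // {1}(divp_eq V f) addrK dvdp_mull.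
Qed.

Lemma dvd_subD_mod f V D E : D %% f = E %% f ->
  (f %| V ^+ 2 - D) = (f %| V ^+ 2 - E).
Proof. by move=> DE; rewrite /dvdp !modpD !modpN DE. Qed.

Lemma nroots_mod f D E : D %% f = E %% f -> nroots f D = nroots f E.
Proof. by move=> DE; apply: eq_bigr => V _; rewrite (dvd_subD_mod _ DE). Qed.

Lemma chi0_mod P D E : D %% P = E %% P -> chi0 D P = chi0 E P.
Proof. by move=> DE; rewrite /chi0 (nroots_mod DE). Qed.

Lemma chi_mod f D E : f \is monic -> D %% f = E %% f -> chi D f = chi E f.
Proof.
move=> mf DE; rewrite /chi; apply: eq_big_seq => P; rewrite mem_pfac // => /andP[_ dP].
apply: chi0_mod; apply/eqP; rewrite eq_modp (dvdp_trans dP) // -eq_modp.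
exact/eqP.
Qed.

Lemma chiM D f g : f \is monic -> g \is monic -> chi D (f * g) = chi D f * chi D g.
Proof. by move=> mf mg; rewrite /chi (perm_big _ (perm_pfacM mf mg)) big_cat. Qed.

Lemma chi1 D : chi D 1 = 1.
Proof. by rewrite /chi pfac1 big_nil. Qed.

Lemma chi_pirr D P : pirr P -> chi D P = chi0 D P.
Proof. by move=> iP; rewrite /chi pfac_pirr // big_seq1. Qed.

Lemma chiX D f e : f \is monic -> chi D (f ^+ e) = chi D f ^+ e.
Proof.
move=> mf; elim: e => [|e IH]; first by rewrite chi1.
by rewrite !exprS chiM ?IH // rpredX.
Qed.

Lemma pmult_chi D : pmult (chi D).
Proof.
split=> [|P e f iP mf _]; first exact: chi1.
by rewrite chiM // rpredX // pirr_monic.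
Qed.

(** Chinese remainders: writing V = r + t f, the condition modulo f sees only r, and for fixed r the
    residue of V modulo g runs through all classes as t varies. *)
Lemma nroots_mul f g D : f \is monic -> g \is monic -> coprimep f g ->
  nroots (f * g) D = nroots f D * nroots g D.
Proof.
move=> mf mg cfg; rewrite /nroots monicM_size // addnC.
have sf : size f = (size f).-1.+1 by rewrite prednK // size_poly_gt0 monic_neq0.
have sg : size g = (size g).-1.+1 by rewrite prednK // size_poly_gt0 monic_neq0.
rewrite (sum_polys_split _ _ sf) exchange_big mulr_suml; apply: eq_big_seq => r.
rewrite mem_polys => sr /=.
transitivity (\sum_(t <- polys F (size g).-1) (f %| r ^+ 2 - D)%R%:R *
   (g %| ((f * t + r) %% g) ^+ 2 - D)%R%:R : int).
  apply: eq_bigr => t _; rewrite Gauss_dvdp // dvd_sq_mod -mulnb natrM.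
  have -> : (f %| (r + t * f) ^+ 2 - D) = (f %| r ^+ 2 - D).
    by rewrite -dvd_sq_mod [r + _]addrC modp_addl_mul_small // sf ltnS.
  by rewrite [f * t]mulrC [t * f + r]addrC.
rewrite -mulr_sumr; congr (_ * _).
by rewrite (sum_polys_affine _ (fun W => (g %| W ^+ 2 - D)%R%:R) sg) // coprimep_sym.
Qed.

Lemma nroots1 D : nroots 1 D = 1.
Proof.
rewrite /nroots size_poly1 /= (_ : polys F 0 = [:: 0]) ?big_seq1 ?dvd1p //.
have : perm_eq (polys F 0) [:: 0].
  apply: uniq_perm; rewrite ?uniq_polys // => f.
  by rewrite mem_polys inE size_poly_leq0.
by move/perm_small_eq=> ->.
Qed.

Lemma pmult_nroots D : pmult (fun f => nroots f D).
Proof.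
split=> [|P e f iP mf nf]; first exact: nroots1.
apply: nroots_mul => //; first by rewrite rpredX // pirr_monic.
by rewrite coprimep_expl // pirr_coprime.
Qed.

Section Quotient.
Variable P : {poly F}.
Hypothesis iP : pirr P.
Definition mi_of : monic_irreducible_poly P := (pirr_irr iP, pirr_monic iP).
Local Notation KP := {poly %/ P with mi_of}.
Definition red (f : {poly F}) : KP := in_qpoly P f.

Lemma red_val f : (red f : {poly %/ P}) = f %% P :> {poly F}.
Proof.
by rewrite /red /= (mk_monicE mi_of) Pdiv.IdomainMonic.modpE ?pirr_monic.
Qed.

Lemma redB f g : red (f - g) = red f - red g. Proof. exact: rmorphB. Qed.
Lemma redM f g : red (f * g) = red f * red g. Proof. exact: rmorphM. Qed.
Lemma redX f n : red (f ^+ n) = red f ^+ n. Proof. exact: rmorphXn. Qed.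
Lemma red_int (z : int) : red z%:~R = z%:~R. Proof. exact: rmorph_int. Qed.

Lemma red_eq0 f : (red f == 0) = (P %| f).
Proof. by rewrite -val_eqE [val (red f)]red_val. Qed.

Lemma card_KP : #|KP| = (q ^ (size P).-1)%N.
Proof. exact: card_qfpoly. Qed.

Lemma sum_red (S : nmodType) (phi : KP -> S) :
  \sum_(V <- polys F (size P).-1) phi (red V) = \sum_y phi y.
Proof.
symmetry; apply: big_bij; rewrite ?uniq_polys ?index_enum_uniq //.
  move=> x y; rewrite !mem_polys => sx sy xy.
  have /eqP := congr1 (fun z : KP => (z : {poly %/ P}) : {poly F}) xy.
  rewrite !red_val !modp_small => [/eqP//||];
    by rewrite -[size P]prednK ?ltnS // ltnW ?pirr_size.
move=> y; split=> [_|]; last by rewrite mem_index_enum.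
have sy : (size ((y : {poly %/ P}) : {poly F}) < size P)%N.
  apply: leq_trans (size_mk_monic (y : {poly %/ P})) _.
  by rewrite (mk_monicE mi_of).
exists ((y : {poly %/ P}) : {poly F}).
  by rewrite mem_polys -ltnS prednK ?(ltnW (pirr_size iP)).
by apply/val_inj; rewrite [val (red _)]red_val modp_small.
Qed.

Lemma chi0E D : chi0 D P = sqc (red D).
Proof.
rewrite /chi0 /nroots /sqc; congr (_ - _).
rewrite -(sum_red (fun y => (y ^+ 2 == red D)%:R)); apply: eq_bigr => V _.
by rewrite -red_eq0 redB redX subr_eq0.
Qed.

End Quotient.

Hypothesis oddF : odd q.

Lemma odd_KP P (iP : pirr P) : odd #|{poly %/ P with mi_of iP}|.
Proof. by rewrite card_KP oddX oddF orbT. Qed.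

Lemma chi0_cases D P : pirr P ->
  chi0 D P = if P %| D then 0 else if chi0 D P == 1 then 1 else -1.
Proof.
move=> iP; rewrite (chi0E iP) sqcE ?odd_KP // red_eq0.
by case: (P %| D) => //; case: (issq _).
Qed.

Lemma chi0_eq0 D P : pirr P -> (chi0 D P == 0) = (P %| D).
Proof.
by move=> iP; rewrite chi0_cases //; case: (P %| D) => //; case: (_ == 1).
Qed.

Lemma chi0_sqr D P : pirr P -> chi0 D P ^+ 2 = (~~ (P %| D))%:R.
Proof.
by move=> iP; rewrite chi0_cases //; case: (P %| D) => //; case: (_ == 1).
Qed.

Lemma chi0_odd D P e : pirr P -> odd e -> chi0 D P ^+ e = chi0 D P.
Proof.
move=> iP oe; rewrite -[e]odd_double_half oe -muln2 mulnC exprS exprM chi0_sqr //.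
have := chi0_cases D iP; case: (P %| D) => /= -> //=; first by rewrite mul0r.
by rewrite expr1n mulr1.
Qed.

Lemma chi0_dvdp D P : pirr P ->
  P %| D ^+ ((q ^ (size P).-1).-1)./2 - (chi0 D P)%:~R.
Proof.
move=> iP; rewrite -(red_eq0 iP) redB redX red_int (chi0E iP) sqc_exp ?odd_KP //.
by rewrite card_KP subrr.
Qed.

(** As 2 != 0 in K, the values 0, 1, -1 stay distinct there. Identities between symbols can thus be
    checked in K, where Euler's criterion turns them into identities between powers. *)
Lemma sqc_injK (K : finFieldType) (a b : int) : odd #|K| ->
  a \in [:: 0; 1; -1] -> b \in [:: 0; 1; -1] -> a%:~R = b%:~R :> K -> a = b.
Proof.
move=> /odd_card_2neq0 K2; rewrite !inE => /or3P[]/eqP-> /or3P[]/eqP-> //= /eqP;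
  rewrite ?rmorphN1 ?rmorph0 ?rmorph1 ?[0 == 1]eq_sym ?[0 == -1]eq_sym ?oppr_eq0 ?oner_eq0 //.
  by rewrite -subr_eq0 opprK (negPf K2).
by rewrite eq_sym -subr_eq0 opprK (negPf K2).
Qed.

Lemma chi0_mem D P : pirr P -> chi0 D P \in [:: 0; 1; -1].
Proof. by move=> iP; rewrite chi0_cases //; case: (P %| D) => //; case: (_ == 1). Qed.

Lemma chi0M A B P : pirr P -> chi0 (A * B) P = chi0 A P * chi0 B P.
Proof.
move=> iP; apply: (sqc_injK (odd_KP iP)); first exact: chi0_mem.
  by have := chi0_mem A iP; have := chi0_mem B iP; rewrite !inE;
    move=> /or3P[]/eqP-> /or3P[]/eqP->.
by rewrite intrM !(chi0E iP) !sqc_exp ?odd_KP // redM exprMn.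
Qed.

Lemma chi_sqM A B f : f \is monic ->
  chi (A ^+ 2 * B) f = (coprimep A f)%:R * chi B f.
Proof.
move=> mf; have [fi fE] := pfacP mf; rewrite /chi.
rewrite -[X in coprimep A X]fE.
elim: (pfac f) fi => [_|P s IH /= /andP[iP si]].
  by rewrite !big_nil coprimep1 mulr1.
rewrite !big_cons IH // chi0M // expr2 chi0M // -expr2 chi0_sqr //.
rewrite coprimepMr [coprimep A P]coprimep_sym (pirr_coprime A iP).
rewrite -mulnb natrM; ring.
Qed.

Lemma chi_sqr D f : f \is monic -> chi D f ^+ 2 = (coprimep D f)%:R.
Proof.
move=> mf; have [fi fE] := pfacP mf; rewrite /chi -[in RHS]fE.
elim: (pfac f) fi => [_|P s IH /= /andP[iP si]].
  by rewrite !big_nil coprimep1.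
rewrite !big_cons exprMn IH // chi0_sqr // coprimepMr.
rewrite [coprimep D P]coprimep_sym (pirr_coprime D iP).
by rewrite -mulnb natrM.
Qed.

Lemma chi_le1 D f : f \is monic -> `|chi D f| <= 1.
Proof.
move=> mf; rewrite -(@expr_le1 _ 2) // ?normr_ge0 // -normrX chi_sqr //.
by case: coprimep.
Qed.

Lemma sum_chi0 P : pirr P -> \sum_(V <- polys F (size P).-1) chi0 V P = 0.
Proof.
move=> iP; rewrite (eq_bigr (fun V => sqc (red iP V))); last first.
  by move=> V _; rewrite (chi0E iP).
by rewrite (sum_red (@sqc _)) sum_sqc.
Qed.

End Residues.

(** * The functional equation *)

Section LocalFactors.
Variable F : finFieldType.
Local Notation q := #|F|.
Hypothesis oddF : odd q.
Implicit Types (f g P D V : {poly F}).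

Definition sqf D := forall P, pirr P -> ~~ (P ^+ 2 %| D).

Lemma two_neq0 : (2 : F) != 0.
Proof. exact: odd_card_2neq0. Qed.

(* Hensel's lemma: writing V = r + t P^(e+1), the condition modulo P^(e+2) is
   linear in t, with invertible slope 2r. *)
Lemma nroots_lift P D e : pirr P -> ~~ (P %| D) ->
  nroots (P ^+ e.+2) D = nroots (P ^+ e.+1) D.
Proof.
move=> iP nPD; rewrite /nroots !monicX_size ?pirr_monic //.
have mP := pirr_monic iP; set d := (size P).-1.
have sP : size P = d.+1 by rewrite prednK // ltnW // pirr_size.
have mQ : P ^+ e.+1 \is monic by rewrite rpredX.
have sQ : size (P ^+ e.+1) = (e.+1 * d).+1.
  by rewrite -monicX_size // prednK // size_poly_gt0 monic_neq0.
rewrite [(e.+2 * d)%N]mulSn (sum_polys_split _ _ sQ) exchange_big.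
apply: eq_big_seq => r _ /=.
have [dr|ndr] := boolP (P ^+ e.+1 %| r ^+ 2 - D); last first.
  rewrite big1 // => t _; case: (boolP (_ %| _)) => // dt.
  case/negP: ndr.
  have := dvdp_trans (dvdp_exp2l P (leqnSn e.+1)) dt.
  have -> : (r + t * P ^+ e.+1) ^+ 2 - D =
     (r ^+ 2 - D) + P ^+ e.+1 * (2%:R * r * t + t ^+ 2 * P ^+ e.+1) by ring.
  by rewrite dvdp_addl // dvdp_mulr.
have [w wE] := dvdpP _ _ dr.
have nPr : ~~ (P %| 2%:R *: r).
  rewrite dvdpZr ?two_neq0 //; apply: contra nPD => dPr.
  have : P %| r ^+ 2 - D by rewrite (dvdp_trans _ dr) // exprS dvdp_mulr.
  by rewrite dvdp_addr ?dvdpNr // expr2 dvdp_mulr.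
transitivity (\sum_(t <- polys F d) ((((2%:R *: r) * t + w) %% P) == 0)%:R : int).
  apply: eq_bigr => t _; congr (nat_of_bool _)%:R.
  have -> : (r + t * P ^+ e.+1) ^+ 2 - D =
     P ^+ e.+1 * (((2%:R *: r) * t + w) + t ^+ 2 * P ^+ e * P).
    rewrite -[LHS]/((r + t * P ^+ e.+1) ^+ 2 - D) -mul_polyC.
    have -> : D = r ^+ 2 - w * P ^+ e.+1 by rewrite -wE opprB addrC subrK.
    rewrite !exprS polyC_natr; ring.
  by rewrite exprSr dvdp_mul2l ?monic_neq0 // dvdp_addl ?dvdp_mull.
rewrite (sum_polys_affine _ (fun x => (x == 0)%:R) sP) ?pirr_coprime //.
rewrite (bigD1_seq 0) ?uniq_polys ?mem_polys ?size_poly0 //= eqxx big1 ?addr0 //.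
by move=> V /negPf->.
Qed.

Lemma nroots_ndvd P D e : pirr P -> ~~ (P %| D) ->
  nroots (P ^+ e.+1) D = 1 + chi0 D P.
Proof.
move=> iP nPD; elim: e => [|e IH]; last by rewrite nroots_lift.
by rewrite expr1 /chi0 addrC subrK.
Qed.

(** If P divides D and P^2 divides V^2 - D, then P divides V, so P^2 divides V^2 and hence D. *)
Lemma nroots_dvd P D e : pirr P -> P %| D -> ~~ (P ^+ 2 %| D) ->
  nroots (P ^+ e.+2) D = 0.
Proof.
move=> iP PD nP2; rewrite /nroots big1 // => V _; case: (boolP (_ %| _)) => // dV.
case/negP: nP2; have d2 : P ^+ 2 %| V ^+ 2 - D.
  by apply: dvdp_trans dV; apply: dvdp_exp2l.
have : P %| V ^+ 2.
  rewrite -(subrK D (V ^+ 2)) dvdp_addl // (dvdp_trans _ d2) //.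
  by rewrite expr2 dvdp_mulr.
move=> /(pirr_dvdX iP) PV; rewrite -(subKr (V ^+ 2) D).
by rewrite dvdp_sub // dvdp_exp2r.
Qed.

Lemma eqX_efactor (h : {poly F} -> int) K P c :
  (forall e, h (P ^+ e) = c ^+ e) -> pirr P ->
  eqX K ((1 - c *: 'X^((size P).-1)) * efactor K h P) 1.
Proof.
move=> hE iP; rewrite /efactor; under eq_bigr do rewrite hE.
by apply: geom_eqX; rewrite -subn1 subn_gt0 pirr_size.
Qed.

(** Write c for the symbol. If P does not divide D, Hensel's lemma makes the factor 1 + (1 + c) y /
    (1 - y) = (1 + c y) / (1 - y), and c^2 = 1. If P divides D exactly once, c = 0 and the factor is
    1 + y. *)
Lemma efactor_nroots K P D : pirr P -> ~~ (P ^+ 2 %| D) ->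
  let y := 'X^((size P).-1) : {poly int} in
  eqX K (efactor K (fun f => nroots f D) P * ((1 - y) * (1 - chi0 D P *: y))) (1 - y ^+ 2).
Proof.
move=> iP nP2 y; have d0 : (0 < (size P).-1)%N by rewrite -subn1 subn_gt0 pirr_size.
have [PD|nPD] := boolP (P %| D).
  have c0 : chi0 D P = 0 by apply/eqP; rewrite chi0_eq0.
  have n1 : nroots P D = 1 by apply/eqP; rewrite -subr_eq0 -[_ - _]/(chi0 D P) c0.
  rewrite c0 scale0r subr0 mulr1.
  suff H : eqX K (efactor K (fun f => nroots f D) P) (1 + y).
    apply: eqX_trans (eqXMr _ H) _; rewrite (_ : _ * _ = 1 - y ^+ 2) //; ring.
  rewrite /efactor; case: K => [|[|K]].
  - by move=> i.
  - move=> [|//] _; rewrite big_ord1 expr0 nroots1 mul0n scale1r expr0 coefD !coef1.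
    by rewrite /y coefXn (ltn_eqF d0) addr0.
  rewrite !big_ord_recl /= expr0 expr1 nroots1 mul0n mul1n !scale1r n1 scale1r.
  rewrite big1 ?addr0 // => e _.
  by rewrite /bump /= !add1n nroots_dvd // scale0r.
have c2 : chi0 D P ^+ 2 = 1 by rewrite chi0_sqr // nPD.
set c := chi0 D P in c2 *.
pose Z := \sum_(e < K) 1 ^+ e *: 'X^(e * (size P).-1) : {poly int}.
have ZE : eqX K ((1 - 1 *: 'X^((size P).-1)) * Z) 1 by apply: geom_eqX.
rewrite scale1r -/y in ZE.
(* The term e = 0 is 1 instead of 1 + c, which the constant corrects; for K = 0 the sum is empty and
   there is nothing to correct. *)
have RE : efactor K (fun f => nroots f D) P = (1 + c) *: Z - (0 < K)%:R * c%:P.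
  rewrite /efactor /Z; case: K {ZE Z} => [|K].
    by rewrite !big_ord0 scaler0 mul0r subr0.
  rewrite !big_ord_recl /=; set T := (X in _ = _ *: (_ + X) - _).
  rewrite (_ : \sum_(i < K) _ = (1 + c) *: T); last first.
    rewrite /T scaler_sumr; apply: eq_bigr => e _.
    by rewrite /bump /= add1n nroots_ndvd // expr1n scale1r.
  by rewrite expr0 nroots1 mul0n !expr0 scale1r -!mul_polyC polyCD; ring.
rewrite RE => i iK; move: (iK); apply: (_ : eqX K _ _).
have -> : (0 < K)%N by apply: leq_ltn_trans iK.
apply: eqX_trans (_ : eqX K (((1 + c) *: ((1 - y) * Z) - c%:P * (1 - y)) * (1 - c *: y)) _).
  by rewrite -!mul_polyC polyCD mul1r; apply: eqX_eq; ring.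
apply: eqX_trans (_ : eqX K (((1 + c) *: 1 - c%:P * (1 - y)) * (1 - c *: y)) _).
  apply: eqXMr; apply: eqXD => // j jK.
  by rewrite !coefZ ZE.
apply: eqX_eq; rewrite -!mul_polyC polyCD.
have c2' : c%:P ^+ 2 = 1 :> {poly int} by rewrite -rmorphXn /= c2.
transitivity (1 - c%:P ^+ 2 * y ^+ 2); [ring | by rewrite c2' mul1r].
Qed.

Definition Lcoef D n : int := \sum_(f <- monics F n) chi D f.
Definition rho D n : int := \sum_(f <- monics F n) nroots f D.

Lemma eqX_comp2 (p r : {poly int}) K : eqX K p r -> eqX K (p \Po 'X^2) (r \Po 'X^2).
Proof.
move=> E i iK; rewrite !coef_comp_poly_Xn //; case: (2 %| i)%N => //.
by apply: E; apply: leq_ltn_trans (leq_div _ _) iK.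
Qed.

(** The zeta function 1 / (1 - q u) of the polynomial ring, kept as an Euler product so that it can
    be compared with other products prime by prime. *)
Definition zetaX K : {poly int} := \prod_(P <- primes F K) efactor K (fun=> 1) P.

Lemma zetaX_inv K : eqX K ((1 - q%:R *: 'X) * zetaX K) 1.
Proof.
have pm : pmult (fun _ : {poly F} => 1 : int) by split=> // *; rewrite mulr1.
have E := eqXMl (1 - q%:R *: 'X) (eqX_sym (@euler_monics F _ _ K pm)).
apply: eqX_trans E _; apply: eqX_trans (@geom_eqX _ K 1 q%:R (ltn0Sn 0)).
rewrite expr1; apply: eqXMl => i iK; rewrite coef_poly iK coef_sum.
rewrite sum_monics_const mulr1 (bigD1 (Ordinal iK)) //= coefZ muln1 coefXn eqxx mulr1.
rewrite big1 ?addr0 // => j ji; rewrite coefZ muln1 coefXn.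
by case: eqP => [ij|]; [case/eqP: ji; apply/val_inj|rewrite mulr0].
Qed.

(* Comparing Euler factors, R(u) zeta(u^2) = zeta(u) L(u) for the series R of
   the [rho D n], and zeta(u) = 1 / (1 - q u). *)
Lemma rho_L_eqX D K : sqf D ->
  eqX K (gen K (rho D) * (1 - q%:R *: 'X)) (gen K (Lcoef D) * (1 - q%:R *: 'X^2)).
Proof.
move=> sD; pose Z2 := zetaX K \Po 'X^2.
have Z2inv : eqX K ((1 - q%:R *: 'X^2) * Z2) 1.
  have := eqX_comp2 (@zetaX_inv K); rewrite comp_polyM comp_polyB comp_polyZ comp_polyX.
  by rewrite rmorph1.
pose R := \prod_(P <- primes F K) efactor K (fun f => nroots f D) P.
pose L := \prod_(P <- primes F K) efactor K (chi D) P.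
have iK P : P \in primes F K -> pirr P by rewrite mem_primes => /andP[].
have RZL : eqX K (R * Z2) (zetaX K * L).
  rewrite /Z2 /zetaX rmorph_prod /= -!big_split; apply: eqX_prod => P PK /=.
  have iP := iK P PK; set d := (size P).-1; set y := 'X^d : {poly int}.
  set Z := efactor K (fun=> 1) P.
  have ZE : eqX K ((1 - y) * Z) 1.
    have := @eqX_efactor (fun=> 1) K P 1 (fun e => esym (expr1n _ e)) iP.
    by rewrite scale1r; apply.
  have Z2E : eqX K ((1 - y ^+ 2) * (Z \Po 'X^2)) 1.
    have := eqX_comp2 ZE; rewrite comp_polyM comp_polyB rmorph1 /y comp_Xn_poly.
    by rewrite -!exprM mulnC; apply.
  have LE : eqX K ((1 - chi0 D P *: y) * efactor K (chi D) P) 1.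
    by apply: eqX_efactor => // e; rewrite chiX ?pirr_monic // chi_pirr.
  have RE := @efactor_nroots K P D iP (sD P iP); rewrite /= -/d -/y in RE.
  set Rf := efactor K (fun f => nroots f D) P in RE *; set Lf := efactor K (chi D) P in LE *.
  set Zc := Z \Po _ in Z2E *.
  apply: eqX_trans (_ : eqX K (Rf * Zc * (((1 - y) * Z) * ((1 - chi0 D P *: y) * Lf))) _).
    have := eqXMl (Rf * Zc) (eqXM ZE LE); rewrite !mulr1; exact: eqX_sym.
  apply: eqX_trans (_ : eqX K ((Rf * ((1 - y) * (1 - chi0 D P *: y))) * (Zc * Z * Lf)) _).
    by apply: eqX_eq; ring.
  apply: eqX_trans (eqXMr _ RE) _.
  apply: eqX_trans (_ : eqX K (((1 - y ^+ 2) * Zc) * (Z * Lf)) _).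
    by apply: eqX_eq; ring.
  by apply: eqX_trans (eqXMr _ Z2E) _; rewrite mul1r.
apply: eqX_trans (eqXMr _ (@euler_monics F _ _ K (pmult_nroots D))) _.
apply: eqX_trans (eqX_sym (eqXMr _ (@euler_monics F _ _ K (pmult_chi D)))).
rewrite -/R -/L.
apply: eqX_trans (_ : eqX K ((R * (1 - q%:R *: 'X)) * ((1 - q%:R *: 'X^2) * Z2)) _).
  have := eqXMl (R * (1 - q%:R *: 'X)) Z2inv; rewrite mulr1; exact: eqX_sym.
apply: eqX_trans (_ : eqX K ((R * Z2) * ((1 - q%:R *: 'X^2) * (1 - q%:R *: 'X))) _).
  by apply: eqX_eq; ring.
apply: eqX_trans (eqXMr _ RZL) _.
apply: eqX_trans (_ : eqX K (((1 - q%:R *: 'X) * zetaX K) * (L * (1 - q%:R *: 'X^2))) _).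
  by apply: eqX_eq; ring.
by apply: eqX_trans (eqXMr _ (@zetaX_inv K)) _; rewrite mul1r.
Qed.

End LocalFactors.

(** * Pairs (f, V), the recurrence for their number, and the symmetry of L *)

Section FunctionalEquation.
Variable F : finFieldType.
Local Notation q := #|F|.
Local Notation qz := (#|F|%:R : int).
Implicit Types (f G D V : {poly F}).

(* Extension by zero to negative indices. *)
Definition ext (a : nat -> int) (z : int) : int := if z is Posz n then a n else 0.

Lemma ext_sub a n k : (k <= n)%N -> ext a (n%:Z - k%:Z) = a (n - k)%N.
Proof. by move=> kn; rewrite subzn. Qed.

Lemma ext1 a n : ext a (n%:Z - 1) = if n is m.+1 then a m else 0.
Proof. by case: n => [|m] //; rewrite -addn1 PoszD addrK. Qed.

Lemma ext2 a n : ext a (n%:Z - 2) = if n is m.+2 then a m else 0.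
Proof. by case: n => [|[|m]] //; rewrite -addn2 PoszD addrK. Qed.

Lemma ext_neg a (z : int) : z < 0 -> ext a z = 0.
Proof. by case: z. Qed.

Definition tau n G : int := \sum_(f <- monics F n) (f %| G)%R%:R.

Lemma tau_big n G : G != 0 -> ((size G).-1 < n)%N -> tau n G = 0.
Proof.
move=> G0 Gn; rewrite /tau big1_seq // => f /andP[_ fn].
rewrite gtNdvdp // (monics_size fn) ltnS.
by move: Gn; case: (size G).
Qed.

Lemma tau_sym n G : G != 0 -> (n <= (size G).-1)%N ->
  tau n G = tau ((size G).-1 - n) G.
Proof.
move=> G0; set e := (size G).-1 => ne.
pose G1 := (lead_coef G)^-1 *: G.
have lG : (lead_coef G)^-1 != 0 by rewrite invr_eq0 lead_coef_eq0.
have G1m : G1 \in monics F e.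
  rewrite mem_monics monicE lead_coefZ mulVf ?lead_coef_eq0 // eqxx size_scale //=.
  by rewrite prednK // size_poly_gt0.
have tE m : tau m G = \sum_(f <- [seq f <- monics F m | f %| G1]) 1.
  rewrite /tau big_filter [RHS]big_mkcond; apply: eq_bigr => f _.
  by rewrite dvdpZr //; case: (f %| G).
rewrite !tE; apply: (big_bij (h := fun f => G1 %/ f)).
- by rewrite filter_uniq // uniq_monics.
- by rewrite filter_uniq // uniq_monics.
- move=> f g; rewrite !mem_filter => /andP[df fm] /andP[dg gm] fg.
  have [_ h1 E1] := monics_divp fm G1m df; have [_ h2 E2] := monics_divp gm G1m dg.
  rewrite fg in E1; apply: (mulIf (monic_neq0 (monics_monic h2))).
  by rewrite -E1.
move=> f; rewrite mem_filter; split=> [/andP[df fm]|[g]].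
  have [_ gm E1] := monics_divp fm G1m df; exists (G1 %/ f).
    by rewrite mem_filter gm andbT [X in _ %| X]E1 dvdp_mull.
  have g0 := monic_neq0 (monics_monic gm).
  by rewrite [X in X %/ (G1 %/ f)]E1 mulpK.
rewrite mem_filter => /andP[dg gm] ->.
have [_ fm E1] := monics_divp gm G1m dg; rewrite subKn // in fm.
by rewrite fm [X in _ %| X]E1 dvdp_mull.
Qed.

(* Pairs (f, V) with f | V^2 - D: the involution f <-> (V^2 - D) / f relates
   the counts in complementary degrees; the degree of V^2 - D is 2g + 1 for
   deg V <= g, and 2 deg V beyond. *)
Definition Mcount D n j : int := \sum_(V <- polys F j) tau n (V ^+ 2 - D).

Definition Mtop D n v : int :=
  \sum_(V <- polys F v.+1 | size V == v.+1) tau n (V ^+ 2 - D).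

(** For j >= n the V of degree less than j are equidistributed modulo f, with q^(j-n) of them in
    each class. *)
Lemma Mcount_rho D n j : (n <= j)%N -> Mcount D n j = qz ^+ (j - n) * rho D n.
Proof.
move=> nj; rewrite /Mcount /tau exchange_big /rho mulr_sumr.
apply: eq_big_seq => f fn /=; have sf := monics_size fn.
under eq_bigr do rewrite -dvd_sq_mod.
by rewrite (sum_polys_mod (fun V => (f %| V ^+ 2 - D)%R%:R) sf nj) /nroots sf.
Qed.

Lemma Mcount_diag D n : Mcount D n n = rho D n.
Proof. by rewrite Mcount_rho // subnn mul1r. Qed.

Lemma McountS D n v : Mcount D n v.+1 = Mcount D n v + Mtop D n v.
Proof.
rewrite /Mcount /Mtop (bigID (fun V => size V == v.+1)) addrC /=; congr (_ + _).
rewrite -big_filter; apply: perm_big.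
apply: uniq_perm; rewrite ?filter_uniq ?uniq_polys // => V.
by rewrite mem_filter !mem_polys -ltn_neqAle ltnS.
Qed.

Variables (D : {poly F}) (g : nat).
Hypothesis sD : size D = (2 * g + 2)%N.

Lemma size_sq_small V : (size V <= g.+1)%N -> size (V ^+ 2 - D) = (2 * g + 2)%N.
Proof.
move=> sV; rewrite addrC size_polyDl size_polyN ?sD //.
by rewrite expr2 (leq_ltn_trans (size_polyMleq _ _)) //; move: sV; set s := size V; lia.
Qed.

Lemma size_sq_big V v : (g < v)%N -> size V = v.+1 -> size (V ^+ 2 - D) = (2 * v).+1.
Proof.
move=> gv sV; have V0 : V != 0 by rewrite -size_poly_eq0 sV.
have s2 : size (V ^+ 2) = (2 * v).+1.
  by rewrite expr2 size_mul // sV addnS /= mul2n -addnn addSn.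
by rewrite size_polyDl s2 // size_polyN sD; lia.
Qed.

Lemma Mcount_sym n : (n <= 2 * g + 1)%N ->
  Mcount D n g.+1 = Mcount D (2 * g + 1 - n) g.+1.
Proof.
move=> n2; apply: eq_big_seq => V; rewrite mem_polys => sV.
have s2 := size_sq_small sV.
rewrite tau_sym -?size_poly_eq0 s2 ?addn2 //=; last by rewrite -addn1.
by rewrite addn1.
Qed.

Lemma Mcount_big n : (2 * g + 1 < n)%N -> Mcount D n g.+1 = 0.
Proof.
move=> n2; rewrite /Mcount big1_seq // => V /andP[_]; rewrite mem_polys => sV.
have s2 := size_sq_small sV.
rewrite tau_big // ?s2 -?size_poly_eq0 ?s2 ?addn2 //.
by rewrite /= -addn1.
Qed.

Lemma Mtop_sym n v : (g < v)%N -> (n <= 2 * v)%N -> Mtop D n v = Mtop D (2 * v - n) v.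
Proof.
move=> gv nv; apply: eq_bigr => V /eqP sV; have s2 := size_sq_big gv sV.
by rewrite tau_sym ?s2 // -size_poly_eq0 s2.
Qed.

Lemma Mtop_big n v : (g < v)%N -> (2 * v < n)%N -> Mtop D n v = 0.
Proof.
move=> gv nv; rewrite /Mtop big1 // => V /eqP sV; have s2 := size_sq_big gv sV.
by rewrite tau_big ?s2 // -size_poly_eq0 s2.
Qed.

Lemma Mtop_small n v : (n <= v)%N -> Mtop D n v = (qz - 1) * qz ^+ (v - n) * rho D n.
Proof.
move=> nv; have /eqP := McountS D n v; rewrite addrC -subr_eq => /eqP <-.
rewrite !Mcount_rho ?(leq_trans nv) // subSn // exprS; ring.
Qed.

(** With v = n - k, the symmetry sends n to 2v - n = n - 2k. This is at most v, so [Mtop_small]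
    evaluates it; if it is negative there is no divisor of degree n at all. *)
Lemma MtopE n k : (0 < k)%N -> (k + g < n)%N ->
  Mtop D n (n - k) = (qz - 1) * qz ^+ k * ext (rho D) (n%:Z - (2 * k)%:Z).
Proof.
move=> k0 kg; have [kn|nk] := leqP (2 * k) n; last first.
  rewrite ext_neg ?mulr0 ?Mtop_big //; try by lia.
have -> : Mtop D n (n - k) = Mtop D (n - 2 * k) (n - k).
  by rewrite Mtop_sym; try lia; congr Mtop; lia.
rewrite Mtop_small; last by lia.
by rewrite ext_sub // (_ : n - k - (n - 2 * k) = k)%N //; lia.
Qed.

Lemma McountE n : (g < n)%N ->
  Mcount D n g.+1 = qz ^+ (n - g) * ext (rho D) ((2 * g + 1)%:Z - n%:Z).
Proof.
move=> gn; have [n2|n2] := leqP n (2 * g + 1); last first.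
  by rewrite Mcount_big // ext_neg ?mulr0 //; lia.
rewrite Mcount_sym // Mcount_rho; last by lia.
by rewrite ext_sub //; congr (_ ^+ _ * _); lia.
Qed.

(** Start from [Mcount_diag] and lower the bound on deg V from n to g + 1, peeling off one [Mtop]
    per degree. In the part that remains V^2 - D always has degree 2g + 1, so it is reflected by n
    -> 2g + 1 - n. *)
Lemma rho_rec n : (g < n)%N ->
  rho D n = qz ^+ (n - g) * ext (rho D) ((2 * g + 1)%:Z - n%:Z) +
    (qz - 1) * \sum_(1 <= k < n - g) qz ^+ k * ext (rho D) (n%:Z - (2 * k)%:Z).
Proof.
move=> gn; rewrite -Mcount_diag -McountE //.
have tele j : (j < n - g)%N -> Mcount D n n =
    Mcount D n (n - j) + \sum_(1 <= k < j.+1) Mtop D n (n - k).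
  elim: j => [|j IH] jn; first by rewrite subn0 big_geq // addr0.
  rewrite IH; last by lia.
  rewrite [in RHS]big_nat_recr //= [RHS]addrCA [LHS]addrC; congr (_ + _).
  by rewrite -McountS; congr (Mcount D n _); lia.
rewrite (tele (n - g).-1); last by lia.
rewrite prednK; last by lia.
rewrite (_ : n - (n - g).-1 = g.+1)%N; last by lia.
congr (_ + _); rewrite mulr_sumr; apply: eq_big_nat => k /andP[k1 kn].
by rewrite MtopE ?mulrA //; lia.
Qed.

Hypothesis oddF : odd q.
Hypothesis sqD : sqf D.

Lemma rho_L z : ext (rho D) z - qz * ext (rho D) (z - 1) =
  ext (Lcoef D) z - qz * ext (Lcoef D) (z - 2).
Proof.
case: z => [n|n]; last first.
  by rewrite !ext_neg; [rewrite !mulr0 | lia..].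
have := @rho_L_eqX F oddF D n.+1 sqD n (ltnSn n).
rewrite !mulrBr !mulr1 -!scalerAr !coefB !coefZ coefMX coefMXn !coef_poly ltnSn /= => E.
rewrite ext1 ext2; case: n E => [|[|n]] //=; rewrite ?coef_poly ?ltnS ?leqnSn //.
by rewrite !subSS subn0 leqW ?leqnSn.
Qed.

(* The coefficients of L(u) / (1 - q u) = R(u) / (1 - q u^2). *)
Definition sig n : int := \sum_(k < n.+1) qz ^+ k * Lcoef D (n - k).

Lemma sig_L z : ext sig z - qz * ext sig (z - 1) = ext (Lcoef D) z.
Proof.
case: z => [[|n]|n].
- by rewrite ext1 mulr0 subr0 /= /sig big_ord1 mul1r subn0.
- rewrite ext1 /= {1}/sig big_ord_recl subn0 mul1r.
  rewrite (_ : \sum_(i < n.+1) _ = qz * sig n) ?addrK // mulr_sumr.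
  by apply: eq_bigr => i _; rewrite /= /bump /= add1n exprS subSS mulrA.
by rewrite !ext_neg ?mulr0 ?subr0 //; lia.
Qed.

(** By [rho_L] and [sig_L], the difference d of the two sides satisfies d(z) = q d(z - 1), and it
    vanishes at negative z. *)
Lemma sig_rho z : ext sig z - qz * ext sig (z - 2) = ext (rho D) z.
Proof.
have [m] := ubnP `|z|%N; elim: m z => // m IH z zm.
have [z0|z0] := ltP z 0; first by rewrite !ext_neg; [rewrite mulr0 | lia..].
have H := rho_L z; rewrite -!sig_L -[z - 2 - 1]addrAC in H.
have IH1 : ext sig (z - 1) - qz * ext sig (z - 1 - 2) = ext (rho D) (z - 1).
  have [z1|z1] := ltP (z - 1) 0; first by rewrite !ext_neg; [rewrite mulr0 | lia..].
  by apply: IH; lia.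
move: H; rewrite -IH1 => /eqP; rewrite subr_eq => /eqP ->; ring.
Qed.

Lemma sum_tele n : (g < n)%N ->
  \sum_(1 <= k < n - g) qz ^+ k * ext (rho D) (n%:Z - (2 * k)%:Z) =
  qz * ext sig (n%:Z - 2) - qz ^+ (n - g) * ext sig ((2 * g)%:Z - n%:Z).
Proof.
(* By [sig_rho] the k-th term of the sum is u k - u k.+1. *)
move=> gn; pose u k := qz ^+ k * ext sig (n%:Z - (2 * k)%:Z).
rewrite (eq_big_nat _ _ (F2 := fun k => - u k.+1 - - u k)); last first.
  move=> k _; rewrite -sig_rho /u exprSr.
  rewrite (_ : n%:Z - (2 * k.+1)%:Z = n%:Z - (2 * k)%:Z - 2); last by lia.
  by ring.
rewrite telescope_sumr; last by lia.
rewrite opprK addrC /u expr1; congr (_ - _ * ext sig _); by lia.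
Qed.

(** The sum of the functional equations at n and at n - 1, which is the form that the recurrence
    yields once [sig] is eliminated. Induction from the trivial case n = g then separates them. *)
Lemma L_pair n : (g < n)%N ->
  ext (Lcoef D) n%:Z + qz * ext (Lcoef D) (n%:Z - 1) =
  qz ^+ (n - g) * (ext (Lcoef D) ((2 * g)%:Z - n%:Z) +
                   ext (Lcoef D) ((2 * g)%:Z - n%:Z + 1)).
Proof.
move=> gn; have H := rho_rec gn; rewrite sum_tele // in H.
rewrite -[rho D n]/(ext (rho D) n%:Z) -!sig_rho in H.
rewrite -!sig_L.
rewrite (_ : (2 * g + 1)%:Z - n%:Z = (2 * g)%:Z - n%:Z + 1) in H; last by lia.
rewrite (_ : (2 * g)%:Z - n%:Z + 1 - 2 = (2 * g)%:Z - n%:Z - 1) in H; last by lia.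
rewrite (_ : (2 * g)%:Z - n%:Z + 1 - 1 = (2 * g)%:Z - n%:Z); last by lia.
rewrite (_ : n%:Z - 1 - 1 = n%:Z - 2); last by lia.
move: H => /eqP; rewrite subr_eq => /eqP ->; ring.
Qed.

Theorem functional_equation k :
  ext (Lcoef D) (g + k)%:Z = qz ^+ k * ext (Lcoef D) (g%:Z - k%:Z).
Proof.
elim: k => [|k IH]; first by rewrite mul1r addn0 subr0.
have := @L_pair (g + k.+1) (ltac:(lia)).
rewrite (_ : (g + k.+1)%:Z - 1 = (g + k)%:Z); last by lia.
rewrite IH (_ : (2 * g)%:Z - (g + k.+1)%:Z = g%:Z - k.+1%:Z); last by lia.
rewrite (_ : g%:Z - k.+1%:Z + 1 = g%:Z - k%:Z); last by lia.
rewrite addKn mulrA -exprS mulrDr => /eqP.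
by rewrite -subr_eq addrK => /eqP.
Qed.

(** The mirror index 2g - n is negative: this is how L(u) is seen to be a polynomial. *)
Lemma Lcoef_big n : (2 * g < n)%N -> Lcoef D n = 0.
Proof.
move=> gn; have := functional_equation (n - g).
by rewrite subnKC ?[ext _ (_ - _)]ext_neg ?mulr0 //; lia.
Qed.

Lemma Lcoef_sym n : (n <= g)%N -> Lcoef D (2 * g - n) = qz ^+ (g - n) * Lcoef D n.
Proof.
move=> ng; have := functional_equation (g - n).
by rewrite ext_sub ?leq_subr // subKn // (_ : g + (g - n) = 2 * g - n)%N //; lia.
Qed.

End FunctionalEquation.

(** * The zeta function of the curve *)

Section LogDerivative.
Variable S : comNzRingType.
Implicit Types p r u v : {poly S}.

Lemma coefXderiv p i : ('X * p^`())`_i = p`_i *+ i.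
Proof.
rewrite coefXM; case: i => [|i] /=; first by rewrite mulr0n.
by rewrite coef_deriv.
Qed.

Lemma eqX_deriv K p r : eqX K p r -> eqX K ('X * p^`()) ('X * r^`()).
Proof. by move=> E i iK; rewrite !coefXderiv E. Qed.

Lemma logderiv_prod (T : eqType) K (s : seq T) (E C : T -> {poly S}) :
  (forall x, x \in s -> eqX K ('X * (E x)^`()) (E x * C x)) ->
  eqX K ('X * (\prod_(x <- s) E x)^`()) ((\prod_(x <- s) E x) * \sum_(x <- s) C x).
Proof.
elim: s => [|x s IH] H; first by rewrite !big_nil derivC !mulr0.
rewrite !big_cons derivM; set Pi := \prod_(y <- s) E y; set Sg := \sum_(y <- s) C y.
have H1 : eqX K ('X * (E x)^`()) (E x * C x) by apply: H; rewrite mem_head.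
have H2 : eqX K ('X * Pi^`()) (Pi * Sg).
  by apply: IH => y ys; apply: H; rewrite inE ys orbT.
have H3 := eqXD (eqXMr Pi H1) (eqXMl (E x) H2).
apply: eqX_trans (eqX_trans H3 _); first by apply: eqX_eq; ring.
by apply: eqX_eq; ring.
Qed.

End LogDerivative.

Section LSeries.
Variable F : finFieldType.
Local Notation q := #|F|.
Implicit Types (f g P D V : {poly F}).

(* u d/du of the logarithm of the Euler factor at P. *)
Definition cfactor K D P : {poly int} :=
  (((size P).-1)%:R * chi0 D P) *: 'X^((size P).-1) * efactor K (chi D) P.

Definition Cser K D : {poly int} := \sum_(P <- primes F K) cfactor K D P.

Lemma chiX0 D P e : pirr P -> chi D (P ^+ e) = chi0 D P ^+ e.
Proof. by move=> iP; rewrite chiX ?pirr_monic // chi_pirr. Qed.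

Lemma logderiv_efactor K D P : pirr P ->
  eqX K ('X * (efactor K (chi D) P)^`()) (efactor K (chi D) P * cfactor K D P).
Proof.
move=> iP; set d := (size P).-1; set c := chi0 D P; set E := efactor K (chi D) P.
have d0 : (0 < d)%N by rewrite /d -subn1 subn_gt0 pirr_size.
have EE : eqX K ((1 - c *: 'X^d) * E) 1.
  by apply: eqX_efactor => // e; apply: chiX0.
(* Differentiating the relation (1 - c X^d) E = 1 avoids handling the series E itself; multiplying
   by E afterwards removes the factor 1 - c X^d. *)
have DE : eqX K (- ((d%:R * c) *: 'X^d * E) + (1 - c *: 'X^d) * ('X * E^`())) 0.
  have := eqX_deriv EE; rewrite derivC mulr0 derivM derivB derivC sub0r derivZ derivXn.
  rewrite (_ : 'X * _ = - (c *: ('X * 'X^(d.-1) *+ d) * E) + (1 - c *: 'X^d) * ('X * E^`())).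
    by rewrite -exprS prednK // -[_ *+ d]scaler_nat scalerA [c * _]mulrC.
  rewrite -!mul_polyC -[_ *+ d]mulr_natr -[_ *+ d]mulr_natr; ring.
have H := eqXMl E DE; rewrite mulr0 in H.
have H2 := eqXMr ('X * E^`()) EE.
rewrite mul1r in H2.
apply: eqX_trans (eqX_sym H2) _.
have H3 := eqXD H (@eqX_refl _ K (E * ((d%:R * c) *: 'X^d * E))).
rewrite add0r in H3; apply: eqX_trans H3; apply: eqX_eq; ring.
Qed.

Lemma logderiv_L K D : eqX K ('X * (gen K (Lcoef D))^`()) (gen K (Lcoef D) * Cser K D).
Proof.
have E := @euler_monics F _ _ K (pmult_chi D).
apply: eqX_trans (eqX_deriv E) _.
apply: eqX_trans (eqX_sym (eqXMr _ E)).
apply: logderiv_prod => P; rewrite mem_primes => /andP[_]; exact: logderiv_efactor.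
Qed.

Lemma coef_efactor K D P i : pirr P -> (i < K)%N ->
  (efactor K (chi D) P)`_i =
  if ((size P).-1 %| i)%N then chi0 D P ^+ (i %/ (size P).-1) else 0.
Proof.
move=> iP iK; set d := (size P).-1.
have d0 : (0 < d)%N by rewrite /d -subn1 subn_gt0 pirr_size.
rewrite /efactor coef_sum; case: ifP => di.
  have jK : (i %/ d < K)%N by apply: leq_ltn_trans (leq_div _ _) iK.
  rewrite (bigD1 (Ordinal jK)) //= coefZ coefXn -/d divnK // eqxx mulr1 chiX0 //.
  rewrite big1 ?addr0 // => e ne; rewrite coefZ coefXn -/d.
  case: eqP => [ie|]; last by rewrite mulr0.
  by case/eqP: ne; apply/val_inj; rewrite /= ie mulnK.
rewrite big1 // => e _; rewrite coefZ coefXn -/d.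
by case: eqP => [ie|]; [rewrite ie dvdn_mull in di|rewrite mulr0].
Qed.

Lemma coef_Cser K D k : (k < K)%N -> (Cser K D)`_k =
  \sum_(P <- primes F K)
    if (0 < k)%N && ((size P).-1 %| k)%N
    then (size P).-1%:R * chi0 D P ^+ (k %/ (size P).-1) else 0.
Proof.
move=> kK; rewrite coef_sum; apply: eq_big_seq => P; rewrite mem_primes => /andP[_ iP].
have d0 : (0 < (size P).-1)%N by rewrite -subn1 subn_gt0 pirr_size.
rewrite /cfactor -scalerAl coefZ coefXnM; case: ltnP => kd.
  rewrite mulr0; case: k {kK} kd => [|k] kd //=.
  by rewrite gtnNdvd.
rewrite coef_efactor ?(leq_ltn_trans (leq_subr _ _)) //.
rewrite (leq_trans d0 kd) /= dvdn_subl //.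
case: ifP => [dk|]; last by rewrite mulr0.
rewrite -mulrA -exprS; congr (_ * _ ^+ _).
by rewrite -{2}(subnK kd) divnDr // divnn d0 addn1.
Qed.

End LSeries.

(** * The exponential of a power series *)

Section ExpSeries.
Variables (a N : nat -> rat).
Hypothesis aN : forall k, (0 < k)%N -> k%:R * a k = N k.

Let G K : {poly rat} := \sum_(1 <= k < K) a k *: 'X^k.
Let E K : {poly rat} := \sum_(j < K) (j`!%:R)^-1 *: G K ^+ j.

Lemma coef_G K i : (G K)`_i = if (0 < i < K)%N then a i else 0.
Proof.
rewrite /G coef_sum; case: ifP => [/andP[i0 iK]|iF].
  rewrite (bigD1_seq i) ?iota_uniq ?mem_index_iota ?i0 //= coefZ coefXn eqxx mulr1.
  rewrite big1 ?addr0 // => k ki; rewrite coefZ coefXn eq_sym (negPf ki).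
  by rewrite mulr0.
rewrite big1_seq // => k; rewrite mem_index_iota /= => kK; rewrite coefZ coefXn.
by case: eqP => [ik|]; [rewrite ik kK in iF|rewrite mulr0].
Qed.

Lemma eqX_G K M : (K <= M)%N -> eqX K (G M) (G K).
Proof. by move=> KM i iK; rewrite !coef_G iK (leq_trans iK KM). Qed.

Lemma eqX_exp (p r : {poly rat}) K j : eqX K p r -> eqX K (p ^+ j) (r ^+ j).
Proof.
move=> pr; elim: j => [|j IH]; first by rewrite !expr0.
by rewrite !exprS; apply: eqXM.
Qed.

Lemma coef_GX K j i (u : {poly rat}) : (i < j)%N -> (u * G K ^+ j)`_i = 0.
Proof.
move=> ij; have [H HE] : exists H, G K = 'X * H.
  exists (\sum_(1 <= k < K) a k *: 'X^(k.-1)); rewrite /G mulr_sumr.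
  apply: eq_big_nat => k /andP[k0 _]; rewrite -scalerAr -exprS prednK //.
by rewrite HE exprMn mulrCA coefXnM ij.
Qed.

(** G has no constant term, so G^j starts in degree j. Any cutoff K > i therefore gives the same
    i-th coefficient, and the single polynomial [E K] serves for all i < K. *)
Lemma exp_series_coefE K i : (i < K)%N -> exp_series_coef a i = (E K)`_i.
Proof.
move=> iK; rewrite /exp_series_coef -/(G i.+1) /E !coef_sum.
rewrite [RHS](bigID (fun j : 'I_K => (j < i.+1)%N)) /= [X in _ + X]big1 ?addr0; last first.
  by move=> j; rewrite -leqNgt => ij; rewrite coefZ -[_ ^+ j]mul1r coef_GX ?mulr0.
rewrite (big_ord_widen_cond K predT (fun j => ((j`!%:R)^-1 *: G i.+1 ^+ j)`_i)) //=.
apply: eq_bigr => j _; rewrite !coefZ; congr (_ * _).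
by rewrite (eqX_exp j (eqX_G iK)).
Qed.

Lemma logderiv_exp K : eqX K ('X * (E K)^`()) (\poly_(k < K) (if k is 0 then 0 else N k) * E K).
Proof.
have XG : 'X * (G K)^`() = \poly_(k < K) (if k is 0 then 0 else N k).
  apply/polyP => i; rewrite coefXderiv coef_G coef_poly.
  case: i => [|i] /=; first by rewrite mulr0n if_same.
  by case: ifP => _; rewrite ?mul0rn // -mulr_natl aN.
rewrite -XG; case: K {XG} => [i //|K]; set g := G K.+1.
have dE : 'X * (E K.+1)^`() = 'X * g^`() * \sum_(j < K) (j`!%:R)^-1 *: g ^+ j.
  rewrite /E big_ord_recl /= derivD expr0 derivZ derivC scaler0 add0r.
  rewrite raddf_sum -mulrA; congr (_ * _); rewrite mulr_sumr; apply: eq_bigr => j _.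
  rewrite /= /bump /= add1n derivZ deriv_exp -/g -scaler_nat scalerA -scalerAr.
  by rewrite factS natrM invfM mulrAC mulVf ?pnatr_eq0 // mul1r.
rewrite {}dE /E big_ord_recr /= -/g mulrDr => i iK.
(* Differentiation loses the top term g^K / K!; multiplied by X g' it only affects degrees above
   K. *)
rewrite coefD [X in _ + X](_ : _ = 0) ?addr0 //.
rewrite -mulrA coefXM; case: i iK => // i iK.
by rewrite /= -scalerAr coefZ coef_GX ?mulr0.
Qed.

End ExpSeries.

(** * Counting points by minimal polynomials *)

Section PointCount.
Variable F : finFieldType.
Local Notation q := #|F|.
Hypothesis oddF : odd q.
Variable L : splittingFieldType F.
Local Notation LF := (finvect_type L).
Variable k : nat.
Hypothesis cardL : #|LF| = (q ^ k)%N.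
Hypothesis k_gt0 : (0 < k)%N.
Implicit Types (P D f : {poly F}) (x y : L).

Local Notation toL := (map_poly (in_alg L)).

Lemma oddLF : odd #|LF|.
Proof. by rewrite cardL oddX oddF orbT. Qed.

Lemma dim_L : \dim {:L} = k.
Proof.
have : (#|LF| = q ^ \dim {:LF})%N by rewrite -card_vspace card_vspacef.
by rewrite cardL => /eqP; rewrite eqn_exp2l ?finNzRing_gt1 // => /eqP ->.
Qed.

(** P is the minimal polynomial of x; its degree is the dimension of F(x), which divides that of
    L. *)
Lemma pirr_root_ex x : exists2 P, pirr P & root (toL P) x /\ ((size P).-1 %| k)%N.
Proof.
have /polyOver1P[P PE] := minPolyOver 1%AS x.
have mP : P \is monic by rewrite -(map_monic (in_alg L)) -PE monic_minPoly.
have sP : size P = (adjoin_degree 1%AS x).+1.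
  by rewrite -(size_map_poly (in_alg L)) -PE size_minPoly.
have dP : (size P).-1 = \dim <<1; x>>%VS by rewrite sP dim_Fadjoin dimv1 muln1.
exists P; last first.
  split; first by rewrite -PE root_minPoly.
  by rewrite dP -dim_L field_dimS // subvf.
rewrite /pirr mP; apply/irreducibleP; split.
  by rewrite sP ltnS adjoin_degreeE divn_gt0 ?dimv1 // adim_gt0.
move=> g sg dg.
have : (toL g %= minPoly 1%AS x) || (toL g %= 1).
  by apply: minPoly_irr; [apply/polyOver1P; exists g | rewrite PE dvdp_map].
rewrite PE eqp_map => /orP[//|].
by rewrite -[1](rmorph1 toL) eqp_map -size_poly_eq1 (negPf sg).
Qed.

Lemma pirr_root_uniq P Q x : pirr P -> pirr Q ->
  root (toL P) x -> root (toL Q) x -> P = Q.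
Proof.
move=> iP iQ rP rQ; apply/eqP; apply: contraT => nPQ.
have : coprimep (toL P) (toL Q) by rewrite coprimep_map coprimep_pirr.
by move=> /coprimep_root/(_ rP); rewrite -rootE rQ.
Qed.

Lemma pirr_dvd_genPoly P : pirr P -> ((size P).-1 %| k)%N ->
  P %| 'X^(q ^ k) - 'X.
Proof.
move=> iP /dvdnP[m ->]; rewrite -(red_eq0 iP) redB redX subr_eq0; apply/eqP.
elim: m => [|m IH]; first by rewrite mul0n expn0 expr1.
by rewrite mulSn expnD exprM -card_KP expf_card IH.
Qed.

(** If deg P divides k, then P divides 'X^(q^k) - 'X, the product of the 'X - x over all x in L, so
    P splits there with simple roots. Otherwise a root would have a minimal polynomial, equal to P,
    of degree dividing k. *)
Lemma card_roots P : pirr P ->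
  (\sum_(x : LF) root (toL P) x)%N = if ((size P).-1 %| k)%N then (size P).-1 else 0%N.
Proof.
move=> iP; case: ifP => [dk|ndk]; last first.
  rewrite big1 // => x _; case: (boolP (root _ _)) => // rx.
  have [Q iQ [rQ dQ]] := pirr_root_ex x.
  by rewrite (pirr_root_uniq iP iQ rx rQ) dQ in ndk.
have : toL P %| \prod_(x : LF) ('X - (x : L)%:P).
  have := finField_genPoly LF; rewrite cardL => E.
  rewrite -[X in _ %| X]E.
  have -> : ('X^(q ^ k) - 'X : {poly LF}) = toL ('X^(q ^ k) - 'X).
    by rewrite rmorphB /= map_polyXn map_polyX.
  by rewrite dvdp_map pirr_dvd_genPoly.
move=> /dvdp_prod_XsubC[m Pm].
have mP : toL P \is monic by rewrite map_monic pirr_monic.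
have PE : toL P = \prod_(x <- mask m (index_enum LF)) ('X - (x : L)%:P).
  by apply/eqP; rewrite -eqp_monic // monic_prod_XsubC.
have um : uniq (mask m (index_enum LF)) by rewrite mask_uniq // index_enum_uniq.
have sE : (size P).-1 = size (mask m (index_enum LF)).
  by rewrite -(size_map_poly (in_alg L)) PE size_prod_XsubC.
rewrite sE -(card_uniqP um) -sum1_card [RHS]big_mkcond; apply: eq_bigr => x _.
by rewrite PE root_prod_XsubC; case: (x \in _).
Qed.

Lemma odd_geom Q n : odd Q -> odd (\sum_(i < n) Q ^ i) = odd n.
Proof.
move=> oQ; elim: n => [|n IH]; first by rewrite big_ord0.
by rewrite big_ord_recr /= oddD IH oddX oQ orbT addbT.
Qed.

Lemma chi0_pow_parity D P a b : pirr P -> (0 < a)%N -> (0 < b)%N -> odd a = odd b ->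
  chi0 D P ^+ a = chi0 D P ^+ b.
Proof.
move=> iP; have H m : (0 < m)%N -> chi0 D P ^+ m = chi0 D P ^+ (if odd m then 1 else 2).
  case: ifP => om m0; first by rewrite chi0_odd.
  case: m om m0 => [|m] // om _; rewrite exprS chi0_odd //.
  by rewrite -[odd m]negbK -[~~ odd m]/(odd m.+1) om.
by move=> a0 b0 ab; rewrite (H a) // (H b) // ab.
Qed.

Lemma sqc_root D P x : pirr P -> root (toL P) x ->
  sqc ((toL D).[x] : LF) = chi0 D P ^+ (k %/ (size P).-1).
Proof.
move=> iP rx; set d := (size P).-1.
have dk : (d %| k)%N.
  have [Q iQ [rQ dQ]] := pirr_root_ex x.
  by rewrite /d (pirr_root_uniq iP iQ rx rQ).
have d0 : (0 < d)%N by rewrite /d -subn1 subn_gt0 pirr_size.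
have kd0 : (0 < k %/ d)%N by rewrite divn_gt0 // dvdn_leq.
(* t = (q^k - 1) / (q^d - 1) is the factor between the exponents of Euler's criterion in L and
   modulo P. It is a sum of k / d odd terms, so it has the parity of k / d, and positive powers of a
   symbol depend only on the parity of the exponent. *)
set t := (\sum_(i < k %/ d) (q ^ d) ^ i)%N.
have ot : odd t = odd (k %/ d) by rewrite odd_geom // oddX oddF orbT.
have t0 : (0 < t)%N.
  rewrite /t; case: (k %/ d)%N kd0 => // n _; rewrite big_ord_recl expn0.
  by [].
have kt : ((q ^ k).-1)./2 = (((q ^ d).-1)./2 * t)%N.
  rewrite -[in LHS](divnK dk) mulnC expnM predn_exp -/t.
  have : ~~ odd (q ^ d).-1.
    have : odd (q ^ d) by rewrite oddX oddF orbT.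
    by case: (q ^ d)%N.
  by move=> /even_halfK {1}<-; rewrite -muln2 mulnAC muln2 doubleK.
rewrite -(chi0_pow_parity D iP t0 kd0 ot).
apply: (sqc_injK oddLF).
- rewrite sqcE ?oddLF //; case: (_ == 0) => //; by case: (issq _).
- have [ot'|ot'] := boolP (odd t); first by rewrite chi0_odd // chi0_mem.
  rewrite (chi0_pow_parity D iP t0 (ltn0Sn 1)) ?(negPf ot') // chi0_sqr //.
  by case: (P %| D).
rewrite sqc_exp ?oddLF // cardL kt exprM rmorphXn /=; congr (_ ^+ t).
have := chi0_dvdp oddF D iP; rewrite -(dvdp_map (in_alg L)) rmorphB rmorphXn /= rmorph_int.
move=> /dvdpP[w wE]; have := congr1 (fun p => p.[x]) wE.
rewrite hornerM (rootP rx) mulr0 hornerD hornerN horner_exp => /eqP.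
rewrite subr_eq0 => /eqP ->; by rewrite -[_%:~R](rmorph_int (@polyC L)) hornerC.
Qed.

Lemma sum_points D K : (k < K)%N ->
  (#|[set xy : LF * LF | (xy.2 ^+ 2 : L) == (toL D).[xy.1]]%SET|)%:R =
  q%:R ^+ k + (Cser K D)`_k :> int.
Proof.
move=> kK; rewrite -sum1_card natr_sum.
rewrite (eq_bigl (fun xy : LF * LF => (xy.2 ^+ 2 : L) == (toL D).[xy.1])); last first.
  by move=> xy; rewrite inE.
rewrite big_mkcond /=.
rewrite -(pair_bigA _ (fun x y : LF => if (y ^+ 2 : L) == (toL D).[x] then 1 else 0)) /=.
rewrite (eq_bigr (fun x : LF => 1 + sqc ((toL D).[x : L] : LF))); last first.
  move=> x _; rewrite /sqc addrC subrK; apply: eq_bigr => y _.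
  by case: (_ == _).
rewrite big_split /= sumr_const cardL natrX; congr (_ + _).
rewrite coef_Cser // k_gt0 /=.
transitivity (\sum_(x : LF) \sum_(P <- primes F K)
   (root (toL P) (x : L))%:R * chi0 D P ^+ (k %/ (size P).-1)).
  (* Exactly one prime in the list has x as a root; its degree divides k, hence is less than K. *)
  apply: eq_bigr => x _; have [P iP [rP dP]] := pirr_root_ex x.
  have PK : P \in primes F K.
    rewrite mem_primes iP andbT (leq_trans _ kK) // -(ltn_predK (pirr_size iP)) ltnS.
    exact: dvdn_leq.
  rewrite (bigD1_seq P) ?uniq_primes //= rP mul1r (sqc_root D iP rP).
  rewrite big1_seq ?addr0 // => Q /andP[QP]; rewrite mem_primes => /andP[_ iQ].
  case: (boolP (root _ _)) => [rQ|_]; last by rewrite mul0r.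
  by rewrite (pirr_root_uniq iP iQ rP rQ) eqxx in QP.
rewrite exchange_big /=; apply: eq_big_seq => P; rewrite mem_primes => /andP[_ iP].
rewrite -mulr_suml -natr_sum card_roots //.
by case: ifP => // _; rewrite mul0r.
Qed.

End PointCount.

Section ZetaNumerator.
Variable F : finFieldType.
Local Notation q := #|F|.
Local Notation qr := (#|F|%:R : rat).

Lemma eqX_map K (p r : {poly int}) : eqX K p r ->
  eqX K (map_poly intr p : {poly rat}) (map_poly intr r).
Proof. by move=> E i iK; rewrite !coef_map /= E. Qed.

(** The equation says that n p_n is the sum of the C_i p_(n-i) over i >= 1, which determines p_n
    from earlier coefficients because n is invertible in the rationals. *)
Lemma logderiv_uniq K (C p r : {poly rat}) : C`_0 = 0 -> p`_0 = r`_0 ->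
  eqX K ('X * p^`()) (C * p) -> eqX K ('X * r^`()) (C * r) -> eqX K p r.
Proof.
move=> C0 pr0 Ep Er n; have [m] := ubnP n; elim: m n => // m IH n nm nK.
case: n nm nK => // n nm nK.
have := Ep _ nK; rewrite coefXderiv coefM big_ord_recl C0 mul0r add0r => E1.
have := Er _ nK; rewrite coefXderiv coefM big_ord_recl C0 mul0r add0r => E2.
apply: (@pmulrnI _ n.+1) => //; rewrite E1 E2.
apply: eq_bigr => i _; rewrite (IH (n.+1 - lift ord0 i)%N) //.
  by rewrite lift0 subSS (leq_ltn_trans (leq_subr _ _)).
by rewrite (leq_ltn_trans _ nK) // leq_subr.
Qed.

(** The series c u + c^2 u^2 + ... is u d/du of -log(1 - c u). It is used for c = 1 and c = q, the
    poles of the zeta function. *)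
Lemma geom_shift K (c : rat) :
  eqX K ((1 - c *: 'X) * \poly_(k < K) (if k is 0 then 0 else c ^+ k)) (c *: 'X).
Proof.
move=> i iK; rewrite mulrBl mul1r -scalerAl coefB !coefZ coefXM coefX !coef_poly iK.
case: i iK => [|[|i]] iK /=; first by rewrite !mulr0 subr0.
  by rewrite (ltnW iK) mulr0 subr0 expr1 mulr1.
by rewrite (ltnW iK) -exprS subrr mulr0.
Qed.

Lemma curve_points_Cser (D : {poly F}) k K : odd q -> (0 < k)%N -> (k < K)%N ->
  (curve_points D k)%:R = 1 + qr ^+ k + (map_poly intr (Cser K D))`_k.
Proof.
move=> oddF k0 kK; rewrite coef_map /= /curve_points.
have H := sum_points oddF (card_ext_field F k0) k0 D kK.
rewrite -natr1 addrC -addrA; congr (_ + _).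
have := congr1 (fun z : int => z%:~R : rat) H.
by rewrite rmorphD rmorphXn /= !rmorph_nat => ->.
Qed.

(** Both sides have constant term 1 and the same logarithmic derivative C. The point counts have the
    series A + B + C, with A and B from the terms 1 and q^k, and these two are cancelled by the
    factors 1 - u and 1 - q u. *)
Lemma zeta_L (D : {poly F}) K : odd q ->
  eqX K ((1 - 'X) * (1 - qr *: 'X) * \poly_(i < K) zeta_coef D i)
        (map_poly intr (gen K (Lcoef D))).
Proof.
move=> oddF; case: K => [i //|K].
pose a k : rat := (curve_points D k)%:R / k%:R.
pose N k : rat := (curve_points D k)%:R.
have aN k : (0 < k)%N -> k%:R * a k = N k.
  by move=> k0; rewrite /a mulrC divfK // pnatr_eq0 -lt0n.
pose Z := \poly_(i < K.+1) zeta_coef D i.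
pose NP : {poly rat} := \poly_(k < K.+1) (if k is 0 then 0 else N k).
pose C : {poly rat} := map_poly intr (Cser K.+1 D).
have C0 : C`_0 = 0.
  by rewrite coef_map coef_Cser //= big1.
have ZE := exp_series_coefE a.
have DZ : eqX K.+1 ('X * Z^`()) (NP * Z).
  have EZ : eqX K.+1 (\sum_(j < K.+1) (j`!%:R)^-1 *: (\sum_(1 <= k < K.+1) a k *: 'X^k) ^+ j) Z.
    by move=> i iK; rewrite coef_poly iK /zeta_coef (ZE _ _ iK).
  apply: eqX_trans (eqX_sym (eqX_deriv EZ)) _.
  by apply: eqX_trans (@logderiv_exp a N aN K.+1) _; apply: eqXMl.
pose A : {poly rat} := \poly_(k < K.+1) (if k is 0 then 0 else 1 ^+ k).
pose B : {poly rat} := \poly_(k < K.+1) (if k is 0 then 0 else qr ^+ k).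
have NE : eqX K.+1 NP (A + B + C).
  move=> i iK; rewrite !coefD [NP`_i]coef_poly [A`_i]coef_poly [B`_i]coef_poly iK.
  case: i iK => [|i] iK.
    by rewrite C0 !addr0.
  by rewrite expr1n /N (curve_points_Cser _ oddF _ iK).
have hA := geom_shift (K := K.+1) 1; have hB := geom_shift (K := K.+1) qr.
rewrite -/A scale1r in hA; rewrite -/B in hB.
set X1 := 1 - 'X; set X2 := 1 - qr *: 'X.
apply: (logderiv_uniq (C := C)) => //.
- rewrite coefM big_ord1 subnn coef_poly /= coefM big_ord1 !coefB !coefZ !coefX !coef1 /=.
  rewrite mulr0 subr0 !mul1r coef_map coef_poly /= /zeta_coef (ZE 1%N) //.
  rewrite big_ord1 fact0 invr1 scale1r expr0 coef1 /=.
  by rewrite /Lcoef monics0 big_seq1 chi1.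
- rewrite -/Z; have dX : 'X * (X1 * X2 * Z)^`() =
     X1 * X2 * ('X * Z^`()) - ('X * X2 + (qr *: 'X) * X1) * Z.
    rewrite !derivM /X1 /X2 !derivB !derivC !derivZ !derivX -!mul_polyC; ring.
  rewrite dX.
  apply: eqX_trans (_ : eqX K.+1 (X1 * X2 * ((A + B + C) * Z) - ('X * X2 + (qr *: 'X) * X1) * Z) _).
    apply: eqXD => //; apply: eqXMl; apply: eqX_trans DZ _; exact: eqXMr.
  apply: eqX_trans (_ : eqX K.+1 (((X1 * A) * X2 + (X2 * B) * X1 + C * (X1 * X2)
     - ('X * X2 + (qr *: 'X) * X1)) * Z) _).
    by apply: eqX_eq; ring.
  apply: eqX_trans (_ : eqX K.+1 (('X * X2 + (qr *: 'X) * X1 + C * (X1 * X2)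
     - ('X * X2 + (qr *: 'X) * X1)) * Z) _).
    apply: eqXMr; apply: eqXD => //; apply: eqXD => //; apply: eqXD; exact: eqXMr.
  by apply: eqX_eq; ring.
have := eqX_map (@logderiv_L F K.+1 D).
by rewrite deriv_map [C * _]mulrC !rmorphM /= map_polyX; apply.
Qed.

Lemma is_zeta_numeratorP (D : {poly F}) g : odd q -> size D = (2 * g + 2)%N ->
  sqf D -> is_zeta_numerator D (\poly_(n < (2 * g).+1) Lcoef D n).
Proof.
move=> oddF sD sqD n; rewrite (zeta_L D oddF (ltnSn n)) coef_map !coef_poly ltnSn.
case: ltnP => // gn; by rewrite (Lcoef_big sD).
Qed.

Lemma zeta_numeratorE (D : {poly F}) g : odd q -> size D = (2 * g + 2)%N ->
  sqf D -> zeta_numerator D = \poly_(n < (2 * g).+1) Lcoef D n.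
Proof.
move=> oddF sD sqD; have H := is_zeta_numeratorP oddF sD sqD.
rewrite /zeta_numerator; case: xgetP => [P _ PE|/(_ _ H)//].
apply/polyP => n; apply: (@intr_inj rat).
by rewrite (PE n) (H n).
Qed.

End ZetaNumerator.

(** * Nonsquare conductors *)

Section NonsquareSums.
Variable F : finFieldType.
Local Notation q := #|F|.
Local Notation qz := (#|F|%:R : int).
Hypothesis oddF : odd q.
Implicit Types (f g h l P A B D V : {poly F}).

Definition issquare f := exists2 l, l \is monic & f = l ^+ 2.

(** Prime powers with even exponent are squares and can be split off; if no odd exponent ever
    appeared, f would be a square. *)
Lemma nonsquare_decomp f : f \is monic -> ~ issquare f ->
  exists P e h, [/\ pirr P, odd e, h \is monic, ~~ (P %| h) & f = P ^+ e * h].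
Proof.
have [n] := ubnP (size f); elim: n f => // n IH f sfn mf nsq.
have [sf|sf] := leqP (size f) 1.
  case: nsq; exists 1; rewrite ?monic1 // expr1n.
  have /size_poly1P[c c0 fE] : size f == 1%N.
    by rewrite eqn_leq sf size_poly_gt0 monic_neq0.
  by move: mf; rewrite fE monicE lead_coefC => /eqP->.
have [P iP dPf] := pirr_divisor sf.
have [h [mh nPh fE]] := vP_decomp iP mf; set e := vP P f in fE.
have mPe i : P ^+ i \is monic by rewrite rpredX // pirr_monic.
have [oe|ee] := boolP (odd e); first by exists P, e, h.
have e0 : (0 < e)%N.
  rewrite lt0n; apply: contraNneq nPh => e0.
  by move: fE dPf; rewrite e0 mul1r => <-.
have sh : (size h < n)%N.
  rewrite -ltnS; apply: leq_trans sfn; rewrite ltnS.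
  have := monicM_size (mPe e) mh; rewrite -fE monicX_size ?pirr_monic // => E.
  have d0 : (0 < (size P).-1)%N by rewrite -subn1 subn_gt0 pirr_size.
  have : (0 < e * (size P).-1)%N by rewrite muln_gt0 e0.
  move: E; have : (0 < size h)%N by rewrite size_poly_gt0 monic_neq0.
  move: sf; case: (size f) => // a; case: (size h) => // b /= _ _ ->; lia.
have [|P' [e' [h' [iP' oe' mh' nh' hE]]]] := IH h sh mh.
  move=> [l ml lE]; case: nsq; exists (P ^+ e./2 * l); first by rewrite rpredM.
  by rewrite exprMn -exprM muln2 even_halfK // -lE.
exists P', e', (P ^+ e * h'); split=> //; first by rewrite rpredM.
  rewrite pirr_dvdM // negb_or nh' andbT; apply/negP => /(pirr_dvdX iP').
  rewrite pirr_dvd_pirr // => /eqP PP; case/negP: nPh; rewrite hE -PP.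
  by case: (e') oe' => // m _; rewrite exprS -mulrA dvdp_mulr.
by rewrite fE hE mulrCA.
Qed.

(** With f = P^e h and e odd, chi_B(f) depends only on B modulo h P, of degree at most n <= b. For a
    fixed residue modulo h, the residue of B modulo P runs through all classes, over which the
    symbol sums to 0. *)
Lemma sum_chi_nonsquare f n b : f \in monics F n -> ~ issquare f -> (n <= b)%N ->
  \sum_(B <- monics F b) chi B f = 0.
Proof.
move=> fn nsq nb; have mf := monics_monic fn.
have [P [e [h [iP oe mh nPh fE]]]] := nonsquare_decomp mf nsq.
have e0 : (0 < e)%N by case: (e) oe.
have mP := pirr_monic iP; have mPh : h * P \is monic by rewrite rpredM.
set d := (size P).-1; set c := (size h).-1.
have sPh : size (h * P) = (d + c).+1.
  by rewrite -(@prednK (size _)) ?size_poly_gt0 ?monic_neq0 // monicM_size // addnC.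
have sP : size P = d.+1 by rewrite prednK // size_poly_gt0 monic_neq0.
have sh : size h = c.+1 by rewrite prednK // size_poly_gt0 monic_neq0.
have dcb : (d + c <= b)%N.
  apply: leq_trans nb; rewrite -(monics_deg fn) fE monicM_size ?rpredX //.
  by rewrite monicX_size // leq_add2r leq_pmull.
pose phi B := chi0 B P * chi B h.
have modP E B : E %| h * P -> (B %% (h * P)) %% E = B %% E.
  move=> dE; apply/eqP; rewrite eq_modp; apply: dvdp_trans dE _.
  by rewrite -eq_modp modp_id.
transitivity (\sum_(B <- monics F b) phi (B %% (h * P))).
  apply: eq_big_seq => B _; rewrite /phi fE chiM ?rpredX // chiX0 // chi0_odd //.
  congr (_ * _); first by apply: chi0_mod; rewrite modP // dvdp_mull.
  by apply: chi_mod => //; rewrite modP // dvdp_mulr.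
rewrite (sum_monics_mod phi sPh dcb) (sum_polys_split _ _ sh) exchange_big big1 ?mulr0 // => r _ /=.
transitivity (\sum_(t <- polys F d) chi0 ((h * t + r) %% P) P * chi r h).
  apply: eq_bigr => t _; rewrite /phi; congr (_ * _).
    by apply: chi0_mod; rewrite modp_id addrC mulrC.
  apply: chi_mod => //; apply/eqP; rewrite eq_modp addrAC subrr add0r.
  by rewrite dvdp_mull.
rewrite -mulr_suml (sum_polys_affine _ (fun V => chi0 V P) sP) ?pirr_coprime //.
by rewrite sum_chi0 ?mul0r.
Qed.

(* The pairs (mu(A), A) for the products A of subsets of s, obtained by expanding
   the product over s of (1 - [P^2 | D]). *)
Fixpoint muls (s : seq {poly F}) : seq (int * {poly F}) :=
  if s is P :: s' then muls s' ++ [seq (- u.1, P * u.2) | u <- muls s']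
  else [:: (1, 1)].

Lemma mulsP s u : all (@pirr F) s -> u \in muls s ->
  [/\ `|u.1| = 1, u.2 \is monic & forall Q, pirr Q -> Q %| u.2 -> Q \in s].
Proof.
elim: s u => [|P s IH] u /=.
  rewrite inE => _ /eqP ->; rewrite normr1 monic1; split=> // Q iQ.
  by rewrite dvdp1 gtn_eqF // pirr_size.
move=> /andP[iP si]; rewrite mem_cat.
move=> /orP[/(IH _ si)[-> -> H]|/mapP[v /(IH _ si)[vn mv H] ->]] /=.
  by split=> // Q iQ /(H Q iQ); rewrite inE => ->; rewrite orbT.
split=> [||Q iQ]; [by rewrite normrN | by rewrite rpredM // pirr_monic |].
rewrite pirr_dvdM // pirr_dvd_pirr // inE => /orP[->//|/(H Q iQ)->].
by rewrite orbT.
Qed.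

Lemma muls_ndvd s P u : all (@pirr F) s -> pirr P -> P \notin s -> u \in muls s ->
  ~~ (P %| u.2).
Proof. by move=> si iP nPs /(mulsP si)[_ _ H]; apply: contra nPs; apply: H. Qed.

Lemma uniq_muls s : all (@pirr F) s -> uniq s -> uniq [seq u.2 | u <- muls s].
Proof.
elim: s => //= P s IH /andP[iP si] /andP[nPs us].
rewrite map_cat cat_uniq IH // -map_comp.
rewrite (map_comp (fun A => P * A) snd) map_inj_uniq ?IH //=; last first.
  exact/mulfI/pirr_neq0.
rewrite andbT; apply/hasPn => A /mapP[B _ ->]; apply/negP => /mapP[u us' E].
by have := muls_ndvd si iP nPs us'; rewrite -E dvdp_mulr.
Qed.

Lemma prod_muls s D : all (@pirr F) s -> uniq s ->
  \prod_(P <- s) (1 - (P ^+ 2 %| D)%R%:R) =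
  \sum_(u <- muls s) u.1 * (u.2 ^+ 2 %| D)%R%:R :> int.
Proof.
elim: s => [|P s IH] /=; first by rewrite big_nil big_seq1 expr1n dvd1p mulr1.
move=> /andP[iP si] /andP[nPs us]; rewrite big_cons IH // mulrBl mul1r.
rewrite big_cat big_map /=; congr (_ + _); rewrite mulr_sumr -sumrN.
apply: eq_big_seq => u us'; rewrite exprMn [(P ^+ 2 * _ %| _)]Gauss_dvdp; last first.
  by rewrite coprimep_expl // coprimep_expr // pirr_coprime // (muls_ndvd si).
by rewrite -mulnb natrM; ring.
Qed.

Lemma sum_by_degree (R : numDomainType) (r : seq {poly F}) (b : nat -> R) M :
  uniq r -> (forall A, A \in r -> A \is monic) -> (forall a, 0 <= b a) ->
  (forall A, A \in r -> (M <= (size A).-1)%N -> b (size A).-1 = 0) ->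
  \sum_(A <- r) b (size A).-1 <= \sum_(a < M) q%:R ^+ a * b a.
Proof.
move=> ur mr b0 bM.
have -> : \sum_(A <- r) b (size A).-1 =
    \sum_(a < M) \sum_(A <- r | (size A).-1 == a) b a.
  rewrite (exchange_big_dep predT) //=; apply: eq_big_seq => A Ar.
  have [AM|MA] := ltnP (size A).-1 M.
    rewrite (bigD1 (Ordinal AM)) //= big1 ?addr0 // => a /andP[/eqP ea /eqP]; case.
    exact/val_inj.
  rewrite bM // big1 // => a /eqP ea; have := ltn_ord a; rewrite -ea.
  by rewrite ltnNge MA.
apply: ler_sum => a _; rewrite -big_filter big_const_seq count_predT iter_addr_0.
rewrite -[b a *+ _]mulr_natl -natrX ler_wpM2r // ler_nat -(size_monics F a).
apply: uniq_leq_size; first exact: filter_uniq.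
move=> A; rewrite mem_filter => /andP[/eqP <- Ar].
exact/in_monics/mr.
Qed.

(** The cutoff makes the indicator a finite product over primes, ready for expansion; it is exact
    when deg D < k. *)
Definition sqfb k D := all (fun P => ~~ (P ^+ 2 %| D)) (primes F k).

Lemma sqfbE N k D : D \in monics F N -> (N < k)%N -> reflect (sqf D) (sqfb k D).
Proof.
move=> DN Nk; apply: (iffP allP) => H P; last first.
  by rewrite mem_primes => /andP[_ iP]; apply: H.
move=> iP; apply/negP => d2; have := H P; rewrite mem_primes iP andbT d2.
rewrite (leq_trans _ Nk) // => [/(_ isT)//|].
rewrite -(monics_size DN) dvdp_leq ?monic_neq0 ?(monics_monic DN) //.
by apply: dvdp_trans d2; rewrite expr2 dvdp_mulr.
Qed.

Lemma sqfb_prod (S : comNzRingType) k D :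
  (sqfb k D)%:R = \prod_(P <- primes F k) (1 - (P ^+ 2 %| D)%R%:R) :> S.
Proof.
rewrite /sqfb; elim: (primes F k) => [|P s IH]; first by rewrite big_nil.
rewrite big_cons -IH /=; case: (P ^+ 2 %| D); first by rewrite subrr mul0r.
by rewrite subr0 mul1r.
Qed.

Definition Hs N : seq {poly F} := [seq D <- monics F N | sqfb N.+1 D].

(* Only the A with N - 2 deg A < n contribute to the sieved character sum, and
   for those the trivial bound is good enough. *)
Definition Bbound N n : int := \sum_(a < N.+1)
  qz ^+ a * (if (2 * a <= N < n + 2 * a)%N then qz ^+ (N - 2 * a) else 0).

Lemma sum_Hs (S : comNzRingType) N (phi : {poly F} -> S) :
  \sum_(D <- Hs N) phi D = \sum_(D <- monics F N) (sqfb N.+1 D)%:R * phi D.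
Proof.
rewrite big_filter [LHS]big_mkcond; apply: eq_bigr => D _.
by case: (sqfb _ D); rewrite ?mul1r ?mul0r.
Qed.

Lemma sum_Hs_nonsquare N f n : f \in monics F n -> ~ issquare f ->
  `|\sum_(D <- Hs N) chi D f| <= Bbound N n.
Proof.
move=> fn nsq; rewrite sum_Hs; set s := primes F N.+1.
have mf := monics_monic fn.
have si : all (@pirr F) s by apply/allP => P; rewrite mem_primes => /andP[].
have us : uniq s by apply: uniq_primes.
have -> : \sum_(D <- monics F N) (sqfb N.+1 D)%:R * chi D f =
    \sum_(u <- muls s) u.1 * \sum_(D <- monics F N) (u.2 ^+ 2 %| D)%R%:R * chi D f.
  under [RHS]eq_bigr do rewrite mulr_sumr.
  rewrite exchange_big /=; apply: eq_bigr => D _.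
  by rewrite sqfb_prod prod_muls // mulr_suml; apply: eq_bigr => u _; rewrite mulrA.
apply: le_trans (ler_norm_sum _ _ _) _.
pose b a := if (2 * a <= N < n + 2 * a)%N then qz ^+ (N - 2 * a) else 0.
apply: (@le_trans _ _ (\sum_(u <- muls s) b (size u.2).-1)).
  rewrite big_seq [leRHS]big_seq; apply: ler_sum => u /(mulsP si)[un mu _].
  rewrite normrM un mul1r.
  have A2 : u.2 ^+ 2 \in monics F (2 * (size u.2).-1) by rewrite monicsX // in_monics.
  rewrite (sum_multiples _ (fun D => chi D f) A2) /b.
  case: (leqP (2 * (size u.2).-1) N) => aN; last by rewrite normr0.
  under eq_bigr do rewrite chi_sqM //.
  (* With D = A^2 B, the character sum over B of degree N - 2 deg A vanishes as soon as that degree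
     is at least n. *)
  rewrite -mulr_sumr andTb; case: (ltnP N (n + 2 * (size u.2).-1)) => Nn; last first.
    by rewrite (sum_chi_nonsquare fn) ?mulr0 ?normr0 //; lia.
  rewrite normrM -[leRHS]mul1r ler_pM //; first by case: coprimep.
  rewrite -[leRHS]mulr1 -sum_monics_const; apply: le_trans (ler_norm_sum _ _ _) _.
  by apply: ler_sum => B _; apply: chi_le1.
rewrite -(big_map snd predT (fun A => b (size A).-1)).
apply: sum_by_degree; first exact: uniq_muls.
- by move=> A /mapP[u us' ->]; have [] := mulsP si us'.
- by move=> a; rewrite /b; case: ifP => // _; rewrite exprn_ge0.
move=> A _ NA; rewrite /b; case: ifP => // /andP[]; lia.
Qed.

Lemma issquare_monics m f : f \in monics F (2 * m) -> issquare f ->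
  exists2 l, l \in monics F m & f = l ^+ 2.
Proof.
move=> fm [l ml fE]; exists l => //; have := monics_deg fm.
rewrite fE monicX_size // => /eqP; rewrite eqn_pmul2l // => /eqP <-.
exact: in_monics.
Qed.

Definition Ssum N m : int :=
  \sum_(l <- monics F m) \sum_(D <- Hs N) (coprimep D l)%:R.

Lemma sum_Lcoef N n :
  `|\sum_(D <- Hs N) Lcoef D n - (if odd n then 0 else Ssum N n./2)|
     <= qz ^+ n * Bbound N n.
Proof.
rewrite /Lcoef exchange_big /=.
rewrite (bigID (fun f => `[< issquare f >])) /= addrAC.
have -> : \sum_(f <- monics F n | `[< issquare f >]) \sum_(D <- Hs N) chi D f =
    if odd n then 0 else Ssum N n./2.
  case: ifP => on.
    rewrite big1_seq // => f /andP[/asboolP[l ml fE] fn].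
    have := monics_deg fn; rewrite fE monicX_size // => E.
    by move: on; rewrite -E mul2n odd_double.
  have nE : n = (2 * n./2)%N by rewrite mul2n even_halfK // on.
  rewrite {1}nE -big_filter /Ssum.
  rewrite (big_bij (r1 := monics F n./2) (h := fun l => l ^+ 2)).
  - apply: eq_big_seq => l lm; apply: eq_bigr => D _.
    by rewrite chiX ?(monics_monic lm) // chi_sqr ?(monics_monic lm).
  - exact: uniq_monics.
  - by rewrite filter_uniq // uniq_monics.
  - move=> l l' lm lm' /eqP; rewrite eqf_sqr => /orP[/eqP//|/eqP E].
    have := monics_monic lm; rewrite E monicE lead_coefN.
    have := monics_monic lm'; rewrite monicE => /eqP ->.
    by rewrite eq_sym -subr_eq0 opprK (negPf (two_neq0 oddF)).
  - move=> f; rewrite mem_filter; split=> [/andP[/asboolP sq fm]|[l lm ->]].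
      exact: issquare_monics.
    rewrite monicsX // andbT; apply/asboolP; exists l => //; exact: monics_monic lm.
rewrite subrr add0r; apply: le_trans (ler_norm_sum _ _ _) _.
rewrite -sum_monics_const big_mkcond big_seq [leRHS]big_seq; apply: ler_sum => f fn.
case: ifP => [/asboolP nsq|_]; first exact: sum_Hs_nonsquare.
apply: sumr_ge0 => a _; rewrite mulr_ge0 ?exprn_ge0 //.
by case: ifP => // _; rewrite exprn_ge0.
Qed.

End NonsquareSums.

(** * Sieving coprime pairs *)

Section Sieve.
Variables (R : realType) (F : finFieldType).
Hypothesis q4 : (4 <= #|F|)%N.
Local Notation Q := (#|F|%:R : R).
Local Notation nrm := (@poly_norm R F).
Implicit Types (f l P U W D : {poly F}).

Lemma Q_gt0 : 0 < Q. Proof. by rewrite ltr0n; lia. Qed.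

Lemma Q_neq0 : Q != 0. Proof. by rewrite gt_eqF // Q_gt0. Qed.

Lemma QV_le : Q^-1 <= 4^-1.
Proof. by rewrite lef_pV2 ?posrE ?Q_gt0 ?ltr0n // ler_nat. Qed.

Lemma nrm_gt0 P : 0 < nrm P. Proof. by rewrite exprn_gt0 // Q_gt0. Qed.

Lemma geo_tail (u : R) k K : 0 <= u -> u <= 2^-1 ->
  \sum_(a < K) (if (k <= a)%N then u ^+ a else 0) <= 2 * u ^+ k.
Proof.
(* The bound is strengthened by subtracting 2 u^K, which majorizes the rest of the series, so that
   the induction on K closes. *)
move=> u0 u2; suff H : \sum_(a < K) (if (k <= a)%N then u ^+ a else 0) <=
    2 * u ^+ k - (if (k <= K)%N then 2 * u ^+ K else 0).
  apply: le_trans H _; rewrite gerBl; case: ifP => // _.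
  by rewrite mulr_ge0 ?exprn_ge0.
elim: K => [|K IH].
  rewrite big_ord0; case: k => [|k] /=; first by rewrite subrr.
  by rewrite subr0 mulr_ge0 ?exprn_ge0.
rewrite big_ord_recr /=; case: (ltngtP k K) IH => kK IH.
- rewrite (leqW (ltnW kK)).
  apply: le_trans (lerD IH (lexx _)) _; rewrite exprS.
  have := exprn_ge0 K u0; set v := u ^+ K; set w := u ^+ k => v0.
  have : u * v <= 2^-1 * v by rewrite ler_wpM2r.
  by lra.
- rewrite (_ : (k <= K.+1)%N = (k == K.+1)); last by rewrite leq_eqVlt ltnS leqNgt kK orbF.
  rewrite addr0.
  case: eqP => [<-|_]; last exact: IH.
  rewrite subrr; apply: le_trans (_ : 0 <= 0) => //.
  rewrite big1 // => a _; case: ifP => // ka.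
  by have := ltn_ord a; rewrite ltnNge (leq_trans (ltnW kK)).
- rewrite kK leqnSn in IH *; apply: le_trans (lerD IH (lexx _)) _.
  rewrite subrr add0r exprS; have := exprn_ge0 K u0; set v := u ^+ K => v0.
  have : u * v <= 2^-1 * v by rewrite ler_wpM2r.
  by lra.
Qed.

Lemma sum_dvd_monics N U u : U \in monics F u -> (u <= N)%N ->
  \sum_(D <- monics F N) (U %| D)%R%:R = Q ^+ N * (Q ^+ u)^-1.
Proof.
move=> Uu uN; have := sum_multiples N (fun=> 1 : R) Uu.
under eq_bigr do rewrite mulr1.
by rewrite uN sum_monics_const mulr1 => ->; rewrite expfB_cond // (negPf Q_neq0).
Qed.

Lemma sum_dvd_monics_le N U u : U \in monics F u ->
  \sum_(D <- monics F N) (U %| D)%R%:R <= Q ^+ N * (Q ^+ u)^-1.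
Proof.
move=> Uu; case: (leqP u N) => uN; first by rewrite (sum_dvd_monics Uu).
have := sum_multiples N (fun=> 1 : R) Uu.
under eq_bigr do rewrite mulr1.
by rewrite leqNgt uN /= => ->; rewrite mulr_ge0 ?invr_ge0 ?exprn_ge0.
Qed.

(* Local sieve conditions at P, written as linear combinations of the events
   P^i | D and P^j | l; [dens] is their mean value. *)
Definition loc (cs : seq (R * (nat * nat))) P D l : R :=
  \sum_(c <- cs) c.1 * ((P ^+ c.2.1 %| D)%R%:R * (P ^+ c.2.2 %| l)%R%:R).

Definition dens (cs : seq (R * (nat * nat))) P : R :=
  \sum_(c <- cs) c.1 * (nrm P ^+ (c.2.1 + c.2.2))^-1.

Definition degsum (s : seq {poly F}) : nat := \sum_(P <- s) (size P).-1.

(** U and W collect the prime powers already imposed on D and l. Treating P with the term c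
    multiplies them by coprime powers of P with exponents at most 2, and the degree hypotheses
    ensure that every final modulus fits, so that all counts are exact. *)
Lemma sieve_count cs s N m U W u w :
  (forall c, c \in cs -> (c.2.1 <= 2)%N /\ (c.2.2 <= 2)%N) ->
  all (@pirr F) s -> uniq s ->
  U \in monics F u -> W \in monics F w ->
  (forall P, P \in s -> ~~ (P %| U) /\ ~~ (P %| W)) ->
  (u + 2 * degsum s <= N)%N -> (w + 2 * degsum s <= m)%N ->
  \sum_(D <- monics F N) \sum_(l <- monics F m)
     (U %| D)%R%:R * (W %| l)%R%:R * \prod_(P <- s) loc cs P D l =
  Q ^+ N * Q ^+ m * (Q ^+ u)^-1 * (Q ^+ w)^-1 * \prod_(P <- s) dens cs P.
Proof.
move=> cs2; elim: s U W u w => [|P s IH] U W u w.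
  move=> _ _ Uu Ww _; rewrite /degsum !big_nil muln0 !addn0 => uN wm.
  under eq_bigr => D _.
    under eq_bigr do rewrite big_nil mulr1.
    rewrite -mulr_sumr (sum_dvd_monics Ww wm).
    over.
  by rewrite -mulr_suml (sum_dvd_monics Uu uN) mulr1; ring.
move=> /= /andP[iP si] /andP[nPs us] Uu Ww ndv; rewrite /degsum big_cons -/(degsum s) => uN wm.
have [nPU nPW] := ndv P (mem_head _ _).
set d := (size P).-1 in uN wm.
have sub c : c \in cs ->
    \sum_(D <- monics F N) \sum_(l <- monics F m)
     (U * P ^+ c.2.1 %| D)%R%:R * (W * P ^+ c.2.2 %| l)%R%:R * \prod_(P <- s) loc cs P D l =
    Q ^+ N * Q ^+ m * (Q ^+ u)^-1 * (Q ^+ w)^-1 * (nrm P ^+ (c.2.1 + c.2.2))^-1 *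
      \prod_(P <- s) dens cs P.
  move=> ccs; have [c1 c2] := cs2 c ccs.
  rewrite (IH _ _ (u + c.2.1 * d)%N (w + c.2.2 * d)%N) //.
  - congr (_ * _); rewrite exprD [Q ^+ (w + _)]exprD.
    rewrite /poly_norm -/d -exprM mulnDr exprD ![(d * _)%N]mulnC !invfM; ring.
  - by rewrite monicsM // monicsX // pirr_in_monics.
  - by rewrite monicsM // monicsX // pirr_in_monics.
  - move=> P' P's.
    have iP' : pirr P' by apply: (allP si).
    have P'Ps : P' \in P :: s by rewrite inE P's orbT.
    have [nU nW] := ndv P' P'Ps.
    have nX i : ~~ (P' %| P ^+ i).
      apply/negP => /(pirr_dvdX iP'); rewrite pirr_dvd_pirr // => /eqP E.
      by rewrite -E P's in nPs.
    by rewrite !pirr_dvdM // !negb_or nU nW !nX.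
  - by apply: leq_trans uN; rewrite mulnDr addnA leq_add2r leq_add2l leq_mul2r c1 orbT.
  - by apply: leq_trans wm; rewrite mulnDr addnA leq_add2r leq_add2l leq_mul2r c2 orbT.
transitivity (\sum_(c <- cs) c.1 * \sum_(D <- monics F N) \sum_(l <- monics F m)
     (U * P ^+ c.2.1 %| D)%R%:R * (W * P ^+ c.2.2 %| l)%R%:R * \prod_(P <- s) loc cs P D l).
  under [RHS]eq_bigr do rewrite mulr_sumr.
  rewrite [RHS]exchange_big; apply: eq_bigr => D _ /=.
  under [RHS]eq_bigr do rewrite mulr_sumr.
  rewrite [RHS]exchange_big; apply: eq_bigr => l _ /=.
  rewrite big_cons {1}/loc mulr_suml mulr_sumr; apply: eq_bigr => c _.
  have copP V i : ~~ (P %| V) -> coprimep V (P ^+ i).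
    by move=> nV; rewrite coprimep_sym coprimep_expl // pirr_coprime.
  rewrite [(U * _ %| _)]Gauss_dvdp ?copP // [(W * _ %| _)]Gauss_dvdp ?copP //.
  by rewrite -!mulnb !natrM; ring.
rewrite (eq_big_seq (fun c => c.1 * (Q ^+ N * Q ^+ m * (Q ^+ u)^-1 * (Q ^+ w)^-1 *
    (nrm P ^+ (c.2.1 + c.2.2))^-1 * \prod_(P <- s) dens cs P))); last first.
  by move=> c ccs; rewrite sub.
rewrite big_cons {2}/dens mulr_suml mulr_sumr; apply: eq_bigr => c _; ring.
Qed.

(* The expansions of (1 - [P^2 | D]) (1 - [P | D] [P | l]) and 1 - [P^2 | D]. *)
Definition csI : seq (R * (nat * nat)) :=
  [:: (1, (0, 0)%N); (-1, (2, 0)%N); (-1, (1, 1)%N); (1, (2, 1)%N)].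
Definition csH : seq (R * (nat * nat)) := [:: (1, (0, 0)%N); (-1, (2, 0)%N)].

Lemma locI P D l : loc csI P D l =
  (1 - (P ^+ 2 %| D)%R%:R) * (1 - (P %| D)%R%:R * (P %| l)%R%:R).
Proof.
rewrite /loc /csI !big_cons big_nil /= !expr0 !expr1 !dvd1p.
have key : (P ^+ 2 %| D)%R%:R * (P %| D)%R%:R = (P ^+ 2 %| D)%R%:R :> R.
  have [d2|] := boolP (P ^+ 2 %| D); last by rewrite mul0r.
  by rewrite (dvdp_trans _ d2) ?mulr1 // expr2 dvdp_mulr.
rewrite -![true%:R]/(1 : R); move: key.
set a := (P ^+ 2 %| D)%R%:R; set b := (P %| D)%R%:R; set c := (P %| l)%R%:R => key.
by transitivity (1 - a - b * c + (a * b) * c); [rewrite key|]; ring.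
Qed.

Lemma locH P D l : loc csH P D l = 1 - (P ^+ 2 %| D)%R%:R.
Proof.
rewrite /loc /csH !big_cons big_nil /= !expr0 !dvd1p -![true%:R]/(1 : R).
by set a := (P ^+ 2 %| D)%R%:R; ring.
Qed.

Definition efac P : R := 1 - ((nrm P + 1) * nrm P)^-1.

(** The origin of the Euler factor of P(1): with x = |P|, 1 - 2 x^-2 + x^-3 = (1 - x^-2) (1 - 1 /
    ((x + 1) x)). The first factor is the squarefree density and cancels in the mean. *)
Lemma densI P : dens csI P = dens csH P * efac P.
Proof.
rewrite /dens /csI /csH !big_cons !big_nil /= /efac !addn0 /= expr0 invr1.
have := nrm_gt0 P; set x := nrm P => x0.
have x1 : x + 1 != 0 by rewrite gt_eqF // ltr_wpDr.
rewrite (_ : (1 + 1)%N = 2%N) // (_ : (2 + 1)%N = 3%N) //.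
have xn : x != 0 by rewrite gt_eqF.
by field; rewrite xn x1.
Qed.

Definition tailp k K : seq {poly F} := [seq P : {poly F} <- primes F K | (k < size P)%N].

Lemma perm_primes k K : (k <= K)%N -> perm_eq (primes F K) (primes F k ++ tailp k K).
Proof.
move=> kK; apply: uniq_perm; first exact: uniq_primes.
  rewrite cat_uniq uniq_primes filter_uniq ?uniq_primes //=.
  rewrite ?andbT; apply/hasPn => P; rewrite mem_filter /= mem_primes => /and3P[kP _ _].
  by rewrite mem_primes leqNgt kP.
move=> P; rewrite mem_cat !mem_primes /tailp mem_filter mem_primes.
case: (pirr P); rewrite ?andbF ?andbT //=.
by case: (leqP (size P) k) => //= Pk; rewrite (leq_trans Pk kK).
Qed.

(** Bounding the number of primes of degree a by q^a leaves the geometric series of the q^-a with a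
    >= k; size greater than k means degree at least k. *)
Lemma sum_tailp k K : \sum_(P <- tailp k K) (nrm P ^+ 2)^-1 <= 2 * Q^-1 ^+ k.
Proof.
pose b a : R := if (k <= a < K)%N then (Q ^+ a ^+ 2)^-1 else 0.
have -> : \sum_(P <- tailp k K) (nrm P ^+ 2)^-1 = \sum_(P <- tailp k K) b (size P).-1.
  apply: eq_big_seq => P; rewrite mem_filter mem_primes => /and3P[kP PK iP].
  have sP : size P = (size P).-1.+1 by rewrite prednK // ltnW // pirr_size.
  have s1 : (k <= (size P).-1)%N by rewrite -ltnS -sP.
  have s2 : ((size P).-1 < K)%N by rewrite -sP.
  by rewrite /b s1 s2.
apply: le_trans (sum_by_degree (M := K) _ _ _ _) _.
- by rewrite filter_uniq // uniq_primes.
- by move=> P; rewrite mem_filter mem_primes => /and3P[_ _ /pirr_monic].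
- by move=> a; rewrite /b; case: ifP => // _; rewrite invr_ge0 !exprn_ge0.
- by move=> P _ KP; rewrite /b [(_ < K)%N]ltnNge KP andbF.
apply: le_trans (_ : _ <= \sum_(a < K) (if (k <= a)%N then Q^-1 ^+ a else 0)) _.
  apply: ler_sum => a _; rewrite /b ltn_ord andbT; case: ifP => _; last by rewrite mulr0.
  rewrite expr2 invfM mulrA divff ?expf_neq0 ?Q_neq0 // mul1r exprVn //.
apply: geo_tail; first by rewrite invr_ge0.
by apply: le_trans QV_le _; lra.
Qed.

Lemma prod_unit (T : eqType) (s : seq T) (a : T -> R) :
  (forall x, x \in s -> 0 <= a x <= 1) -> 0 <= \prod_(x <- s) a x <= 1.
Proof.
elim: s => [|x s IH] H; first by rewrite big_nil lexx ler01.
rewrite big_cons; have /andP[a0 a1] := H x (mem_head _ _).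
have /andP[p0 p1] := IH (fun y ys => H y (mem_behead (s := x :: s) ys)).
by rewrite mulr_ge0 //= mulr_ile1.
Qed.

(** The union bound, in the form of the Weierstrass product inequality. *)
Lemma prod_union (T : eqType) (s : seq T) (a : T -> R) :
  (forall x, x \in s -> 0 <= a x <= 1) ->
  1 - \prod_(x <- s) a x <= \sum_(x <- s) (1 - a x).
Proof.
elim: s => [|x s IH] H; first by rewrite !big_nil subrr.
rewrite !big_cons; have /andP[a0 a1] := H x (mem_head _ _).
have H' y (ys : y \in s) := H y (mem_behead (s := x :: s) ys).
have /andP[p0 p1] := prod_unit H'; have := IH H'.
set p := \prod_(_ <- s) _ in p0 p1 *; set g := \sum_(_ <- s) _ => pg.
have : 0 <= (1 - a x) * (1 - p) by rewrite mulr_ge0 // subr_ge0.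
by nra.
Qed.

Lemma prod_primes_tail k K (a : {poly F} -> R) : (k <= K)%N ->
  (forall P, 0 <= a P <= 1) ->
  0 <= \prod_(P <- primes F k) a P - \prod_(P <- primes F K) a P
    <= \sum_(P <- tailp k K) (1 - a P).
Proof.
move=> kK a01; rewrite (perm_big _ (perm_primes kK)) big_cat /=.
have /andP[p0 p1] := prod_unit (s := primes F k) (fun P _ => a01 P).
have /andP[r0 r1] := prod_unit (s := tailp k K) (fun P _ => a01 P).
have := prod_union (s := tailp k K) (fun P _ => a01 P).
move: p0 p1 r0 r1; set p := \prod_(_ <- _) _; set r := \prod_(_ <- _) _.
set g := \sum_(_ <- _) _ => p0 p1 r0 r1 rg.
rewrite -{1 3}[p]mulr1 -mulrBr mulr_ge0 ?subr_ge0 //=.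
apply: le_trans rg; rewrite -[leRHS]mul1r ler_wpM2r // subr_ge0 //.
Qed.

Lemma bool01 (b : bool) : 0 <= (b%:R : R) <= 1.
Proof. by case: b; rewrite /= ?lexx ler01. Qed.

Lemma aI01 D l P :
  0 <= (1 - (P ^+ 2 %| D)%R%:R) * (1 - (P %| D)%R%:R * (P %| l)%R%:R : R) <= 1.
Proof.
by case: (P ^+ 2 %| D); case: (P %| D); case: (P %| l);
   rewrite /= ?mulr1 ?mulr0 ?mul0r ?subr0 ?subrr ?mulr0 ?mul0r ?mulr1 ?lexx ?ler01.
Qed.

Lemma sqf_coprime_prod N D l : D \in monics F N ->
  (sqfb N.+1 D)%:R * (coprimep D l)%:R =
  \prod_(P <- primes F N.+1) ((1 - (P ^+ 2 %| D)%R%:R) * (1 - (P %| D)%R%:R * (P %| l)%R%:R)) :> R.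
Proof.
move=> DN; rewrite big_split /= -sqfb_prod; congr (_ * _).
have D0 : D != 0 by rewrite monic_neq0 // (monics_monic DN).
have [cDl|ncDl] := boolP (coprimep D l).
  rewrite big1_seq // => P /=; rewrite mem_primes => /andP[_ iP].
  have [dPD|] := boolP (P %| D); last by rewrite mul0r subr0.
  have [dPl|] := boolP (P %| l); last by rewrite mulr0 subr0.
  have := coprimepP _ _ cDl P dPD dPl; rewrite -size_poly_eq1.
  by rewrite gtn_eqF // pirr_size.
have sg : (1 < size (gcdp D l))%N.
  rewrite ltn_neqAle eq_sym -coprimep_def ncDl size_poly_gt0 gcdp_eq0.
  by rewrite (negPf D0).
have [P iP dP] := pirr_divisor sg.
have dPD : P %| D by apply: dvdp_trans dP (dvdp_gcdl _ _).
have dPl : P %| l by apply: dvdp_trans dP (dvdp_gcdr _ _).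
rewrite (bigD1_seq P) ?uniq_primes //=; last first.
  by rewrite mem_primes iP andbT -(monics_size DN) dvdp_leq.
by rewrite dPD dPl mulr1 subrr mul0r.
Qed.

End Sieve.

(** * Densities of squarefree polynomials and of coprime pairs *)

Section Densities.
Variables (R : realType) (F : finFieldType).
Hypothesis q4 : (4 <= #|F|)%N.
Local Notation Q := (#|F|%:R : R).
Local Notation u := (#|F|%:R^-1 : R).
Local Notation nrm := (@poly_norm R F).
Implicit Types (f l P U W D : {poly F}).

Definition SR N m : R := (Ssum F N m)%:~R.

Lemma SRE N m : SR N m = \sum_(D <- monics F N) \sum_(l <- monics F m)
  \prod_(P <- primes F N.+1)
    ((1 - (P ^+ 2 %| D)%R%:R) * (1 - (P %| D)%R%:R * (P %| l)%R%:R)).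
Proof.
rewrite /SR /Ssum exchange_big /= (sum_Hs _ (fun D => \sum_(l <- monics F m) (coprimep D l)%:R)).
rewrite rmorph_sum; apply: eq_big_seq => D DN.
rewrite rmorphM rmorph_sum mulr_sumr; apply: eq_bigr => l _.
by rewrite -(sqf_coprime_prod R _ DN) /= !rmorph_nat.
Qed.

Lemma pirr_all k : all (@pirr F) (primes F k).
Proof. by apply/allP => P; rewrite mem_primes => /andP[]. Qed.

Lemma one_monics : (1 : {poly F}) \in monics F 0.
Proof. by rewrite monics0 mem_head. Qed.

Lemma sieve_primes cs k N m :
  (forall c, c \in cs -> (c.2.1 <= 2)%N /\ (c.2.2 <= 2)%N) ->
  (2 * degsum (primes F k) <= N)%N -> (2 * degsum (primes F k) <= m)%N ->
  \sum_(D <- monics F N) \sum_(l <- monics F m) \prod_(P <- primes F k) loc cs P D l =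
  Q ^+ N * Q ^+ m * \prod_(P <- primes F k) dens cs P.
Proof.
move=> cs2 kN km.
have ndv P : P \in primes F k -> ~~ (P %| 1) /\ ~~ (P %| 1).
  by rewrite mem_primes => /andP[_ iP]; rewrite dvdp1 gtn_eqF // pirr_size.
have := sieve_count q4 (N := N) (m := m) cs2 (pirr_all k) (uniq_primes F k) one_monics
  one_monics ndv kN km.
rewrite !expr0 invr1 !mulr1 => <-; apply: eq_bigr => D _; apply: eq_bigr => l _.
by rewrite !dvd1p !mul1r.
Qed.

(** An omitted prime P matters only if P^2 | D or if P divides both D and l. Each event has density
    at most |P|^-2, so the constant is 2 times the 2 of [sum_tailp]. *)
Lemma S_approx k N m : (k <= N.+1)%N ->
  (2 * degsum (primes F k) <= N)%N -> (2 * degsum (primes F k) <= m)%N ->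
  `|SR N m - Q ^+ N * Q ^+ m * \prod_(P <- primes F k) dens (csI R) P|
    <= Q ^+ N * Q ^+ m * (4 * u ^+ k).
Proof.
move=> kN1 kN km; rewrite SRE distrC -(sieve_primes (cs := csI R) _ kN km); last first.
  by move=> c; rewrite !inE => /or4P[]/eqP->.
rewrite -sumrB; under eq_bigr => D _.
  rewrite -sumrB; under eq_bigr => l _ do (under eq_bigr do rewrite locI).
  over.
pose a D l P : R := (1 - (P ^+ 2 %| D)%R%:R) * (1 - (P %| D)%R%:R * (P %| l)%R%:R).
have tl D l := prod_primes_tail kN1 (aI01 R D l).
rewrite ger0_norm; last first.
  by apply: sumr_ge0 => D _; apply: sumr_ge0 => l _; have /andP[] := tl D l.
pose x P : R := (nrm P ^+ 2)^-1.
apply: (@le_trans _ _ (\sum_(D <- monics F N) \sum_(l <- monics F m)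
   \sum_(P <- tailp F k N.+1) ((P ^+ 2 %| D)%R%:R + (P %| D)%R%:R * (P %| l)%R%:R))).
  apply: ler_sum => D _; apply: ler_sum => l _; have /andP[_ H] := tl D l.
  apply: le_trans H _; apply: ler_sum => P _.
  have := bool01 R (P ^+ 2 %| D); have := bool01 R (P %| D); have := bool01 R (P %| l).
  set b1 := (P ^+ 2 %| D)%R%:R; set b2 := (P %| D)%R%:R; set b3 := (P %| l)%R%:R.
  move=> /andP[b30 b31] /andP[b20 b21] /andP[b10 b11].
  have : 0 <= b1 * (b2 * b3) by rewrite !mulr_ge0.
  by lra.
under eq_bigr do rewrite exchange_big /=.
rewrite exchange_big /=.
apply: (@le_trans _ _ (\sum_(P <- tailp F k N.+1) Q ^+ N * Q ^+ m * (2 * x P))).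
  rewrite big_seq [leRHS]big_seq; apply: ler_sum => P.
  rewrite mem_filter mem_primes => /and3P[_ _ iP].
  under eq_bigr do rewrite big_split /= sum_monics_const -mulr_sumr.
  rewrite big_split /= -mulr_sumr -mulr_suml.
  have H1 := sum_dvd_monics_le R q4 N (monicsX 2 (pirr_in_monics iP)).
  have H2 := sum_dvd_monics_le R q4 N (pirr_in_monics iP).
  have H3 := sum_dvd_monics_le R q4 m (pirr_in_monics iP).
  have xE : (Q ^+ (2 * (size P).-1))^-1 = x P.
    by rewrite /x /poly_norm -exprM mulnC.
  have xE2 : (Q ^+ (size P).-1)^-1 * (Q ^+ (size P).-1)^-1 = x P.
    by rewrite /x /poly_norm expr2 invfM.
  rewrite xE in H1.
  have -> : Q ^+ N * Q ^+ m * (2 * x P) = Q ^+ m * (Q ^+ N * x P) +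
     (Q ^+ N * (Q ^+ (size P).-1)^-1) * (Q ^+ m * (Q ^+ (size P).-1)^-1).
    by rewrite -xE2; ring.
  apply: lerD; first by rewrite ler_wpM2l ?exprn_ge0.
  by apply: ler_pM => //; apply: sumr_ge0 => ? _; apply: ler0n.
rewrite -mulr_sumr ler_wpM2l ?mulr_ge0 ?exprn_ge0 // -mulr_sumr.
rewrite (_ : 4 = 2 * 2); last by ring.
by rewrite -mulrA ler_wpM2l // sum_tailp.
Qed.

Lemma HsE N : (size (Hs F N))%:R = \sum_(D <- monics F N)
  \prod_(P <- primes F N.+1) (1 - (P ^+ 2 %| D)%R%:R) :> R.
Proof.
transitivity (\sum_(D <- Hs F N) (1 : R)).
  by rewrite big_const_seq count_predT iter_addr_0.
by rewrite sum_Hs; apply: eq_bigr => D _; rewrite mulr1 sqfb_prod.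
Qed.

Lemma H_approx k N : (k <= N.+1)%N -> (2 * degsum (primes F k) <= N)%N ->
  `|(size (Hs F N))%:R - Q ^+ N * \prod_(P <- primes F k) dens (csH R) P|
    <= Q ^+ N * (2 * u ^+ k).
Proof.
move=> kN1 kN.
have -> : Q ^+ N * \prod_(P <- primes F k) dens (csH R) P =
   \sum_(D <- monics F N) \prod_(P <- primes F k) (1 - (P ^+ 2 %| D)%R%:R).
  have cs2 c : c \in csH R -> (c.2.1 <= 2)%N /\ (c.2.2 <= 2)%N.
    by rewrite !inE => /orP[]/eqP->.
  (* The two-variable sieve is applied with an auxiliary l of just sufficient degree m. The
     conditions [csH] do not involve l, so the factor Q^m cancels. *)
  have := sieve_primes cs2 kN (leqnn _); set m := (2 * _)%N => H.
  apply: (mulfI (_ : Q ^+ m != 0)); first by rewrite expf_neq0 // Q_neq0.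
  rewrite mulrA [Q ^+ m * _]mulrC -H mulr_sumr; apply: eq_bigr => D _.
  rewrite -sum_monics_const; apply: eq_bigr => l _; apply: eq_bigr => P _.
  exact: locH.
rewrite HsE distrC -sumrB.
have a01 D P : 0 <= (1 - (P ^+ 2 %| D)%R%:R : R) <= 1.
  have /andP[b0 b1] := bool01 R (P ^+ 2 %| D).
  by rewrite subr_ge0 b1 gerBl b0.
have tl D := prod_primes_tail kN1 (a01 D).
rewrite ger0_norm; last by apply: sumr_ge0 => D _; have /andP[] := tl D.
apply: (@le_trans _ _ (\sum_(D <- monics F N) \sum_(P <- tailp F k N.+1) (P ^+ 2 %| D)%R%:R)).
  apply: ler_sum => D _; have /andP[_ H] := tl D; apply: le_trans H _.
  by apply: ler_sum => P _; rewrite opprB addrC subrK.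
rewrite exchange_big /=.
apply: (@le_trans _ _ (\sum_(P <- tailp F k N.+1) Q ^+ N * (nrm P ^+ 2)^-1)).
  rewrite big_seq [leRHS]big_seq; apply: ler_sum => P.
  rewrite mem_filter mem_primes => /and3P[_ _ iP].
  apply: le_trans (sum_dvd_monics_le R q4 N (monicsX 2 (pirr_in_monics iP))) _.
  by rewrite /poly_norm -exprM mulnC.
by rewrite -mulr_sumr ler_wpM2l ?exprn_ge0 // sum_tailp.
Qed.

Lemma H_lower N : Q ^+ N / 2 <= (size (Hs F N))%:R.
Proof.
(* For k = 1 the product is empty, and the error 2 q^N / q is at most half of q^N because q >= 4. *)
have := @H_approx 1 N isT; rewrite primes1 /degsum !big_nil muln0 mulr1 expr1.
move=> /(_ (leq0n _)); rewrite ler_distlC => /andP[_ H].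
have u4 := QV_le R q4.
have QN : 0 <= Q ^+ N by rewrite exprn_ge0.
have : Q ^+ N * u <= Q ^+ N * 4^-1 by rewrite ler_wpM2l.
by lra.
Qed.

Definition epart k : R := \prod_(P <- primes F k) efac R P.

Lemma efac01 P : 0 <= efac R P <= 1.
Proof.
have x1 : 1 <= nrm P by rewrite /poly_norm exprn_ege1 // ler1n; lia.
have x2 : 1 <= (nrm P + 1) * nrm P by nra.
rewrite /efac subr_ge0 invf_le1 ?(lt_le_trans ltr01) // x2 /= gerBl invr_ge0.
by rewrite (le_trans ler01).
Qed.

Lemma epart01 k : 0 <= epart k <= 1.
Proof. by apply: prod_unit => P _; apply: efac01. Qed.

Lemma ratio_approx k N m : (k <= N.+1)%N ->
  (2 * degsum (primes F k) <= N)%N -> (2 * degsum (primes F k) <= m)%N ->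
  `|SR N m / (Q ^+ m * (size (Hs F N))%:R) - epart k| <= 12 * u ^+ k.
Proof.
move=> kN1 kN km; have HS := S_approx kN1 kN km; have HH := H_approx kN1 kN.
set h := (size (Hs F N))%:R in HH *; set S := SR N m in HS *.
have QN : 0 < Q ^+ N by rewrite exprn_gt0 // Q_gt0.
have Qm : 0 < Q ^+ m by rewrite exprn_gt0 // Q_gt0.
have hl : Q ^+ N / 2 <= h := H_lower N.
have h0 : 0 < h by apply: lt_le_trans hl; rewrite divr_gt0.
have /andP[e0 e1] := epart01 k.
pose p := \prod_(P <- primes F k) dens (csH R) P.
have pE : \prod_(P <- primes F k) dens (csI R) P = p * epart k.
  by rewrite /p /epart -big_split; apply: eq_bigr => P _; rewrite densI.
rewrite pE in HS; rewrite -/p in HH.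
set e := epart k in e0 e1 HS *; set v := u ^+ k in HS HH *.
have v0 : 0 <= v by rewrite exprn_ge0.
have -> : S / (Q ^+ m * h) - e = (S - Q ^+ m * h * e) / (Q ^+ m * h).
  by rewrite mulrBl mulrAC divff ?mul1r // mulf_neq0 // gt_eqF.
rewrite normrM normfV (gtr0_norm (mulr_gt0 Qm h0)) ler_pdivrMr ?mulr_gt0 //.
(* 6 = 4 + 2 adds the errors of [S_approx] and [H_approx]; dividing by h >= Q^N / 2 doubles it to
   12. *)
have : `|S - Q ^+ m * h * e| <= Q ^+ N * Q ^+ m * (6 * v).
  have -> : S - Q ^+ m * h * e = (S - Q ^+ N * Q ^+ m * (p * e)) - Q ^+ m * e * (h - Q ^+ N * p).
    by ring.
  apply: le_trans (ler_normB _ _) _.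
  have : `|Q ^+ m * e * (h - Q ^+ N * p)| <= Q ^+ m * 1 * (Q ^+ N * (2 * v)).
    rewrite normrM; apply: ler_pM => //.
    by rewrite ger0_norm ?ler_wpM2l ?mulr_ge0 // ltW.
  move=> H2; apply: le_trans (lerD HS H2) _.
  by rewrite [leLHS](_ : _ = Q ^+ N * Q ^+ m * (6 * v)) //; ring.
move=> /le_trans; apply.
have : Q ^+ N * (Q ^+ m * v) <= (2 * h) * (Q ^+ m * v).
  by rewrite ler_wpM2r ?(mulr_ge0 (ltW Qm) v0) //; lra.
move=> H; rewrite [leLHS](_ : _ = 6 * (Q ^+ N * (Q ^+ m * v))); last by ring.
rewrite [leRHS](_ : _ = 6 * (2 * h * (Q ^+ m * v))); last by ring.
by rewrite ler_wpM2l.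
Qed.

Lemma ratio01 N m : 0 <= SR N m / (Q ^+ m * (size (Hs F N))%:R) <= 1.
Proof.
have Qm : 0 < Q ^+ m by rewrite exprn_gt0 // Q_gt0.
have h0 : 0 < (size (Hs F N))%:R :> R.
  by apply: lt_le_trans (H_lower N); rewrite divr_gt0 // exprn_gt0 // Q_gt0.
have S0 : 0 <= SR N m.
  rewrite /SR ler0z; apply: sumr_ge0 => l _; apply: sumr_ge0 => D _.
  by case: coprimep.
apply/andP; split; first by rewrite divr_ge0 // mulr_ge0 // ltW.
rewrite ler_pdivrMr ?mulr_gt0 // mul1r.
have -> : Q ^+ m * (size (Hs F N))%:R = (#|F|%:R ^+ m * (size (Hs F N))%:R : int)%:~R.
  by rewrite rmorphM rmorphXn /= !rmorph_nat.
rewrite ler_int -sum_monics_const; apply: ler_sum => l _.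
have -> : (size (Hs F N))%:R = \sum_(D <- Hs F N) (1 : int).
  by rewrite big_const_seq count_predT iter_addr_0.
by apply: ler_sum => D _; case: coprimep.
Qed.

End Densities.

(** * The mean value *)

Section MeanValue.
Variables (R : realType) (F : finFieldType).
Hypothesis oddF : odd #|F|.
Hypothesis q4 : (4 <= #|F|)%N.
Local Notation Q := (#|F|%:R : R).
Local Notation u := (#|F|%:R^-1 : R).
Implicit Types (f P D : {poly F}).

Lemma squarefreeE D : D != 0 -> squarefree D <-> sqf D.
Proof.
move=> D0; split=> [sD P iP|sD h sh]; first by apply: sD; rewrite gtn_eqF ?pirr_size.
apply/negP => hD; have h0 : h != 0.
  by apply: contraNneq D0 => h0; rewrite h0 expr0n dvd0p in hD.
have sh1 : (1 < size h)%N by rewrite ltn_neqAle eq_sym sh size_poly_gt0.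
have [P iP dP] := pirr_divisor sh1.
by case/negP: (sD P iP); apply: dvdp_trans hD; apply: dvdp_exp2r.
Qed.

Lemma mem_Hs g D : (D \in Hs F (2 * g + 1)) =
  [&& size D == (2 * g + 2)%N, D \is monic & `[< squarefree D >]].
Proof.
rewrite mem_filter mem_monics (addnS _ 1).
have [mD|] := boolP (D \is monic); last by rewrite !andbF.
have [sD|] := eqVneq (size D) (2 * g + 1).+1; last by rewrite !andbF.
have DN : D \in monics F (2 * g + 1) by rewrite mem_monics mD sD eqxx.
rewrite !andbT /=; apply/(sqfbE DN (ltnSn _))/asboolP => H; apply/squarefreeE => //.
  exact: monic_neq0.
exact: monic_neq0.
Qed.

Lemma sum_hyper (S : nmodType) g (E : {poly F} -> S) :
  \sum_(D in hyper_ensemble F g) E D = \sum_(D <- Hs F (2 * g + 1)) E D.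
Proof.
rewrite -big_enum /=; symmetry.
apply: (big_bij (h := fun D : {poly_(2 * g + 2) F} => D : {poly F})).
- exact: enum_uniq.
- by rewrite filter_uniq // uniq_monics.
- by move=> D D' _ _; apply: val_inj.
move=> D; rewrite mem_Hs; split=> [H|[x]].
  have sD : (size D <= 2 * g + 2)%N by case/andP: H => /eqP->.
  exists (NPoly (sD : D \is a poly_of_size (2 * g + 2))) => //.
  by rewrite mem_enum inE.
by rewrite mem_enum inE => H ->.
Qed.

Lemma card_hyper g : #|hyper_ensemble F g|%:R = (size (Hs F (2 * g + 1)))%:R :> R.
Proof.
rewrite -sum1_card natr_sum (sum_hyper g (fun=> 1)).
by rewrite big_const_seq count_predT iter_addr_0.
Qed.

Definition sq : R := Q `^ (- 2^-1).

Lemma sq_gt0 : 0 < sq.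
Proof. by rewrite powR_gt0 // Q_gt0. Qed.

Lemma sq2 : sq ^+ 2 = u.
Proof.
have Q0 := Q_gt0 R q4.
rewrite /sq -powR_mulrn ?powR_ge0 // -powRrM mulNr mulVf ?pnatr_eq0 //.
by rewrite powRN powRr1 // ltW.
Qed.

Lemma sq_le1 : sq <= 1.
Proof.
rewrite -(@expr_le1 _ 2) ?(ltW sq_gt0) // sq2.
by apply: le_trans (QV_le R q4) _; lra.
Qed.

Lemma L_value g D : D \in Hs F (2 * g + 1) ->
  (map_poly intr (zeta_numerator D)).[sq] =
  \sum_(n < g.+1) (Lcoef D n)%:~R * sq ^+ n + \sum_(n < g) (Lcoef D n)%:~R * sq ^+ n.
Proof.
rewrite mem_Hs => /and3P[/eqP sD mD /asboolP sfD].
have sqD : sqf D by apply/squarefreeE; rewrite ?monic_neq0.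
rewrite (zeta_numeratorE oddF sD sqD).
rewrite (@horner_coef_wide _ (2 * g).+1); last first.
  by rewrite (leq_trans (size_poly _ _)) // size_poly.
under eq_bigr => i _ do rewrite coef_map coef_poly ltn_ord /=.
rewrite -(big_mkord predT (fun i => (Lcoef D i)%:~R * sq ^+ i)).
rewrite (@big_cat_nat _ _ _ g.+1) //=; last by rewrite ltnS mul2n -addnn leq_addr.
rewrite big_mkord; congr (_ + _); rewrite big_nat_rev /= -{1}[g.+1]add0n big_addn.
rewrite (_ : (2 * g).+1 - g.+1 = g)%N; last by lia.
rewrite big_mkord; apply: eq_bigr => i _; have ig := ltn_ord i.
rewrite (_ : g.+1 + (2 * g).+1 - (i + g.+1).+1 = 2 * g - i)%N; last by lia.
rewrite (Lcoef_sym sD oddF sqD) ?(ltnW ig) //.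
(* At u = q^(-1/2) the factor q^(g-i) of the functional equation cancels u^(2(g-i)), so the terms of
   index i and 2g - i are equal. *)
rewrite (_ : (2 * g - i)%N = (2 * (g - i) + i)%N); last by lia.
rewrite exprD exprM sq2 rmorphM rmorphXn /= rmorph_nat.
have Qn : Q ^+ (g - i) != 0 by rewrite expf_neq0 // Q_neq0.
by rewrite exprVn; field.
Qed.

Definition Tsum g n : R := (\sum_(D <- Hs F (2 * g + 1)) Lcoef D n)%:~R.
Local Notation hcard g := ((size (Hs F (2 * g + 1)))%:R : R).

Lemma mean_valueE g : mean_zeta_numerator R F g =
  \sum_(n < g.+1) sq ^+ n * Tsum g n / hcard g + \sum_(n < g) sq ^+ n * Tsum g n / hcard g.
Proof.
rewrite /mean_zeta_numerator card_hyper -/sq.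
rewrite (sum_hyper g (fun D => (map_poly intr (zeta_numerator D)).[sq])).
rewrite (eq_big_seq _ (@L_value g)) big_split /= mulrDr.
by congr (_ + _); rewrite exchange_big mulr_sumr; apply: eq_bigr => n _;
  rewrite -mulr_suml /Tsum rmorph_sum /= mulrC -mulrA [_ * sq ^+ _]mulrC mulrA.
Qed.

(** For even n the weight q^(-n/2) is the inverse of the number of l of degree n/2, so this is the
    proportion of pairs (D, l) that are coprime. *)
Definition tau_main g n : R :=
  if odd n then 0 else SR R F (2 * g + 1) n./2 / (Q ^+ n./2 * hcard g).

(** The condition N < n + 2a means a > (N - n)/2, and each such a contributes at most q^a q^(N-2a) =
    q^N u^a: a geometric tail. *)
Lemma Bbound_le N n : (n <= N)%N ->
  (Bbound F N n)%:~R <= Q ^+ N * (2 * u ^+ ((N - n)./2).+1) :> R.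
Proof.
move=> nN; set a0 := ((N - n)./2).+1.
apply: (@le_trans _ _ (Q ^+ N * \sum_(a < N.+1) (if (a0 <= a)%N then u ^+ a else 0))).
  rewrite rmorph_sum mulr_sumr; apply: ler_sum => a _.
  rewrite rmorphM rmorphXn /= rmorph_nat; case: ifP => [/andP[aN Na]|_]; last first.
    by rewrite rmorph0 mulr0 mulr_ge0 ?exprn_ge0 //; case: ifP => // _; rewrite exprn_ge0 ?invr_ge0.
  have -> : (a0 <= a)%N.
    rewrite /a0 -ltn_double; have := odd_double_half (N - n).
    by rewrite -!mul2n; case: (odd _) => /=; lia.
  rewrite rmorphXn /= rmorph_nat -exprD exprVn.
  have -> : Q ^+ N = Q ^+ (a + (N - 2 * a)) * Q ^+ a.
    by rewrite -exprD; congr (_ ^+ _); lia.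
  by rewrite mulfK // expf_neq0 // Q_neq0.
rewrite ler_wpM2l ?exprn_ge0 //; apply: geo_tail; first by rewrite invr_ge0.
by apply: le_trans (QV_le R q4) _; lra.
Qed.

Lemma main_error g n : (n <= g)%N ->
  `|sq ^+ n * Tsum g n / hcard g - tau_main g n| <= 4 * u ^+ (g.+1 - n).
Proof.
move=> ng; set N := (2 * g + 1)%N; set h := hcard g.
have hl : Q ^+ N / 2 <= h := H_lower R q4 N.
have QN : 0 < Q ^+ N by rewrite exprn_gt0 // Q_gt0.
have h0 : 0 < h by apply: lt_le_trans hl; rewrite divr_gt0.
have sn0 : 0 < sq ^+ n by rewrite exprn_gt0 // sq_gt0.
have Qn0 : 0 < Q ^+ n by rewrite exprn_gt0 // Q_gt0.
have Qs : Q ^+ n * (sq ^+ n * sq ^+ n) = 1.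
  by rewrite -exprMn -expr2 sq2 exprVn divff // gt_eqF.
have -> : tau_main g n =
   sq ^+ n * ((if odd n then 0 else Ssum F N n./2) : int)%:~R / h.
  rewrite /tau_main; case: ifP => [_|on]; first by rewrite mulr0 mul0r.
  have nE : n = (2 * n./2)%N by rewrite mul2n even_halfK // on.
  have -> : sq ^+ n = u ^+ n./2 by rewrite {1}nE exprM sq2.
  rewrite exprVn invfM -/h /SR -/N; set z := (_)%:~R; set w := (Q ^+ _)^-1.
  by ring.
rewrite -mulrBl -mulrBr -rmorphB /= normrM normrM normfV (gtr0_norm sn0) (gtr0_norm h0).
rewrite -intr_norm ler_pdivrMr //.
have := sum_Lcoef oddF N n; rewrite -(ler_int R) rmorphM rmorphXn /= rmorph_nat => H1.
have nN : (n <= N)%N by rewrite /N; lia.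
have H2 := Bbound_le nN; set a0 := ((N - n)./2).+1 in H2.
apply: le_trans (ler_wpM2l (ltW sn0) (le_trans H1 (ler_wpM2l (ltW Qn0) H2))) _.
(* Half of the saving u^a0, that is sq^(2 a0), is spent as sq^n: together with the weight sq^n it
   cancels the number q^n of conductors, and u^(g+1-n) is left. *)
have a0n : (2 * (g.+1 - n) + n <= 2 * a0)%N.
  rewrite /a0; have := odd_double_half (N - n); rewrite /N -!mul2n.
  by case: (odd _) => /=; lia.
have key : u ^+ a0 <= u ^+ (g.+1 - n) * sq ^+ n.
  rewrite -sq2 -!exprM -exprD ler_wiXn2l ?(ltW sq_gt0) ?sq_le1 //.
have -> : sq ^+ n * (Q ^+ n * (Q ^+ N * (2 * u ^+ a0))) =
   2 * Q ^+ N * (Q ^+ n * sq ^+ n * u ^+ a0) by ring.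
apply: (@le_trans _ _ (2 * Q ^+ N * (Q ^+ n * sq ^+ n * (u ^+ (g.+1 - n) * sq ^+ n)))).
  by rewrite ler_wpM2l ?mulr_ge0 ?(ltW QN) // ler_wpM2l // mulr_ge0 ?ltW.
have -> : Q ^+ n * sq ^+ n * (u ^+ (g.+1 - n) * sq ^+ n) = u ^+ (g.+1 - n).
  set v := u ^+ _; transitivity (v * (Q ^+ n * (sq ^+ n * sq ^+ n))); first by ring.
  by rewrite Qs mulr1.
have v0 : 0 <= u ^+ (g.+1 - n) by rewrite exprn_ge0 // invr_ge0.
rewrite [leRHS](_ : _ = 2 * (2 * h) * u ^+ (g.+1 - n)); last by ring.
by rewrite ler_wpM2r // ler_wpM2l //; lra.
Qed.

Lemma geo_sum j : \sum_(n < j) u ^+ (j - n) <= 1.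
Proof.
have u0 : 0 <= u by rewrite invr_ge0.
have u4 := QV_le R q4.
elim: j => [|j IH]; first by rewrite big_ord0.
rewrite big_ord_recr /= subSnn expr1.
rewrite (_ : \sum_(i < j) _ = u * \sum_(i < j) u ^+ (j - i)); last first.
  rewrite mulr_sumr; apply: eq_bigr => i _.
  by rewrite subSn ?exprS // ltnW.
have : u * \sum_(i < j) u ^+ (j - i) <= u * 1 by rewrite ler_wpM2l.
by lra.
Qed.

Lemma sum_main_error g j : (j <= g.+1)%N ->
  `|\sum_(n < j) sq ^+ n * Tsum g n / hcard g - \sum_(n < j) tau_main g n| <= 4.
Proof.
move=> jg; rewrite -sumrB; apply: le_trans (ler_norm_sum _ _ _) _.
apply: (@le_trans _ _ (\sum_(n < j) 4 * u ^+ (j - n))).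
  apply: ler_sum => n _; have nj := ltn_ord n.
  apply: le_trans (main_error _) _; first by rewrite -ltnS (leq_trans nj).
  rewrite ler_wpM2l // ler_wiXn2l ?invr_ge0 //.
    by apply: le_trans (QV_le R q4) _; lra.
  by rewrite leq_sub2r.
by rewrite -mulr_sumr -[leRHS]mulr1 ler_wpM2l // geo_sum.
Qed.

Lemma sum_lt_ord j c : \sum_(n < j) (if (n < c)%N then 1 else 0) = (minn j c)%:R :> R.
Proof.
elim: j => [|j IH]; first by rewrite big_ord0 min0n.
rewrite big_ord_recr /= IH; case: ltnP => jc.
  by rewrite (minn_idPl jc) natr1.
by rewrite addr0 (minn_idPr (leqW jc)).
Qed.

(** [uphalf j] counts the even n < j. The sieve needs n/2 >= 2 degsum, so each n below 4 degsum is
    charged 1 by [ratio01]; this cost does not grow with g for fixed k. *)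
Lemma tau_main_approx g k E j (e : R) :
  0 <= E <= 1 -> 0 <= e -> `|epart R F k - E| + 12 * u ^+ k <= e ->
  (k <= 2 * g + 2)%N -> (2 * degsum (primes F k) <= 2 * g + 1)%N ->
  `|\sum_(n < j) tau_main g n - (uphalf j)%:R * E| <=
     (4 * degsum (primes F k))%:R + j%:R * e.
Proof.
move=> /andP[E0 E1] e0 ke kg dg; set M := degsum _ in dg *.
have -> : (uphalf j)%:R * E = \sum_(n < j) (if odd n then 0 else E).
  elim: j => [|j IH]; first by rewrite big_ord0 mul0r.
  rewrite big_ord_recr /= -IH [in RHS]uphalf_half; case: (odd j).
    by rewrite addr0 add1n.
  by rewrite add0n -natr1 mulrDl mul1r.
rewrite -sumrB; apply: le_trans (ler_norm_sum _ _ _) _.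
apply: (@le_trans _ _ (\sum_(n < j) ((if (n < 4 * M)%N then 1 else 0) + e))).
  apply: ler_sum => n _; rewrite /tau_main; case: ifP => on.
    by rewrite subrr normr0 addr_ge0 //; case: ifP.
  have /andP[t0 t1] := ratio01 R q4 (2 * g + 1) n./2.
  case: ltnP => nM.
    apply: (@le_trans _ _ 1); last by rewrite lerDl.
    by rewrite ler_norml; lra.
  rewrite add0r; apply: le_trans ke; rewrite [leRHS]addrC.
  rewrite -[X in `|X - _|](subrK (epart R F k)) -addrA.
  apply: le_trans (ler_normD _ _) _; rewrite lerD2r.
  apply: ratio_approx => //; first by rewrite -addnS.
  have nE : n = (2 * n./2)%N :> nat by rewrite mul2n even_halfK // on.
  by move: nM; rewrite {1}nE; lia.
rewrite big_split /= sumr_const card_ord -[e *+ _]mulr_natl lerD2r.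
by rewrite sum_lt_ord ler_nat geq_minr.
Qed.

End MeanValue.

(** * Convergence of the Euler product and the asymptotic estimate *)

Section EulerProductLimit.
Variables (R : realType) (F : finFieldType).
Hypothesis q4 : (4 <= #|F|)%N.
Local Notation Q := (#|F|%:R : R).
Local Notation u := (#|F|%:R^-1 : R).

Lemma euler_partE n : \prod_(P : {poly_n F} |
    ((P : {poly F}) \is monic) && `[< irreducible_poly (P : {poly F}) >])
    (1 - ((poly_norm R P + 1) * (poly_norm R P `^ 1))^-1) = epart R F n.
Proof.
rewrite /epart /primes /polys big_filter big_map big_enum_cond /=.
apply: eq_big => [P|P _].
  by rewrite /pirr; congr (_ && _); apply/asboolP/irreducibleP.
by rewrite powRr1 // ltW // nrm_gt0.
Qed.

Lemma euler_prodE : euler_prod F (1 : R) = limn (epart R F).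
Proof. by rewrite /euler_prod; congr (limn _); apply/funext => n; apply: euler_partE. Qed.

Lemma epart_noninc : nonincreasing_seq (epart R F).
Proof.
apply/nonincreasing_seqP => n.
have := prod_primes_tail (leqnSn n) (@efac01 R F q4).
by move=> /andP[]; rewrite subr_ge0.
Qed.

(** No prime has degree 0, each factor differs from 1 by at most |P|^-2, and these sum to at most
    2/q <= 1/2. The positive lower bound is what turns an error o(g) into a relative one. *)
Lemma epart_ge n : 2^-1 <= epart R F n.+1.
Proof.
have := @prod_primes_tail R F 1 n.+1 _ (ltn0Sn n) (@efac01 R F q4).
rewrite primes1 big_nil => /andP[_ H].
have H2 : \sum_(P <- tailp F 1 n.+1) (1 - efac R P) <= 2 * u ^+ 1.
  apply: le_trans (sum_tailp R q4 1 n.+1); apply: ler_sum => P _.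
  have x0 := nrm_gt0 R q4 P; rewrite /efac opprB addrC subrK expr2.
  by rewrite lef_pV2 ?posrE ?mulr_gt0 ?addr_gt0 // ler_wpM2r ?lerDl // ltW.
have := QV_le R q4; rewrite expr1 in H2.
by move: H H2; rewrite /epart; lra.
Qed.

Lemma epart_cvg : epart R F @ \oo --> euler_prod F (1 : R).
Proof.
rewrite euler_prodE; apply: nonincreasing_is_cvgn; first exact: epart_noninc.
exists 0 => _ [n _ <-]; by have /andP[] := epart01 R q4 n.
Qed.

Lemma euler_prod_bounds : 2^-1 <= euler_prod F (1 : R) <= 1.
Proof.
have cv : cvgn (epart R F) by apply/cvg_ex; exists (euler_prod F (1 : R)); exact: epart_cvg.
rewrite euler_prodE; apply/andP; split.
  apply: limr_ge => //; exists 1%N => // n /= n1.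
  by rewrite -(prednK n1) epart_ge.
by apply: limr_le => //; exists 0%N => // n _; have /andP[] := epart01 R q4 n.
Qed.

Lemma mean_approx (e : R) : odd #|F| -> 0 < e -> exists (C : R) (g0 : nat),
  forall g, (g0 <= g)%N ->
  `|mean_zeta_numerator R F g - 2^-1 * euler_prod F (1 : R) * (2 * g + 1)%:R|
    <= C + e * (2 * g + 1)%:R.
Proof.
move=> oddF e0; have e20 : 0 < e / 2 by rewrite divr_gt0.
have [k ke] : exists k, `|epart R F k - euler_prod F (1 : R)| + 12 * u ^+ k <= e.
  have u1 : `|u| < 1.
    by rewrite ger0_norm ?invr_ge0 //; apply: le_lt_trans (QV_le R q4) _; lra.
  have /cvgrPdist_le/(_ _ e20)[n1 _ H1] := epart_cvg.
  have e24 : 0 < e / 24 by rewrite divr_gt0.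
  have /cvgrPdist_le/(_ _ e24)[n2 _ H2] := cvg_expr u1.
  exists (maxn n1 n2); have /= h1 := H1 (maxn n1 n2) (leq_maxl _ _).
  have /= h2 := H2 (maxn n1 n2) (leq_maxr _ _).
  rewrite sub0r normrN ger0_norm ?exprn_ge0 ?invr_ge0 // in h2.
  by rewrite distrC; lra.
set M := degsum (primes F k); set E := euler_prod F (1 : R) in ke *.
have /andP[E0 E1] := euler_prod_bounds; rewrite -/E in E0 E1.
(* Each of the two ranges of n costs 4 from [sum_main_error] and 4M from [tau_main_approx], and E/2
   <= 1 is added. Taking g >= k + M makes the degree conditions of the sieve hold. *)
exists (9 + 8 * M%:R), (k + M)%N => g gk.
have E01 : 0 <= E <= 1 by rewrite E1 andbT; lra.
have kg : (k <= 2 * g + 2)%N by lia.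
have Mg : (2 * M <= 2 * g + 1)%N by lia.
have B1 := tau_main_approx oddF q4 g.+1 E01 (ltW e0) ke kg Mg.
have B2 := tau_main_approx oddF q4 g E01 (ltW e0) ke kg Mg.
have A1 := sum_main_error R oddF q4 (leqnn g.+1).
have A2 := sum_main_error R oddF q4 (leqnSn g).
rewrite mean_valueE //.
move: A1 A2 B1 B2; set a1 := \sum_(n < g.+1) _; set b1 := \sum_(n < g.+1) _.
set a2 := \sum_(n < g) _; set b2 := \sum_(n < g) _.
(* The two ranges contain g + 1 even indices in all, against (2g + 1)/2 in the claim: hence the
   extra E/2. *)
have gE : (uphalf g.+1)%:R * E + (uphalf g)%:R * E = (g%:R + 1) * E.
  by rewrite -mulrDl -natrD natr1 uphalfE /= uphalf_half addSn addnCA addnn odd_double_half.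
rewrite -/M natrM -[g.+1%:R]natr1 => A1 A2 B1 B2.
have -> : a1 + a2 - 2^-1 * E * (2 * g + 1)%:R =
  (a1 - b1) + (a2 - b2) + (b1 - (uphalf g.+1)%:R * E) + (b2 - (uphalf g)%:R * E) + 2^-1 * E.
  have -> : (2 * g + 1)%:R = 2 * g%:R + 1 :> R by rewrite natrD natrM.
  by move: gE; lra.
have -> : (2 * g + 1)%:R = 2 * g%:R + 1 :> R by rewrite natrD natrM.
apply: le_trans (ler_normD _ _) _; rewrite [`|2^-1 * E|]ger0_norm; last by lra.
have T1 := ler_normD (a1 - b1 + (a2 - b2) + (b1 - (uphalf g.+1)%:R * E)) (b2 - (uphalf g)%:R * E).
have T2 := ler_normD (a1 - b1 + (a2 - b2)) (b1 - (uphalf g.+1)%:R * E).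
have T3 := ler_normD (a1 - b1) (a2 - b2).
have {}B1 := le_trans B1 (lexx _); have {}B2 := le_trans B2 (lexx _).
apply: (@le_trans _ _ ((4 + 4 + (4 * M%:R + (g%:R + 1) * e) + (4 * M%:R + g%:R * e)) + 1)).
  apply: lerD; last by lra.
  apply: le_trans T1 _; apply: lerD => //; apply: le_trans T2 _; apply: lerD => //.
  by apply: le_trans T3 _; apply: lerD.
by rewrite [leLHS](_ : _ = 9 + 8 * M%:R + e * (2 * g%:R + 1)) //; ring.
Qed.

End EulerProductLimit.

Lemma log_base_exp (R : realType) (b : R) n : 1 < b -> log_base b (b ^+ n) = n%:R.
Proof.
move=> b1; have b0 : 0 < b by apply: lt_trans b1.
by rewrite /log_base lnXn // -[ln b *+ n]mulr_natl mulfK // gt_eqF // ln_gt0.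
Qed.

Theorem corollary1 (R : realType) (F : finFieldType)
    (hq : (#|F| = 1 %[mod 4])%N) :
  [/\ forall (g : nat) (D : {poly_(2 * g + 2) F}),
        (0 < g)%N -> D \in hyper_ensemble F g ->
        poly_norm R D = #|F|%:R ^+ (2 * g + 1),
      (fun g => mean_zeta_numerator R F g) ~_\oo
        (fun g => 2^-1 * euler_prod F (1 : R)
                  * log_base #|F|%:R (#|F|%:R ^+ (2 * g + 1)))
    & forall g : nat, (0 < g)%N ->
        2^-1 * euler_prod F (1 : R)
          * log_base #|F|%:R (#|F|%:R ^+ (2 * g + 1))
        = 2^-1 * euler_prod F (1 : R) * (2 * g + 1)%:R].
Proof.
have F1 := finNzRing_gt1 F.
have q4 : (4 <= #|F|)%N.
  rewrite leqNgt; apply/negP => F4; move: hq F1; rewrite modn_small //.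
  by move=> ->.
have oddF : odd #|F|.
  by rewrite (divn_eq #|F| 4) hq oddD oddM andbF.
have Q1 : 1 < #|F|%:R :> R by rewrite ltr1n.
have logE g : log_base (#|F|%:R : R) (#|F|%:R ^+ (2 * g + 1)) = (2 * g + 1)%:R.
  exact: log_base_exp.
split=> [g D _||g _]; last by rewrite logE.
  by rewrite inE => /and3P[/eqP sD _ _]; rewrite /poly_norm sD addn2 addn1.
have /andP[E0 E1] := euler_prod_bounds R q4.
apply/eqaddoP => e e0.
(* As E >= 1/2, the allowed error is at least e/4 times 2g + 1. One half of it, e/8, goes to the
   linear term, and the other absorbs C once g exceeds 8 |C| / e. *)
have [C [g0 H]] := mean_approx q4 oddF (divr_gt0 e0 (ltr0Sn R 7)).
pose g1 := Num.bound (8 * `|C| / e).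
exists (maxn g0 g1) => // g /= gg.
have {}H := H g (leq_trans (leq_maxl _ _) gg).
rewrite -[X in `|X|]/(mean_zeta_numerator R F g - 2^-1 * euler_prod F 1 *
   log_base #|F|%:R (#|F|%:R ^+ (2 * g + 1))) logE.
apply: le_trans H _; set E := euler_prod F 1 in E0 E1 *.
rewrite [`|2^-1 * E * _|]ger0_norm; last by rewrite !mulr_ge0 //; lra.
have Cg : 8 * `|C| <= e * g%:R.
  rewrite [leRHS]mulrC -ler_pdivrMr //; apply: ltW.
  apply: lt_le_trans (archi_boundP _) _; first by rewrite divr_ge0 ?mulr_ge0 // ltW.
  by rewrite ler_nat (leq_trans (leq_maxr _ _) gg).
set m : R := (2 * g + 1)%:R.
have gm : g%:R <= m by rewrite ler_nat; lia.
have CC := ler_norm C.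
have m0 : 0 <= m by rewrite ler0n.
have h1 : e * g%:R <= e * m by rewrite ler_wpM2l // ltW.
have h2 : e * (2^-1 * 2^-1 * m) <= e * (2^-1 * E * m).
  by rewrite ler_wpM2l ?(ltW e0) // ler_wpM2r // ler_wpM2l.
by move: h1 h2 Cg CC; lra.
Qed.
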